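(* Let $t>0$ and $s>1$ with $s-2t<1$, and let $$b(x)=\sum_{n=1}^\infty n^{-s}\cos(n^{-t}x_1)+\sum_{n=1}^\infty n^{-s}\cos(n^{-t}x_2),\qquad x=(x_1,x_2)\in\mathbb{R}^2.$$ Let $H$ be the two-dimensional Pauli operator with magnetic field $b$ and zero electric potential. Then $\dim\operatorname{Ker}H=\infty$.
   Context: Pauli operator: for a bounded continuous $b:\mathbb{R}^2\to\mathbb{R}$ choose $A=(A_1,A_2)\in C^1(\mathbb{R}^2;\mathbb{R}^2)$ with $\partial_{x_1}A_2-\partial_{x_2}A_1=b$, let $h=(-i\nabla-A)^2$ be the self-adjoint operator in $L^2(\mathbb{R}^2)$ generated by the closure of the form $\int_{\mathbb{R}^2}|i\nabla u+Au|^2dx$, $u\in C_0^\infty(\mathbb{R}^2)$, and put $H=\begin{pmatrix}h-b&0\\0&h+b\end{pmatrix}$ in $L^2(\mathbb{R}^2;\mathbb{C}^2)$. Different choices of $A$ give unitarily equivalent operators (gauge invariance), so $\dim\operatorname{Ker}H$ depends only on $b$. *)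

(* Defs.v *)
From HB Require Import structures.
From mathcomp Require Import all_boot all_order all_algebra.
From mathcomp Require Import complex.
From mathcomp Require Import all_classical all_reals all_analysis.

Set Implicit Arguments.
Unset Strict Implicit.
Unset Printing Implicit Defensive.

Import Order.TTheory GRing.Theory Num.Theory.
Import numFieldNormedType.Exports.

Local Open Scope classical_set_scope.
Local Open Scope ring_scope.
Local Open Scope complex_scope.

Section Pauli.
Variable R : realType.

Local Notation plane := (R * R)%type.

Local Notation area := ((@lebesgue_measure R \x @lebesgue_measure R)%E).

Definition e1 : plane := (1, 0).
Definition e2 : plane := (0, 1).

Fixpoint Ck (k : nat) (f : plane -> R) : Prop :=
  if k is k'.+1 then
    [/\ continuous f,
        forall x, derivable f x e1 /\ derivable f x e2,
        Ck k' (fun x => 'D_e1 f x) & Ck k' (fun x => 'D_e2 f x)]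
  else continuous f.

Definition rePart (u : plane -> R[i]) : plane -> R := fun x => complex.Re (u x).
Definition imPart (u : plane -> R[i]) : plane -> R := fun x => complex.Im (u x).

Definition test_function (u : plane -> R[i]) : Prop :=
  (forall k, Ck k (rePart u) /\ Ck k (imPart u)) /\
  compact (closure [set x | u x != 0]).

(* L^2 classes are handled through measurable representatives: all the L^2
   notions below are insensitive to the choice of the representative. *)
Definition L2 (u : plane -> R[i]) : Prop :=
  rePart u \in Lfun area 2%:E /\ imPart u \in Lfun area 2%:E.

Definition sqmod (z : R[i]) : R := complex.Re z ^+ 2 + complex.Im z ^+ 2.

Definition cintegral (u : plane -> R[i]) : R[i] :=
  Rintegral area setT (rePart u) +i* Rintegral area setT (imPart u).

Definition inner (u v : plane -> R[i]) : R[i] :=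
  cintegral (fun x => u x * conjc (v x)).

Definition cpartial (v : plane) (u : plane -> R[i]) (x : plane) : R[i] :=
  'D_v (rePart u) x +i* 'D_v (imPart u) x.

Definition vector_potential (b : plane -> R) (A : plane -> R * R) : Prop :=
  [/\ Ck 1 (fun x => (A x).1), Ck 1 (fun x => (A x).2) &
      forall x, 'D_e1 (fun y => (A y).2) x - 'D_e2 (fun y => (A y).1) x = b x].

Section MagneticOperator.
Variable A : plane -> R * R.

(* the two components of i grad u + A u *)
Definition mgrad1 (u : plane -> R[i]) (x : plane) : R[i] :=
  'i%C * cpartial e1 u x + (A x).1%:C * u x.
Definition mgrad2 (u : plane -> R[i]) (x : plane) : R[i] :=
  'i%C * cpartial e2 u x + (A x).2%:C * u x.

Definition qform (u : plane -> R[i]) : R :=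
  Rintegral area setT (fun x => sqmod (mgrad1 u x) + sqmod (mgrad2 u x)).

Definition sform (u v : plane -> R[i]) : R[i] :=
  inner (mgrad1 u) (mgrad1 v) + inner (mgrad2 u) (mgrad2 v).

Definition form_approx (phi : nat -> plane -> R[i]) (u : plane -> R[i]) : Prop :=
  [/\ L2 u, forall n, test_function (phi n),
      (fun n => Rintegral area setT (fun x => sqmod (phi n x - u x))) @ \oo
        --> (0 : R) &
      forall eps : R, 0 < eps -> exists N : nat, forall m n : nat,
        (N <= m)%N -> (N <= n)%N -> qform (fun x => phi m x - phi n x) < eps].

Definition form_domain (u : plane -> R[i]) : Prop :=
  exists phi, form_approx phi u.

(* [closed_form u v z]: the closure of the form takes the value z at (u, v).
   The form being closable, z does not depend on the approximating sequences. *)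
Definition closed_form (u v : plane -> R[i]) (z : R[i]) : Prop :=
  exists phi psi : nat -> plane -> R[i],
    [/\ form_approx phi u, form_approx psi v &
        (fun n => sqmod (sform (phi n) (psi n) - z)) @ \oo --> (0 : R)].

(* The graph of the self-adjoint operator h generated by the closed form. *)
Definition magnetic_op (u f : plane -> R[i]) : Prop :=
  [/\ form_domain u, L2 f &
      forall v, form_domain v -> closed_form u v (inner f v)].

Definition spinor := ((plane -> R[i]) * (plane -> R[i]))%type.

(* The graph of H = diag (h - b, h + b), b bounded. *)
Definition pauli_op (b : plane -> R) (psi eta : spinor) : Prop :=
  exists f g : plane -> R[i],
    [/\ magnetic_op psi.1 f, magnetic_op psi.2 g,
        {ae area, forall x, eta.1 x = f x - (b x)%:C * psi.1 x} &
        {ae area, forall x, eta.2 x = g x + (b x)%:C * psi.2 x}].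

Definition pauli_ker (b : plane -> R) (psi : spinor) : Prop :=
  pauli_op b psi (fun=> 0, fun=> 0).

End MagneticOperator.

(* Linear independence is that of the classes modulo a.e. equality. *)
Definition lin_indep (n : nat) (F : 'I_n -> spinor) : Prop :=
  forall c : 'I_n -> R[i],
    {ae area, forall x, \sum_(i < n) c i * (F i).1 x = 0} ->
    {ae area, forall x, \sum_(i < n) c i * (F i).2 x = 0} ->
    forall i, c i = 0.

Definition infinite_dim (E : spinor -> Prop) : Prop :=
  forall n : nat, exists F : 'I_n -> spinor, (forall i, E (F i)) /\ lin_indep F.

Definition cos_series (t s y : R) : R :=
  limn (series (fun n : nat =>
    n.+1%:R `^ (- s) * cos (n.+1%:R `^ (- t) * y))).

Definition field_b (t s : R) (x : plane) : R :=
  cos_series t s x.1 + cos_series t s x.2.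

End Pauli.

(* Main.v *)
(* The field is [b = Laplacian phi] with [phi x = Phi x.1 + Phi x.2] and
   [Phi y = sum_n n^(2t-s) (1 - cos (n^-t y))].  All terms of [Phi] are nonnegative, and the
   block of indices [n ~ |y|^(1/t)] alone contributes a multiple of
   [|y|^((2t+1-s)/t)], a positive power of [|y|] since [s - 2t < 1]; hence [exp (- phi)]
   decays faster than any power.  A curl-free remainder being a gradient,
   [A = (- d_2 phi, d_1 phi) + grad chi], and the Aharonov-Casher functions
   [u_k = exp (- phi + i chi) (x_1 + i x_2)^k] satisfy [(P_1 + i P_2) u_k = 0] for
   [P_j = i d_j + A_j].  Writing [w = P_1 u_k], so that [P_2 u_k = i w], one integration by
   parts gives [<P_1 u_k, P_1 psi> + <P_2 u_k, P_2 psi> = <b u_k, psi>] for test functions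
   [psi], that is [h u_k = b u_k]: the spinors [(u_k, 0)] lie in the kernel.

   The form is the closure from smooth functions, whereas [chi] is only of class C^2.  The
   approximants of [u_k] are [eta_m p_m], with [eta_m] a rescaled cutoff and [p_m] the
   Bernstein polynomial of [u_k] on a square, which approximates [u_k] together with its
   first derivatives.  All errors are bounded pointwise by multiples of [1/m] times the
   integrable function [1 / ((1 + x_1^2) (1 + x_2^2))]. *)

Require Import Defs.
From mathcomp Require Import all_boot all_order all_algebra.
From mathcomp Require Import all_classical all_reals all_analysis.
From mathcomp Require Import complex ring lra measurable_realfun.

Import Order.TTheory GRing.Theory Num.Theory.
Import numFieldNormedType.Exports.
Local Open Scope ring_scope.

Set Implicit Arguments.
Unset Strict Implicit.
Unset Printing Implicit Defensive.

Local Open Scope classical_set_scope.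
Local Open Scope complex_scope.

(** * Calculus in the plane *)

(** Under [s - 2t < 1] the coefficients [n^(2t-s)] are not summable, so a second primitive of the
    cosine series cannot be formed from cosines alone. Subtracting from each term its value at 0
    restores convergence, because [1 - cos z <= z^2] gives back the factor [n^(-2t)]; the same
    divergence is what makes [Phi] grow. The main obstacle is analytic: membership in the graph of
    [h] is tested against every [v] of the form domain, and such a [v] is known only through some
    approximating sequence, while [A] is merely C^1 and may grow arbitrarily fast. Two devices deal
    with this. Squared moduli are required to decay like [weight^2], one factor [weight] being spent
    on integrability and the other on the linear growth allowed in [1 - eta_m]. And in the tails
    [i d_j u] and [A_j u] are never estimated separately: only their sum [P_j u], in which [chi]
    cancels up to a phase, is known to decay. *)

Section PlaneCalculus.
Variable R : realType.
Local Notation plane := (R * R)%type.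
Implicit Types (f g : plane -> R) (x y : plane).

Lemma plane_continuousP f : continuous f <-> forall x (e : R), 0 < e ->
  exists2 d : R, 0 < d & forall y, `|x.1 - y.1| < d -> `|x.2 - y.2| < d ->
    `|f x - f y| < e.
Proof.
split=> [cf x e e0|cf x].
  have /cvgrPdist_lt/(_ _ e0) := cf x.
  rewrite near_simpl. move=> /(@nbhs_ballP R (R * R)%type)[d /= d0 H]; exists d => // y y1 y2.
  by apply: H; split.
apply/cvgrPdist_lt => e e0; have [d d0 H] := cf x e e0.
apply/(@nbhs_ballP R (R * R)%type); exists d => //= y [y1 y2]; exact: H.
Qed.

Definition box (M : R) : set plane := `[- M, M] `*` `[- M, M].

Lemma boxP M x : box M x <-> (`|x.1| <= M /\ `|x.2| <= M).
Proof. by rewrite /box /setX /= !in_itv /= !ler_norml. Qed.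

Lemma box_compact M : compact (box M).
Proof. by apply: compact_setX; exact: segment_compact. Qed.

Lemma box_bounded f M : continuous f -> exists2 C, 0 < C &
  forall x, box M x -> `|f x| <= C.
Proof.
move=> cf.
have /compact_bounded[C [_ HC]] : compact (f @` box M).
  by apply: continuous_compact; [exact: continuous_subspaceT|exact: box_compact].
exists (`|C| + 1); first by rewrite ltr_wpDl.
by move=> x bx; apply: HC; [rewrite (le_lt_trans (ler_norm _))// ltrDl|exists x].
Qed.

(** Compactness in near-covering form gives one [d] for the whole box. Only [x] is confined to it:
    later uses compare a point of the box with neighbours that may lie outside. *)
Lemma box_uniformly_continuous f M (e : R) : continuous f -> 0 < e ->
  exists2 d, 0 < d & forall x y, box M x ->
    `|x.1 - y.1| < d -> `|x.2 - y.2| < d -> `|f x - f y| < e.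
Proof.
move=> /plane_continuousP cf e0.
have /compact_near_coveringP/near_covering_withinP := @box_compact M.
move=> /(_ _ (0:R)^'+ (fun d x => forall y, `|x.1 - y.1| < d ->
  `|x.2 - y.2| < d -> `|f x - f y| < e) _).
have H x : box M x -> \forall x' \near x & d \near (0:R)^'+, box M x' ->
    forall y, `|x'.1 - y.1| < d -> `|x'.2 - y.2| < d -> `|f x' - f y| < e.
  move=> bx; have [d d0 Hd] := cf x (e / 2) (divr_gt0 e0 (ltr0n _ 2)).
  (* Half of the radius is spent on moving the centre and half on the increment, so that [y] stays
     within [d] of [x]. *)
  exists (ball x (d / 2), [set d' | d' < d / 2]) => /=.
    split; first by apply: nbhsx_ballx; rewrite divr_gt0.
    by apply: nbhs_right_lt; rewrite divr_gt0.
  case=> [x' d'] /= [[b1 b2] dd'] _ y y1 y2.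
  have -> : f x' - f y = (f x - f y) - (f x - f x') by ring.
  rewrite (splitr e) (le_lt_trans (ler_normB _ _))// ltrD// Hd//.
  - have -> : x.1 - y.1 = (x.1 - x'.1) + (x'.1 - y.1) by ring.
    by rewrite (splitr d) (le_lt_trans (ler_normD _ _))// ltrD// (lt_trans y1).
  - have -> : x.2 - y.2 = (x.2 - x'.2) + (x'.2 - y.2) by ring.
    by rewrite (splitr d) (le_lt_trans (ler_normD _ _))// ltrD// (lt_trans y2).
  - by rewrite (lt_trans b1)// ltr_pdivrMr// ltr_pMr// ltr1n.
  - by rewrite (lt_trans b2)// ltr_pdivrMr// ltr_pMr// ltr1n.
move=> /(_ H) K.
have [d /= [d0 Kd]] : exists d : R, 0 < d /\ (box M `<=` [set x | forall y, `|x.1 - y.1| < d ->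
  `|x.2 - y.2| < d -> `|f x - f y| < e]).
  near ((0:R)^'+) => d; exists d; split => //.
  by near: d.
by exists d => // x y bx; apply: Kd.
Unshelve. all: by end_near. Qed.

(** Both difference quotients are the same function of [h]; one-variable calculus on slices thus
    applies to partial derivatives. *)
Lemma is_derive_e1 f x d : is_derive x (@e1 R) f d <-> is_derive x.1 (1 : R) (fun s => f (s, x.2)) d.
Proof.
have E : (fun h : R => h^-1 *: (((fun s => f (s, x.2)) \o shift x.1) (h *: (1:R)) - f (x.1, x.2)))
  = (fun h : R => h^-1 *: ((f \o shift x) (h *: (@e1 R)) - f x)).
  apply/funext => h /=; congr (_ *: (f _ - f _)); last by case: x.
  by rewrite /e1 /shift /=; case: x => a b /=; congr (_, _) => /=; rewrite scaler0 add0r.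
by split=> -[H1 H2]; split; [| | |]; rewrite /derivable /derive ?E// -?E //.
Qed.

Lemma is_derive_e2 f x d : is_derive x (@e2 R) f d <-> is_derive x.2 (1 : R) (fun s => f (x.1, s)) d.
Proof.
have E : (fun h : R => h^-1 *: (((fun s => f (x.1, s)) \o shift x.2) (h *: (1:R)) - f (x.1, x.2)))
  = (fun h : R => h^-1 *: ((f \o shift x) (h *: (@e2 R)) - f x)).
  apply/funext => h /=; congr (_ *: (f _ - f _)); last by case: x.
  by rewrite /e2 /shift /=; case: x => a b /=; congr (_, _) => /=; rewrite scaler0 add0r.
by split=> -[H1 H2]; split; [| | |]; rewrite /derivable /derive ?E// -?E //.
Qed.

(* Unlike the library version, [a] and [b] need not be ordered. *)
Lemma mean_value (f df : R -> R) (a b : R) : (forall s, is_derive s (1 : R) f (df s)) ->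
  exists2 c, `|c - a| <= `|b - a| & f b - f a = df c * (b - a).
Proof.
move=> Hd.
have cf : continuous f.
  by move=> s; apply: differentiable_continuous; apply/derivable1_diffP; case: (Hd s).
have [ab|/ltW ba] := leP a b.
  have [c] := MVT_segment ab (fun s _ => Hd s) (continuous_subspaceT cf).
  rewrite in_itv /= => /andP[ac cb] E; exists c => //.
  by rewrite !ger0_norm ?subr_ge0// lerB.
have [c] := MVT_segment ba (fun s _ => Hd s) (continuous_subspaceT cf).
rewrite in_itv /= => /andP[bc ca] E; exists c; last by rewrite -opprB E; ring.
by rewrite !ler0_norm ?subr_le0// lerN2 lerB.
Qed.

(** The increment is split at the corner [(x.1, y.2)]. The mean value theorem on each leg and bounds
    for the two partials on a box give a local Lipschitz estimate. *)
Lemma C1_continuous f (d1 d2 : plane -> R) : continuous d1 -> continuous d2 ->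
  (forall x, is_derive x (@e1 R) f (d1 x)) -> (forall x, is_derive x (@e2 R) f (d2 x)) ->
  continuous f.
Proof.
move=> c1 c2 H1 H2; apply/plane_continuousP => x e e0.
pose M := `|x.1| + `|x.2| + 1.
have [C1 C10 HC1] := box_bounded M c1; have [C2 C20 HC2] := box_bounded M c2.
have C0 : 0 < C1 + C2 by rewrite addr_gt0.
exists (Num.min 1 (e / (C1 + C2))); first by rewrite lt_min ltr01 divr_gt0.
move=> y; rewrite !lt_min => /andP[y11 y1e] /andP[y21 y2e].
have [c Hc Ec] := @mean_value (fun s => f (s, y.2)) (fun s => d1 (s, y.2)) x.1 y.1
  (fun s => (is_derive_e1 f (s, y.2) _).1 (H1 _)).
have [k Hk Ek] := @mean_value (fun s => f (x.1, s)) (fun s => d2 (x.1, s)) x.2 y.2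
  (fun s => (is_derive_e2 f (x.1, s) _).1 (H2 _)).
have nb (a b c' : R) : `|b - c'| < 1 -> `|a - b| <= `|b - c'| -> `|a| <= `|b| + 1.
  move=> h1 h2; rewrite -[a](subrK b) addrC (le_trans (ler_normD _ _))// lerD2l.
  exact: le_trans h2 (ltW h1).
have bd1 : `|d1 (c, y.2)| <= C1.
  apply: HC1; apply/boxP => /=; split; rewrite /M.
    by rewrite (le_trans (nb _ x.1 y.1 y11 _))// 1?[leRHS]distrC// -addrA lerD2l lerDr.
  rewrite (le_trans (nb _ x.2 y.2 y21 _))// 1?[leRHS]distrC//.
  by rewrite lerD2r lerDr.
have bd2 : `|d2 (x.1, k)| <= C2.
  apply: HC2; apply/boxP => /=; split; rewrite /M.
    by rewrite -addrA lerDl addr_ge0.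
  rewrite (le_trans (nb _ x.2 y.2 y21 _))// 1?[leRHS]distrC//.
  by rewrite lerD2r lerDr.
have -> : f x - f y = - (d1 (c, y.2) * (y.1 - x.1) + d2 (x.1, k) * (y.2 - x.2)).
  rewrite -Ec -Ek; case: (x) (y) => [? ?] [? ?] /=; ring.
rewrite normrN (le_lt_trans (ler_normD _ _))// !normrM.
have -> : e = C1 * (e / (C1 + C2)) + C2 * (e / (C1 + C2)).
  by rewrite -mulrDl mulrC mulfVK// gt_eqF.
apply: ltr_leD.
  rewrite distrC (le_lt_trans (ler_wpM2r (normr_ge0 _) bd1))// ltr_pM2l//.
rewrite distrC (le_trans (ler_wpM2r (normr_ge0 _) bd2))// ler_wpM2l// ?ltW//.
Qed.
End PlaneCalculus.

(** * Primitives on the line and potentials of curl-free fields *)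

Section Primitive.
Variable R : realType.
Local Notation plane := (R * R)%type.

Lemma is_derive_eps (F : R -> R) (y D : R) : (forall e : R, 0 < e -> exists2 d : R, 0 < d &
    forall h, `|h| < d -> `|F (y + h) - F y - h * D| <= e * `|h|) ->
  is_derive y (1 : R) F D.
Proof.
move=> H.
have cF : h^-1 *: ((F \o shift y) (h *: (1 : R)) - F y) @[h --> 0^'] --> D.
  apply/cvgrPdist_le => e e0; have [d d0 Hd] := H e e0.
  apply/nbhs_ballP; exists d => //= h; rewrite /ball /= sub0r normrN => hd h0.
  rewrite distrC /shift /= scaler1 [h + y]addrC.
  have -> : h^-1 *: (F (y + h) - F y) - D = h^-1 * (F (y + h) - F y - h * D).
    by rewrite [RHS]mulrBr mulKf.
  rewrite normrM normfV ler_pdivrMl ?normr_gt0// [leRHS]mulrC. exact: Hd.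
by split; [apply/cvg_ex; exists D|apply/cvg_lim].
Qed.

Lemma primitive_exists (g : R -> R) : continuous g ->
  exists2 G : R -> R, forall y, is_derive y (1 : R) G (g y) & G 0 = 0.
Proof.
move=> cg.
pose I (a b : R) := \int[@lebesgue_measure R]_(s in `[a, b]) g s.
have ig (a b : R) : (@lebesgue_measure R).-integrable `[a, b] (EFin \o g).
  apply: continuous_compact_integrable; first exact: segment_compact.
  exact: continuous_subspaceT.
have split_I (a b c : R) : a <= b -> b <= c -> I a c = I a b + I b c.
  move=> ab bc; have := @Rintegral_itvB R g (BLeft a) (BRight c) b (ig a c).
  rewrite !bnd_simp => /(_ ab bc) => E.
  rewrite /I -[LHS](subrK (I a b)) /I E addrC; congr (_ + _).
  apply: Rintegral_itv_obnd_cbnd.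
  by apply: integrableS (ig b c) => //; apply: subset_itv_oc_cc.
(* The oriented integral from 0 to [y]: one of the two terms always vanishes. *)
pose P y := I 0 y - I y 0.
have I0 (a b : R) : b <= a -> I a b = 0.
  rewrite le_eqVlt => /orP[/eqP->|ba]; rewrite /I.
    by rewrite set_itv1 Rintegral_set1.
  by rewrite set_itv_ge ?Rintegral_set0// bnd_simp -ltNge.
have PE (a y : R) : a <= 0 -> a <= y -> P y = I a y - I a 0.
  move=> a0 ay; rewrite /P; have [y0|/ltW y0] := leP 0 y.
    by rewrite (I0 y 0)// subr0 (split_I _ _ _ a0 y0); ring.
  by rewrite (I0 0 y)// (split_I _ _ _ ay y0); ring.
exists P; last by rewrite /P subrr.
(* The fundamental theorem needs a fixed base point to the left of [y]. This one is also left of 0,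
   so near [y] the function [P] differs from [I a] by the constant [I a 0]. *)
move=> y; pose a := - (`|y| + 1).
have ay : a < y.
  by rewrite /a ltrNl ltr_pwDr// -normrN ler_norm.
have a0 : a <= 0 by rewrite oppr_le0 addr_ge0.
have [D1 D2] := @continuous_FTC1 R g (BLeft a) y (y + 1) (ltr_pwDr ltr01 (lexx _))
  (ig _ _) ay (cg y).
have Hd : is_derive y (1 : R) (fun z => I a z - I a 0) (g y).
  have H1 : is_derive y (1 : R) (fun z => I a z) (g y).
    by split; [exact: D1 | rewrite -derive1E; exact: D2].
  by apply: is_derive_eq; rewrite subr0.
apply: near_eq_is_derive Hd.
by near=> z; rewrite (PE a)//; near: z; apply: filterS (lt_nbhsr ay) => z /ltW.
Unshelve. all: by end_near. Qed.

Lemma primitive_bound (F dF : R -> R) (C : R) (y : R) :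
  (forall s, is_derive s (1 : R) F (dF s)) -> F 0 = 0 ->
  (forall s, `|s| <= `|y| -> `|dF s| <= C) -> `|F y| <= C * `|y|.
Proof.
move=> HF F0 HC; have [c + E] := @mean_value R F dF 0 y HF.
rewrite !subr0 => cy; move: E; rewrite F0 !subr0 => ->.
by rewrite normrM ler_wpM2r// HC.
Qed.

Lemma slice_continuous (f : plane -> R) (b : R) : continuous f ->
  continuous (fun s => f (s, b)) /\ continuous (fun s => f (b, s)).
Proof.
move=> /plane_continuousP cf; split=> s; apply/cvgrPdist_lt => e e0.
  have [r r0 Hr] := cf (s, b) e e0; apply/nbhs_ballP; exists r => //= t st.
  by apply: Hr => //=; rewrite subrr normr0.
have [r r0 Hr] := cf (b, s) e e0; apply/nbhs_ballP; exists r => //= t st.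
by apply: Hr => //=; rewrite subrr normr0.
Qed.

(* Differentiation under the integral sign, in terms of primitives: by the
   mean value theorem the difference quotient has a uniformly small derivative. *)
Lemma potential_exists (a1 a2 d : plane -> R) :
  continuous a1 -> continuous a2 -> continuous d ->
  (forall x, is_derive x (@e1 R) a2 (d x)) -> (forall x, is_derive x (@e2 R) a1 (d x)) ->
  exists chi : plane -> R, forall x,
    is_derive x (@e1 R) chi (a1 x) /\ is_derive x (@e2 R) chi (a2 x).
Proof.
move=> c1 c2 cd H1 H2.
have [Q HQ _] := primitive_exists (slice_continuous 0 c1).1.
have /choice[P HP] : forall b : R, exists P : R -> R,
    (forall y : R, is_derive y (1 : R) P (a2 (b, y))) /\ P 0 = 0.
  by move=> b; have [G] := primitive_exists (slice_continuous b c2).2; exists G.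
(* The line integral of [(a1, a2)] from the origin along the horizontal axis to [(x.1, 0)], then
   vertically. The second partial is immediate; the first needs an interchange. *)
exists (fun x => Q x.1 + P x.1 x.2) => -[b y]; split; last first.
  apply: (is_derive_e2 _ _ _).2 => /=; have h := (HP b).1 y.
  rewrite -[a2 _]add0r; exact: (@is_deriveD _ _ _ (cst (Q b)) (P b)).
apply: (is_derive_e1 _ _ _).2 => /=.
have -> : a1 (b, y) = a1 (b, 0) + (a1 (b, y) - a1 (b, 0)) by ring.
apply: (@is_deriveD _ _ _ Q (fun s => P s y)).
apply: is_derive_eps => e e0.
pose M := `|b| + `|y| + 1.
have y1 : 0 < `|y| + 1 by rewrite ltr_wpDl.
have [r r0 Hr] := @box_uniformly_continuous R d M (e / (`|y| + 1)) cd (divr_gt0 e0 y1).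
exists r => // h hr.
(* The first-order remainder in the first variable, as a function of the height [s]. It vanishes at
   height 0, and its derivative is the corresponding remainder of [a2], which [mean_value] turns
   into an increment of [d]. *)
pose F s := P (b + h) s - P b s - h * (a1 (b, s) - a1 (b, 0)).
pose dF s := a2 (b + h, s) - a2 (b, s) - h * d (b, s).
have HF s : is_derive s (1 : R) F (dF s).
  rewrite /F /dF; have p1 := (HP (b + h)).1 s; have p2 := (HP b).1 s.
  have p3 := (is_derive_e2 a1 (b, s) _).1 (H2 (b, s)); rewrite /= in p3.
  apply: (@is_deriveB _ _ _ (fun s => P (b + h) s - P b s) (fun s => h * (a1 (b, s) - a1 (b, 0)))).
  have p4 : is_derive s (1 : R) (fun t : R => a1 (b, t) - a1 (b, 0)) (d (b, s)).
    by apply: is_derive_eq; rewrite subr0.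
  by apply: is_deriveZ.
have F0 : F 0 = 0 by rewrite /F !(HP _).2 !subrr mulr0 subr0.
have -> : P (b + h) y - P b y - h * (a1 (b, y) - a1 (b, 0)) = F y by [].
rewrite (le_trans (@primitive_bound F dF (e / (`|y| + 1) * `|h|) y HF F0 _))//; last first.
  rewrite mulrAC ler_wpM2r// mulrAC ler_pdivrMr// ler_wpM2l ?ltW// ltrDl.
  exact: ltr01.
move=> s sy; rewrite /dF.
have [c Hc Ec] := @mean_value R (fun t => a2 (t, s)) (fun t => d (t, s)) b (b + h)
  (fun t => (is_derive_e1 a2 (t, s) _).1 (H1 _)).
rewrite Ec [b + h - b]addrC addKr mulrC -mulrBr normrM mulrC ler_wpM2r// distrC.
apply/ltW/Hr => /=; last by rewrite subrr normr0.
- apply/boxP; split => /=; first by rewrite /M -addrA lerDl addr_ge0.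
  by rewrite (le_trans sy)// /M addrAC lerDr addr_ge0.
- by rewrite distrC (le_lt_trans Hc)// [b + h]addrC addrK.
Qed.
End Primitive.

(** * Integration over the plane *)

Section PlaneMeasure.
Variable R : realType.
Local Notation plane := (R * R)%type.
Local Notation area := ((@lebesgue_measure R \x @lebesgue_measure R)%E).
Implicit Types (f g : plane -> R) (x y : plane).

(* Rational boxes form a countable basis of the plane. *)
Lemma open_measurable_plane (U : set plane) :
  (forall x, U x -> exists2 d : R, 0 < d & forall y, `|x.1 - y.1| < d -> `|x.2 - y.2| < d -> U y) ->
  measurable U.
Proof.
move=> oU.
pose B (p q r : rat) : set plane := (ball (ratr p : R) (ratr r : R)) `*` (ball (ratr q : R) (ratr r)).
pose F p q r := if pselect (B p q r `<=` U) then B p q r else set0.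
have -> : U = \bigcup_p \bigcup_q \bigcup_r F p q r.
  apply/seteqP; split=> [x Ux|x [p _ [q _ [r _]]]]; last first.
    by rewrite /F; case: pselect => // H /H.
  have [d d0 Hd] := oU x Ux.
  have d20 : 0 < d / 2 by rewrite divr_gt0.
  have [r] := rat_in_itvoo d20; rewrite in_itv /= => /andP[r0 rd].
  have near_rat (a : R) : exists p : rat, `|ratr p - a| < ratr r.
    have [p] := @rat_in_itvoo R (a - ratr r) (a + ratr r) ltac:(lra).
    by rewrite in_itv /= => /andP[p1 p2]; exists p; rewrite ltr_distl p1 p2.
  have [p px] := near_rat x.1; have [q qx] := near_rat x.2.
  exists p => //; exists q => //; exists r => //.
  rewrite /F; case: pselect => [?|]; first by split.
  case=> y [/= yp yq]; apply: Hd.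
    have -> : x.1 - y.1 = (ratr p - y.1) - (ratr p - x.1) by ring.
    by rewrite (splitr d) (le_lt_trans (ler_normB _ _))// ltrD// (lt_trans _ rd).
  have -> : x.2 - y.2 = (ratr q - y.2) - (ratr q - x.2) by ring.
  by rewrite (splitr d) (le_lt_trans (ler_normB _ _))// ltrD// (lt_trans _ rd).
apply: bigcupT_measurable_rat => p; apply: bigcupT_measurable_rat => q; apply: bigcupT_measurable_rat => r.
by rewrite /F; case: pselect => //= ?; exact: (measurableX (measurable_ball _ _) (measurable_ball _ _)).
Qed.

Lemma continuous_measurable_plane f : continuous f -> measurable_fun setT f.
Proof.
move=> /plane_continuousP cf; apply: (measurability _ (RGenOpens.measurableE R)).
move=> _ [_ [a [b ->] <-]]; rewrite setTI; apply: open_measurable_plane => x /=.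
rewrite in_itv /= => /andP[ax xb].
have [d d0 Hd] := cf x (Num.min (f x - a) (b - f x)) ltac:(rewrite lt_min !subr_gt0 ax xb//).
exists d => // y y1 y2; have := Hd y y1 y2; rewrite lt_min in_itv /= !ltr_norml.
by move=> /andP[/andP[? ?] /andP[? ?]]; apply/andP; split; lra.
Qed.

(** A product of two Cauchy densities up to normalisation. It is the common majorant for all
    integrability arguments: the product form lets Tonelli compute its integral, and polynomial
    decay makes it easy to dominate. *)
Definition weight x : R := (oneDsqr x.1)^-1 * (oneDsqr x.2)^-1.

Lemma weight_gt0 x : 0 < weight x.
Proof. by rewrite mulr_gt0// invr_gt0// (lt_le_trans ltr01)// oneDsqr_ge1. Qed.

Lemma weight_le1 x : weight x <= 1.
Proof.
have h (a : R) : 0 <= (oneDsqr a)^-1 <= 1.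
  by apply/andP; split; [rewrite invr_ge0 (le_trans ler01 (oneDsqr_ge1 _))|exact: oneDsqrV_le1].
have /andP[a1 a2] := h x.1; have /andP[b1 b2] := h x.2.
by rewrite /weight mulr_ile1.
Qed.

Lemma weight_continuous : continuous weight.
Proof.
move=> x; apply: (@cvgM _ _ _ _ (fun x => (oneDsqr x.1)^-1) (fun x => (oneDsqr x.2)^-1)).
  by apply: (@cvg_comp _ _ _ fst (fun a : R => (oneDsqr a)^-1)); [exact: cvg_fst|exact: continuous_oneDsqrV].
by apply: (@cvg_comp _ _ _ snd (fun a : R => (oneDsqr a)^-1)); [exact: cvg_snd|exact: continuous_oneDsqrV].
Qed.

Notation integrable f := (area.-integrable setT (EFin \o f)).

Lemma weight_integrable : integrable weight.
Proof.
have mW := continuous_measurable_plane weight_continuous.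
pose w (a : R) := (oneDsqr a)^-1.
have w0 a : 0 <= w a by rewrite invr_ge0 (le_trans ler01 (oneDsqr_ge1 _)).
have cw : continuous w by exact: continuous_oneDsqrV.
have mw : measurable_fun setT w by exact: continuous_measurable_fun.
have mwE : measurable_fun setT (fun b => (w b)%:E) by exact/measurable_EFinP.
have Ew : (\int[@lebesgue_measure R]_a (w a)%:E = pi%:E)%E.
  rewrite ge0_symfun_integralT//; last by move=> a; rewrite /w /oneDsqr /= sqrrN.
  rewrite -set_itvcy integral0y_oneDsqr -EFinM; congr (_%:E).
  by rewrite mulrC divfK// pnatr_eq0.
apply/integrableP; split; first exact/measurable_EFinP.
under eq_integral do rewrite /= ger0_norm ?(ltW (weight_gt0 _))//.
rewrite fubini_tonelli1//=; last 2 first.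
- exact/measurable_EFinP.
- by move=> x; rewrite lee_fin ltW// weight_gt0.
rewrite /fubini_F /=.
have Ei (c : R) : 0 <= c -> (\int[@lebesgue_measure R]_b (c * w b)%:E = (c * pi)%:E)%E.
  move=> c0; under eq_integral do rewrite EFinM.
  rewrite ge0_integralZl_EFin ?Ew -?EFinM//.
  by move=> ? _; rewrite lee_fin.
rewrite (_ : (fun a => _) = (fun a => (pi * w a)%:E)); last first.
  by apply/funext => a; rewrite mulrC -(Ei _ (w0 a)).
by rewrite Ei ?pi_ge0// ltry.
Qed.

Lemma bounded_integrable f g : measurable_fun setT f -> (forall x, `|f x| <= g x) ->
  integrable g -> integrable f.
Proof.
move=> mf fg; apply: le_integrable => //; first exact/measurable_EFinP.
by move=> x _ /=; rewrite lee_fin (le_trans (fg x))// ler_norm.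
Qed.

Lemma integrable_scale (c : R) f : integrable f -> integrable (fun x => c * f x).
Proof. by move=> /(integrableZl measurableT c). Qed.

Lemma integrable_add f g : integrable f -> integrable g -> integrable (fun x => f x + g x).
Proof. by move=> hf hg; have := integrableD measurableT hf hg. Qed.

Lemma integrable_sub f g : integrable f -> integrable g -> integrable (fun x => f x - g x).
Proof. by move=> hf hg; have := integrableB measurableT hf hg. Qed.

Lemma weight_bounded_integrable f (C : R) : measurable_fun setT f ->
  (forall x, `|f x| <= C * weight x) -> integrable f.
Proof.
move=> mf fC; apply: bounded_integrable mf fC _; exact: integrable_scale weight_integrable.
Qed.

(** Compact support is recorded by an explicit square, so that all slices are supported in the same
    interval. *)
Definition vanishes_outside (M : R) f := forall x, ~ box M x -> f x = 0.

Lemma weight_box_lb M : exists2 c, 0 < c & forall x, box M x -> c <= weight x.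
Proof.
exists ((oneDsqr M)^-1 * (oneDsqr M)^-1).
  by rewrite mulr_gt0// invr_gt0 (lt_le_trans ltr01)// oneDsqr_ge1.
have h (a : R) : `|a| <= M -> (oneDsqr M)^-1 <= (oneDsqr a)^-1.
  move=> aM; rewrite lef_pV2 ?posrE ?(lt_le_trans ltr01)// ?oneDsqr_ge1//.
  by rewrite /oneDsqr lerD2l -(real_normK (num_real a)) lerXn2r// ?nnegrE// (le_trans _ aM).
by move=> x /boxP[/h h1 /h h2]; rewrite /weight ler_pM// invr_ge0.
Qed.

Lemma vanishing_weight_bounded f M : continuous f -> vanishes_outside M f ->
  exists2 C, 0 <= C & forall x, `|f x| <= C * weight x.
Proof.
move=> cf vf; have [C C0 HC] := box_bounded M cf; have [c c0 Hc] := weight_box_lb M.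
exists (C / c); first by rewrite divr_ge0 ?ltW.
move=> x; have [bx|nbx] := pselect (box M x).
  by rewrite (le_trans (HC x bx))// -mulrA ler_peMr ?(ltW C0)// mulrC ler_pdivlMr// mul1r Hc.
by rewrite vf// normr0 !mulr_ge0 ?invr_ge0 ?(ltW _)// weight_gt0.
Qed.

Lemma vanishing_integrable f M : continuous f -> vanishes_outside M f -> integrable f.
Proof.
move=> cf vf; have [C _ HC] := vanishing_weight_bounded cf vf.
exact: weight_bounded_integrable (continuous_measurable_plane cf) HC.
Qed.
End PlaneMeasure.

(** * Integrals of compactly supported derivatives, square integrability, null sets *)

Section IntegralTools.
Variable R : realType.
Local Notation plane := (R * R)%type.
Local Notation mu := (@lebesgue_measure R).
Local Notation area := ((@lebesgue_measure R \x @lebesgue_measure R)%E).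
Implicit Types (f g : plane -> R).
Notation integrable f := (area.-integrable setT (EFin \o f)).
Notation I f := (Rintegral area setT f).

Lemma integral_derive_vanishing (g dg : R -> R) (M : R) : 0 <= M -> continuous dg ->
  (forall s, is_derive s (1 : R) g (dg s)) -> (forall s, M < `|s| -> g s = 0 /\ dg s = 0) ->
  (\int[mu]_s (dg s)%:E = 0)%E.
Proof.
(* Vanishing is known only where [|s|] exceeds [M] strictly, so the endpoints are taken one unit
   further out. *)
move=> M0 cdg Hg v; pose K := M + 1.
have K0 : 0 < K by rewrite ltr_wpDl.
have cg : continuous g.
  by move=> s; apply: differentiable_continuous; apply/derivable1_diffP; case: (Hg s).
have MK : M < `|K| by rewrite gtr0_norm// ltrDl.
pose S : set R := `[- K, K].
have -> : (fun s => (dg s)%:E) = ((fun s => (dg s)%:E) \_ S)%E.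
  apply/funext => s; rewrite /patch; case: ifPn => //.
  rewrite /S notin_setE /= in_itv /= -ler_norml => /negP; rewrite -ltNge => Ks.
  by rewrite (v s _).2// (lt_trans _ Ks)// ltrDl.
rewrite -integral_mkcond (@continuous_FTC2 _ dg g).
- by rewrite (v K _).1// (v (- K) _).1 ?normrN// sube0.
- by rewrite gtrN.
- exact: continuous_subspaceT.
- split=> [s _|  |]; first by case: (Hg s).
    by apply: cvg_at_right_filter; exact: cg.
  by apply: cvg_at_left_filter; exact: cg.
- by move=> s _; rewrite derive1E; case: (Hg s).
Qed.

Lemma box_slices (M s b : R) : M < `|s| -> ~ box M (s, b) /\ ~ box M (b, s).
Proof.
by move=> Ms; split=> /boxP[] /=; [move=> + _|move=> _]; rewrite leNgt Ms.
Qed.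

(* The partial derivatives integrate to zero slice by slice. *)
Lemma integral_partial1 f d M : 0 <= M -> continuous d -> (forall x, is_derive x (@e1 R) f (d x)) ->
  vanishes_outside M f -> vanishes_outside M d -> I d = 0.
Proof.
move=> M0 cd Hf vf vd; have id := vanishing_integrable cd vd.
rewrite /Rintegral -(integral21_prod_meas1 id) /fubini_G.
rewrite (_ : (fun b => _) = cst 0%E) ?integral0//; apply/funext => b /=.
apply: (@integral_derive_vanishing (fun s => f (s, b)) (fun s => d (s, b)) M) => //.
- exact: (slice_continuous b cd).1.
- by move=> s; exact: (is_derive_e1 f (s, b) _).1.
- by move=> s Ms; split; [apply: vf|apply: vd]; exact: (box_slices b Ms).1.
Qed.

Lemma integral_partial2 f d M : 0 <= M -> continuous d -> (forall x, is_derive x (@e2 R) f (d x)) ->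
  vanishes_outside M f -> vanishes_outside M d -> I d = 0.
Proof.
move=> M0 cd Hf vf vd; have id := vanishing_integrable cd vd.
rewrite /Rintegral -(integral12_prod_meas1 id) /fubini_F.
rewrite (_ : (fun b => _) = cst 0%E) ?integral0//; apply/funext => b /=.
apply: (@integral_derive_vanishing (fun s => f (b, s)) (fun s => d (b, s)) M) => //.
- exact: (slice_continuous b cd).2.
- by move=> s; exact: (is_derive_e2 f (b, s) _).1.
- by move=> s Ms; split; [apply: vf|apply: vd]; exact: (box_slices b Ms).2.
Qed.

Lemma Lfun2P f : f \in Lfun area 2%:E <->
  measurable_fun setT f /\ integrable (fun x => f x ^+ 2).
Proof.
split=> [fL|[mf fi]].
  split; last exact: Lfun2_integrable_sqr.
  by move: fL; rewrite inE => /andP[]; rewrite inE.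
rewrite inE; apply/andP; split; rewrite inE//= /finite_norm unlock /=.
apply: poweR_lty.
case/integrableP: fi => _; apply: le_lt_trans.
rewrite le_eqVlt; apply/orP; left; apply/eqP; apply: eq_integral => x _ /=.
by rewrite powR_mulrn// normrX.
Qed.

(** The square []K, K + 1[] times []0, 1[] has measure one and cannot lie in the exceptional null
    set. Increasing [K] produces as many distinct points of [P] as wanted. *)
Lemma ae_exists_right (P : plane -> Prop) (K : R) :
  {ae area, forall x, P x} -> exists2 x, P x & K < x.1.
Proof.
move=> [N [mN N0 sub]]; apply: contrapT => H.
pose S1 : set R := `]K, K + 1[; pose S2 : set R := `]0, 1[.
have : (area (S1 `*` S2) <= area N)%E.
  apply: le_measure; rewrite ?inE//.
    by apply: measurableX; exact: measurable_itv.
  move=> x [/= x1 _]; apply: sub => /= Px; apply: H; exists x => //.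
  by move: x1; rewrite /S1 /= in_itv /= => /andP[].
have E1 : (mu S1 = 1%:E)%E.
  by rewrite /S1 lebesgue_measure_itv /= lte_fin ltrDl ltr01 -EFinB addrAC subrr add0r.
have E2 : (mu S2 = 1%:E)%E by rewrite /S2 lebesgue_measure_itv /= lte_fin ltr01 -EFinB subr0.
have -> : (area (S1 `*` S2) = 1%:E)%E.
  rewrite product_measure1E; [|exact: measurable_itv..].
  by transitivity (mu S1 * mu S2)%E => //; rewrite E1 E2 mule1.
by rewrite N0 lee_fin ler10.
Qed.
End IntegralTools.

(** * Bernstein polynomials and density of smooth functions *)

Section SmoothFunctions.
Variable R : realType.
Local Notation plane := (R * R)%type.
Implicit Types (f g : plane -> R).

(** Together with [CkS_inv] this trades the ['D] of [Ck] for named partials certified by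
    [is_derive], the form in which sums and products can be differentiated by induction on [k]. *)
Lemma CkS k f d1 d2 :
  (forall x, is_derive x (@e1 R) f (d1 x)) -> (forall x, is_derive x (@e2 R) f (d2 x)) ->
  continuous f ->
  Ck k d1 -> Ck k d2 -> Ck k.+1 f.
Proof.
move=> H1 H2 cf C1 C2.
have E1 : (fun x => 'D_(@e1 R) f x) = d1 by apply/funext => x; case: (H1 x).
have E2 : (fun x => 'D_(@e2 R) f x) = d2 by apply/funext => x; case: (H2 x).
by split; rewrite ?E1 ?E2//= => x; case: (H1 x); case: (H2 x).
Qed.

Lemma CkS_inv k f : Ck k.+1 f -> exists d1 d2, [/\ continuous f,
  (forall x, is_derive x (@e1 R) f (d1 x)), (forall x, is_derive x (@e2 R) f (d2 x)),
  Ck k d1 & Ck k d2].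
Proof.
case=> cf D C1 C2; exists (fun x => 'D_(@e1 R) f x), (fun x => 'D_(@e2 R) f x).
by split=> // x; apply: derivableP; [exact: (D x).1|exact: (D x).2].
Qed.

Lemma Ck_weaken k f : Ck k.+1 f -> Ck k f.
Proof.
elim: k f => [|k IH] f; first by case.
by move=> /CkS_inv[d1 [d2 [cf H1 H2 /IH C1 /IH C2]]]; exact: CkS H1 H2 cf C1 C2.
Qed.

Lemma Ck_cst k (c : R) : Ck k (fun _ : plane => c).
Proof.
elim: k c => [|k IH] c; first by move=> x; exact: cvg_cst.
apply: (@CkS k _ (fun=> 0) (fun=> 0)) => // x; exact: cvg_cst.
Qed.

Lemma Ck_add k f g : Ck k f -> Ck k g -> Ck k (fun x => f x + g x).
Proof.
elim: k f g => [|k IH] f g.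
  by move=> cf cg x; apply: cvgD; [exact: cf|exact: cg].
move=> /CkS_inv[d1 [d2 [cf H1 H2 C1 C2]]] /CkS_inv[b1 [b2 [cg K1 K2 B1 B2]]].
apply: (@CkS _ _ _ _ (fun x => is_deriveD (H1 x) (K1 x)) (fun x => is_deriveD (H2 x) (K2 x))).
- by move=> x; apply: cvgD; [exact: cf|exact: cg].
- exact: IH.
- exact: IH.
Qed.

Lemma Ck_mul k f g : Ck k f -> Ck k g -> Ck k (fun x => f x * g x).
Proof.
elim: k f g => [|k IH] f g.
  by move=> cf cg x; apply: cvgM; [exact: cf|exact: cg].
move=> Hf Hg; have wf := Ck_weaken Hf; have wg := Ck_weaken Hg.
move: Hf Hg => /CkS_inv[d1 [d2 [cf H1 H2 C1 C2]]] /CkS_inv[b1 [b2 [cg K1 K2 B1 B2]]].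
apply: (@CkS _ _ _ _ (fun x => is_deriveM (H1 x) (K1 x)) (fun x => is_deriveM (H2 x) (K2 x))).
- by move=> x; apply: cvgM; [exact: cf|exact: cg].
- by apply: Ck_add; exact: IH.
- by apply: Ck_add; exact: IH.
Qed.

(** The inner argument of the smooth functions below: the rescaled coordinates of the Bernstein
    polynomials and the edges of the cutoff. *)
Definition affine (a b c : R) (x : plane) : R := a * x.1 + b * x.2 + c.

Lemma affine_continuous a b c : continuous (affine a b c).
Proof.
move=> x; apply: cvgD; last exact: cvg_cst.
by apply: cvgD; (apply: cvgM; [exact: cvg_cst|]); [exact: cvg_fst|exact: cvg_snd].
Qed.

Lemma is_derive_affine1 a b c (x : plane) : is_derive x (@e1 R) (affine a b c) a.
Proof.
apply: (is_derive_e1 _ _ _).2; rewrite /affine /=; apply: is_derive_eq.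
by rewrite /GRing.scale /=; ring.
Qed.

Lemma is_derive_affine2 a b c (x : plane) : is_derive x (@e2 R) (affine a b c) b.
Proof.
apply: (is_derive_e2 _ _ _).2; rewrite /affine /=; apply: is_derive_eq.
by rewrite /GRing.scale /=; ring.
Qed.

Lemma Ck_affine k a b c : Ck k (affine a b c).
Proof.
case: k => [|k]; first exact: affine_continuous.
apply: (@CkS k _ (fun=> a) (fun=> b) (is_derive_affine1 a b c) (is_derive_affine2 a b c)).
- exact: affine_continuous.
- exact: Ck_cst.
- exact: Ck_cst.
Qed.
End SmoothFunctions.

(** * Algebra, moments and derivatives of Bernstein polynomials *)

Section Bernstein.
Variable R : realType.
Local Notation plane := (R * R)%type.

(* De Casteljau's recursion for the Bernstein polynomial with coefficients [c]. *)
Fixpoint bern (n : nat) (s : R) (c : nat -> R) : R :=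
  if n is m.+1 then (1 - s) * bern m s c + s * bern m s (fun i => c i.+1) else c 0%N.

Lemma bern_eq n s c c' : (forall i, (i <= n)%N -> c i = c' i) -> bern n s c = bern n s c'.
Proof.
elim: n c c' => [|n IH] c c' H /=; first exact: H.
by rewrite (IH c c') ?(IH (fun i => c i.+1) (fun i => c' i.+1))// => i Hi; apply: H => //; exact: leqW.
Qed.

Lemma bern_lin n s a c b c' :
  bern n s (fun i => a * c i + b * c' i) = a * bern n s c + b * bern n s c'.
Proof. by elim: n c c' => [|n IH] c c' //=; rewrite !IH; ring. Qed.

Lemma bern_cst n s a : bern n s (fun=> a) = a.
Proof. by elim: n => [|n IH] //=; rewrite IH; ring. Qed.

Lemma bern_le n s c c' : 0 <= s <= 1 -> (forall i, (i <= n)%N -> c i <= c' i) ->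
  bern n s c <= bern n s c'.
Proof.
move=> /andP[s0 s1]; elim: n c c' => [|n IH] c c' H /=; first exact: H.
apply: lerD; apply: ler_wpM2l; rewrite ?subr_ge0//; apply: IH => i Hi; apply: H => //.
exact: leqW.
Qed.

(** On [[0, 1]] the Bernstein average is positive and reproduces constants, so a bound on the
    deviation of each coefficient passes to the average. *)
Lemma bern_dist n s c a c' : 0 <= s <= 1 -> (forall i, (i <= n)%N -> `|c i - a| <= c' i) ->
  `|bern n s c - a| <= bern n s c'.
Proof.
move=> s01 H.
have up : bern n s c <= a + bern n s c'.
  rewrite -[X in X + _](bern_cst n s) -[X in X + _]mul1r -[X in _ + X]mul1r -bern_lin.
  by apply: bern_le => // i /H; rewrite ler_norml => /andP[? ?]; lra.
have lo : a - bern n s c' <= bern n s c.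
  rewrite -[X in X - _](bern_cst n s) -[X in X - _]mul1r -[X in _ - X]mul1r -mulNr -bern_lin.
  by apply: bern_le => // i /H; rewrite ler_norml => /andP[? ?]; lra.
by rewrite ler_norml; apply/andP; split; lra.
Qed.

Lemma bern_id n s : bern n s (fun i => i%:R) = n%:R * s.
Proof.
elim: n => [|n IH] /=; first by rewrite mul0r.
rewrite (@bern_eq n s (fun i => i.+1%:R) (fun i => 1 * i%:R + 1 * 1)); last first.
  by move=> i _; rewrite -[i.+1]addn1 natrD; ring.
by rewrite bern_lin bern_cst IH -[n.+1]addn1 natrD; ring.
Qed.

Lemma bern_sqr n s : bern n s (fun i => i%:R ^+ 2) = n%:R * (n%:R - 1) * s ^+ 2 + n%:R * s.
Proof.
elim: n => [|n IH] /=; first by rewrite !mul0r addr0 expr2 mul0r.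
rewrite (@bern_eq n s (fun i => i.+1%:R ^+ 2) (fun i => 1 * i%:R ^+ 2 + 1 * (2 * i%:R + 1 * 1))); last first.
  by move=> i _; rewrite -[i.+1]addn1 natrD; ring.
by rewrite !bern_lin bern_cst bern_id IH -[n.+1]addn1 natrD; ring.
Qed.

(** Variance plus squared bias of a binomial law. The degree [n = N] is allowed because a derivative
    has one degree less while the nodes keep the denominator [N.+1]; the mismatch adds the bias
    [s ^+ 2], at most 1. *)
Lemma bern_moment n N (s : R) : 0 <= s <= 1 -> n = N.+1 \/ n = N ->
  bern n s (fun i => (i%:R - N.+1%:R * s) ^+ 2) <= N.+1%:R.
Proof.
move=> /andP[s0 s1] nN; set b := N.+1%:R * s.
rewrite (@bern_eq n s _ (fun i => 1 * i%:R ^+ 2 + 1 * (- (2 * b) * i%:R + b ^+ 2 * 1))); last first.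
  by move=> i _; ring.
rewrite !bern_lin bern_cst bern_id bern_sqr /b.
have N0 : 0 <= N%:R :> R by [].
have p1 : 0 <= s * (1 - s) by rewrite mulr_ge0// subr_ge0.
have p2 : s * (1 - s) <= 1 by rewrite mulr_ile1// ?subr_ge0// gerBl.
have p3 : s ^+ 2 <= 1 by rewrite expr_le1.
by case: nN => ->; rewrite -[N.+1]addn1 natrD; nra.
Qed.

(** The derivative is again a Bernstein average, now of forward differences. On a grid these are
    multiples of derivative values at intermediate points, which is why Bernstein approximation also
    converges in C^1. *)
Lemma is_derive_bern n (s : R) c :
  is_derive s (1 : R) (fun s => bern n.+1 s c) (n.+1%:R * bern n s (fun i => c i.+1 - c i)).
Proof.
elim: n c => [|n IH] c.
  rewrite /= mul1r; apply: is_derive_eq.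
  by rewrite /GRing.scale /=; ring.
have IH0 := IH c; have IH1 := IH (fun i => c i.+1).
rewrite [X in is_derive _ _ X _](_ : _ =
  (fun s => (1 - s) * bern n.+1 s c + s * bern n.+1 s (fun i => c i.+1)))//.
set b0 := fun s : R => bern n.+1 s c; set b1 := fun s : R => bern n.+1 s (fun i => c i.+1).
rewrite -/b0 -/b1 in IH0 IH1 *.
apply: is_derive_eq; rewrite /GRing.scale /=.
have D c0 : bern n s (fun i => c0 i.+1 - c0 i) = bern n s (fun i => c0 i.+1) - bern n s c0.
  rewrite (@bern_eq n s _ (fun i => 1 * c0 i.+1 + (-1) * c0 i)) ?bern_lin; first by ring.
  by move=> i _; ring.
rewrite (D c) (D (fun i => c i.+1)) -[n.+2]addn1 natrD; ring.
Qed.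

Lemma is_derive_bern_coeff n (r s : R) (h dh : nat -> R -> R) :
  (forall i, is_derive s (1 : R) (h i) (dh i s)) ->
  is_derive s (1 : R) (fun s => bern n r (fun i => h i s)) (bern n r (fun i => dh i s)).
Proof.
elim: n h dh => [|n IH] h dh H /=; first exact: H.
have H0 := IH h dh H; have H1 := IH (fun i => h i.+1) (fun i => dh i.+1) (fun i => H i.+1).
have K0 := is_deriveZ (1 - r) H0; have K1 := is_deriveZ r H1.
exact: (is_deriveD K0 K1).
Qed.

Lemma Ck_bern k n (sg : plane -> R) (h : nat -> plane -> R) : Ck k sg ->
  (forall i, Ck k (h i)) -> Ck k (fun x => bern n (sg x) (fun i => h i x)).
Proof.
move=> Hs; elim: n h => [|n IH] h Hh /=; first exact: Hh.
apply: Ck_add; apply: Ck_mul => //; [|exact: IH|by apply: (IH (fun i => h i.+1))].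
rewrite (_ : (fun x => _) = (fun x => 1 + (-1) * sg x)).
  by apply: Ck_add; [exact: Ck_cst|apply: Ck_mul => //; exact: Ck_cst].
by apply/funext => x; ring.
Qed.
End Bernstein.

(** * C^1 approximation by tensor-product Bernstein polynomials *)

Section PolynomialApproximation.
Variable R : realType.
Local Notation plane := (R * R)%type.
Implicit Types (f g : plane -> R).

(** Bernstein averages are controlled through second moments, so uniform continuity is recast
    quadratically: for close points the error is [e], and for distant ones [2 * C] is absorbed by
    the squared distance. The tripled box leaves room for points that are located only up to one
    mesh step from a node. *)
Lemma quadratic_modulus g (M e : R) : continuous g -> 0 < M -> 0 < e ->
  exists2 K, 0 <= K & forall x y, box M x -> box (3 * M) y ->
    `|g y - g x| <= e + K * ((y.1 - x.1) ^+ 2 + (y.2 - x.2) ^+ 2).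
Proof.
move=> cg M0 e0; have [d d0 Hd] := box_uniformly_continuous M cg e0.
have [C C0 HC] := box_bounded (3 * M) cg.
exists (2 * C / d ^+ 2); first by rewrite divr_ge0 ?mulr_ge0 ?sqr_ge0// ltW.
move=> x y bx by3; set S := _ + _ ^+ 2.
have S0 : 0 <= S by rewrite addr_ge0 ?sqr_ge0.
have K0 : 0 <= 2 * C / d ^+ 2 by rewrite divr_ge0 ?mulr_ge0 ?sqr_ge0// ltW.
have [/andP[h1 h2]|] := boolP ((`|x.1 - y.1| < d) && (`|x.2 - y.2| < d)).
  by rewrite distrC (le_trans (ltW (Hd x y bx h1 h2)))// lerDl mulr_ge0.
rewrite negb_and -!leNgt => H.
have dS : d ^+ 2 <= S.
  have sq (a b : R) : d <= `|a - b| -> d ^+ 2 <= (b - a) ^+ 2.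
    by move=> h; rewrite -(real_normK (num_real (b - a))) distrC lerXn2r// nnegrE ltW.
  case/orP: H => /sq h; first by rewrite (le_trans h)// lerDl sqr_ge0.
  by rewrite (le_trans h)// lerDr sqr_ge0.
have bx3 : box (3 * M) x.
  by move/boxP: bx => [x1 x2]; apply/boxP; split; [apply: le_trans x1 _|apply: le_trans x2 _]; lra.
rewrite (le_trans (ler_normB _ _))// (le_trans (lerD (HC y by3) (HC x bx3)))//.
have -> : C + C = 2 * C / d ^+ 2 * d ^+ 2 by rewrite mulfVK ?expf_neq0 ?gt_eqF//; ring.
by apply: ler_wpDl; [exact: ltW|rewrite ler_wpM2l].
Qed.

Section Grid.
Variables (M : R) (N : nat).
Hypothesis M0 : 0 < M.
Let n := N.+1.

Definition node (i : nat) : R := - M + 2 * M * i%:R / n%:R.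
Definition rescale (a : R) : R := (a + M) / (2 * M).

Let n0 : 0 < n%:R :> R. Proof. by []. Qed.

Lemma rescale01 a : `|a| <= M -> 0 <= rescale a <= 1.
Proof.
rewrite ler_norml => /andP[h1 h2]; have M20 : 0 < 2 * M by rewrite mulr_gt0.
by rewrite /rescale divr_ge0 ?ler_pdivrMr//=; lra.
Qed.

Lemma node_bound i : (i <= n)%N -> `|node i| <= M.
Proof.
move=> iN; have h : i%:R <= n%:R :> R by rewrite ler_nat.
have : 0 <= (i%:R : R) / n%:R <= 1 by rewrite divr_ge0//= ler_pdivrMr// mul1r.
rewrite /node -mulrA; set r := _ / _ => /andP[r0 r1].
have p : 0 <= M * r <= M by rewrite mulr_ge0 ?(ltW M0)//= ger_pMr.
move: p => /andP[p0 p1]; rewrite -mulrA ler_norml; apply/andP; split; lra.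
Qed.

Lemma node_step i : node i.+1 - node i = 2 * M / n%:R.
Proof. by rewrite /node -[i.+1]addn1 natrD; ring. Qed.

Lemma node_moment m a : `|a| <= M -> m = n \/ m = N ->
  bern m (rescale a) (fun i => (node i - a) ^+ 2) <= 4 * M ^+ 2 / n%:R.
Proof.
move=> aM mN; have c01 := rescale01 aM.
pose V := bern m (rescale a) (fun i => (i%:R - n%:R * rescale a) ^+ 2).
have -> : bern m (rescale a) (fun i => (node i - a) ^+ 2) = (2 * M / n%:R) ^+ 2 * V.
  (* The summand [0 * 0] pads the coefficients to the two-term shape of [bern_lin]. *)
  rewrite (@bern_eq _ m _ _ (fun i => (2 * M / n%:R) ^+ 2 * (i%:R - n%:R * rescale a) ^+ 2 + 0 * 0)).
    by rewrite bern_lin bern_cst mul0r addr0.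
  move=> i _; rewrite mul0r addr0 -exprMn; congr (_ ^+ 2).
  by rewrite /node /rescale; field; rewrite !gt_eqF.
have VN : V <= n%:R by exact: bern_moment.
have -> : 4 * M ^+ 2 / n%:R = (2 * M / n%:R) ^+ 2 * n%:R by field; rewrite gt_eqF.
by rewrite ler_wpM2l// sqr_ge0.
Qed.

(** [bern_dist] in each variable replaces the two squares by second moments, each at most
    [4 * M ^+ 2 / n]. The degrees may drop to [N] so that the partial derivatives are covered
    too. *)
Lemma grid_error (m1 m2 : nat) (x : plane) (G : nat -> nat -> R) (v e K : R) :
  (m1 = n \/ m1 = N) -> (m2 = n \/ m2 = N) -> box M x -> 0 <= K ->
  (forall i j, (i <= m1)%N -> (j <= m2)%N ->
    `|G i j - v| <= e + K * ((node i - x.1) ^+ 2 + (node j - x.2) ^+ 2)) ->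
  `|bern m1 (rescale x.1) (fun i => bern m2 (rescale x.2) (fun j => G i j)) - v| <=
    e + K * (8 * M ^+ 2 / n%:R).
Proof.
move=> h1 h2 /boxP[x1 x2] K0 H.
have c1 := rescale01 x1; have c2 := rescale01 x2.
pose W2 := bern m2 (rescale x.2) (fun j => (node j - x.2) ^+ 2).
pose W1 := bern m1 (rescale x.1) (fun j => (node j - x.1) ^+ 2).
have HW : e + K * (W1 + W2) <= e + K * (8 * M ^+ 2 / n%:R).
  rewrite lerD2l ler_wpM2l// (le_trans (lerD (node_moment x1 h1) (node_moment x2 h2)))//.
  by rewrite -mulrDl -mulrDl; lra.
apply: le_trans HW.
apply: le_trans (@bern_dist _ m1 _ _ v (fun i => 1 * (e + K * W2) + K * (node i - x.1) ^+ 2) c1 _) _.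
  move=> i im; apply: le_trans (@bern_dist _ m2 _ _ v
    (fun j => 1 * (e + K * (node i - x.1) ^+ 2) + K * (node j - x.2) ^+ 2) c2 _) _.
    by move=> j jm; apply: le_trans (H i j im jm) _; lra.
  by rewrite bern_lin bern_cst -/W2; lra.
by rewrite bern_lin bern_cst -/W1; lra.
Qed.
End Grid.

Lemma is_derive_rescale (M a : R) (F : R -> R) (d : R) : 0 < M ->
  is_derive (rescale M a) (1 : R) F d -> is_derive a (1 : R) (fun s => F (rescale M s)) (d / (2 * M)).
Proof.
move=> M0 H.
have Hc : is_derive a (1 : R) (rescale M) (1 / (2 * M)).
  rewrite /rescale (_ : (fun a => _) = (fun a => (2 * M)^-1 * (a + M))).
    by apply: is_derive_eq; rewrite /GRing.scale /=; ring.
  by apply/funext => b; rewrite mulrC.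
by have := is_derive1_comp H Hc; rewrite mul1r.
Qed.

Lemma C1_approx f (d1 d2 : plane -> R) (M e : R) : 0 < M -> 0 < e ->
  continuous f -> continuous d1 -> continuous d2 ->
  (forall x, is_derive x (@e1 R) f (d1 x)) -> (forall x, is_derive x (@e2 R) f (d2 x)) ->
  exists p p1 p2 : plane -> R, [/\ forall k, Ck k p,
    forall x, is_derive x (@e1 R) p (p1 x), forall x, is_derive x (@e2 R) p (p2 x) &
    forall x, box M x -> [/\ `|p x - f x| <= e, `|p1 x - d1 x| <= e & `|p2 x - d2 x| <= e]].
Proof.
move=> M0 e0 cf c1 c2 H1 H2.
have e20 : 0 < e / 2 by rewrite divr_gt0.
have [K0 K00 HK0] := quadratic_modulus cf M0 e20.
have [K1 K10 HK1] := quadratic_modulus c1 M0 e20.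
have [K2 K20 HK2] := quadratic_modulus c2 M0 e20.
pose K := K0 + K1 + K2.
have K_ge0 : 0 <= K by rewrite !addr_ge0.
(* The constant 24 is 8 for moving from a node to an intermediate point, plus twice the 8 of
   [grid_error], the squares being doubled by that move. *)
have [N HN] : exists N : nat, K * (24 * M ^+ 2) / N.+1%:R <= e / 2.
  exists (Num.truncn (K * (24 * M ^+ 2) / (e / 2))).
  rewrite ler_pdivrMr// [leRHS]mulrC -ler_pdivrMr//; apply/ltW; exact: truncnS_gt.
pose n := N.+1; have n0 : 0 < n%:R :> R by [].
pose pt := node M N; pose sg := rescale M.
pose F i j := f (pt i, pt j).
pose B m1 m2 (G : nat -> nat -> R) (x : plane) :=
  bern m1 (sg x.1) (fun i => bern m2 (sg x.2) (fun j => G i j)).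
(* Difference quotients over the mesh [2 * M / n]; by the mean value theorem they are values of [d1]
   and [d2] at intermediate points. *)
pose D1 i j := (F i.+1 j - F i j) * (n%:R / (2 * M)).
pose D2 i j := (F i j.+1 - F i j) * (n%:R / (2 * M)).
have M20 : 0 < 2 * M by rewrite mulr_gt0.
have nM : n%:R / (2 * M) * (2 * M / n%:R) = 1 by field; rewrite !gt_eqF.
have st i := node_step M N i.
have in_box i (c : R) : (i <= n)%N -> `|c - pt i| <= `|pt i.+1 - pt i| ->
    `|c| <= 3 * M.
  move=> iN; rewrite st => h; have := node_bound M0 iN; rewrite -/pt => pM.
  rewrite -[c](subrK (pt i)) (le_trans (ler_normD _ _))//.
  have : `|2 * M / n%:R| <= 2 * M.
    by rewrite gtr0_norm ?divr_gt0// ler_pdivrMr// ler_peMr ?ler1n// ltW.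
  lra.
have in_box' i : (i <= n)%N -> `|pt i| <= 3 * M.
  by move=> iN; apply: (@in_box i) => //; rewrite subrr normr0.
(* From [(p + q)^2 <= 2 p^2 + 2 q^2] with [q] at most one mesh step, and
   [(2 M / n)^2 <= 4 M^2 / n]. *)
have sqr_bd i (c a : R) : `|c - pt i| <= `|pt i.+1 - pt i| ->
    (c - a) ^+ 2 <= 2 * (pt i - a) ^+ 2 + 8 * M ^+ 2 / n%:R.
  rewrite st [leRHS]gtr0_norm ?divr_gt0// => h.
  have h2 : (c - pt i) ^+ 2 <= (2 * M / n%:R) ^+ 2.
    by rewrite -(real_normK (num_real (c - _))) lerXn2r// nnegrE divr_ge0// ltW.
  have h3 : (2 * M / n%:R) ^+ 2 <= 4 * M ^+ 2 / n%:R.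
    have -> : (2 * M / n%:R) ^+ 2 = 4 * M ^+ 2 / n%:R / n%:R by field; rewrite gt_eqF.
    by rewrite ler_pdivrMr// ler_peMr ?ler1n// divr_ge0// mulr_ge0 ?sqr_ge0.
  have -> : c - a = (c - pt i) + (pt i - a) by ring.
  have := sqr_ge0 ((c - pt i) - (pt i - a)).
  have -> : 8 * M ^+ 2 / n%:R = 2 * (4 * M ^+ 2 / n%:R) by ring.
  nra.
have fin (x : plane) m1 m2 G v Kv : (m1 = n \/ m1 = N) -> (m2 = n \/ m2 = N) -> box M x ->
    0 <= Kv -> Kv <= K ->
    (forall i j, (i <= m1)%N -> (j <= m2)%N ->
    `|G i j - v| <= e / 2 + Kv * (2 * ((pt i - x.1) ^+ 2 + (pt j - x.2) ^+ 2) + 8 * M ^+ 2 / n%:R)) ->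
    `|B m1 m2 G x - v| <= e.
  move=> h1 h2 bx Kv0 KvK H.
  have := @grid_error M N M0 m1 m2 x G v (e / 2 + Kv * (8 * M ^+ 2 / n%:R)) (2 * Kv) h1 h2 bx
    (mulr_ge0 (ler0n _ 2) Kv0).
  move=> /(_ _)/le_trans; apply.
    by move=> i j im jm; apply: le_trans (H i j im jm) _; rewrite /pt; lra.
  have : Kv * (24 * M ^+ 2 / n%:R) <= K * (24 * M ^+ 2) / n%:R.
    by rewrite -[leRHS]mulrA ler_wpM2r// divr_ge0// mulr_ge0 ?sqr_ge0.
  have -> : 24 * M ^+ 2 / n%:R = 3 * (8 * M ^+ 2 / n%:R) by ring.
  by move: HN; rewrite -/n; lra.
have MMn : 0 <= 8 * M ^+ 2 / n%:R by rewrite divr_ge0// mulr_ge0 ?sqr_ge0.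
(* Differentiation lowers the degree in its own variable only, while the nodes stay those of degree
   [n]. *)
exists (B n n F), (B N n D1), (B n N D2); split.
- move=> k; apply: Ck_bern => [|i]; last first.
    apply: Ck_bern => [|j]; last exact: Ck_cst.
    rewrite (_ : (fun x => _) = affine 0 (2 * M)^-1 (M / (2 * M))); first exact: Ck_affine.
    by apply/funext => x; rewrite /affine /sg /rescale; ring.
  rewrite (_ : (fun x => _) = affine (2 * M)^-1 0 (M / (2 * M))); first exact: Ck_affine.
  by apply/funext => x; rewrite /affine /sg /rescale; ring.
- move=> x; apply: (is_derive_e1 _ _ _).2.
  have H := is_derive_rescale M0 (is_derive_bern N (sg x.1) (fun i => bern n (sg x.2) (fun j => F i j))).
  set D := (X in is_derive _ _ _ X) in H; suff -> : B N n D1 x = D by exact: H.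
  rewrite /B /D.
  rewrite (@bern_eq _ N _ (fun i => bern n (sg x.2) (fun j => D1 i j)) (fun i => n%:R / (2 * M) *
    (bern n (sg x.2) (fun j => F i.+1 j) - bern n (sg x.2) (fun j => F i j)) + 0 * 0)).
    by rewrite bern_lin /n; ring.
  move=> i _; rewrite (@bern_eq _ n _ (fun j => D1 i j) (fun j => n%:R / (2 * M) * F i.+1 j +
    (- (n%:R / (2 * M))) * F i j)); first by rewrite bern_lin; ring.
  by move=> j _; rewrite /D1; ring.
- move=> x; apply: (is_derive_e2 _ _ _).2.
  apply: (is_derive_bern_coeff n (sg x.1) (h := fun i s => bern n (sg s) (fun j => F i j))
    (dh := fun i s => bern N (sg s) (fun j => D2 i j))) => i.
  have H := is_derive_rescale M0 (is_derive_bern N (sg x.2) (fun j => F i j)).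
  set D := (X in is_derive _ _ _ X) in H; suff -> : bern N (sg x.2) (fun j => D2 i j) = D by exact: H.
  rewrite /D.
  rewrite (@bern_eq _ N _ (fun j => D2 i j) (fun j => n%:R / (2 * M) * (F i j.+1 - F i j) + 0 * 0)).
    by rewrite bern_lin /n; ring.
  by move=> j _; rewrite /D2; ring.
move=> x bx; split.
- apply: (fin x n n F _ K0) => //; [by left|by left|by rewrite /K; lra|] => i j iN jN.
  have bb : box (3 * M) (pt i, pt j) by apply/boxP; split; exact: in_box'.
  apply: le_trans (HK0 x (pt i, pt j) bx bb) _ => /=.
  rewrite lerD2l ler_wpM2l//.
  by have := addr_ge0 (sqr_ge0 (pt i - x.1)) (sqr_ge0 (pt j - x.2)); lra.
- apply: (fin x N n D1 _ K1) => //; [by right|by left|by rewrite /K; lra|] => i j iN jN.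
  have [c Hc Ec] := @mean_value R (fun s => f (s, pt j)) (fun s => d1 (s, pt j)) (pt i) (pt i.+1)
    (fun s => (is_derive_e1 f (s, pt j) _).1 (H1 _)).
  have -> : D1 i j = d1 (c, pt j) by rewrite /D1 /F Ec st mulrAC -mulrA nM mulr1.
  have bb : box (3 * M) (c, pt j).
    by apply/boxP; split; [apply: (@in_box i) => //; exact: leqW|exact: in_box'].
  apply: le_trans (HK1 x (c, pt j) bx bb) _ => /=.
  rewrite lerD2l ler_wpM2l//.
  have := sqr_bd i c x.1 Hc; have := sqr_ge0 (pt j - x.2); lra.
- apply: (fin x n N D2 _ K2) => //; [by left|by right|by rewrite /K; lra|] => i j iN jN.
  have [c Hc Ec] := @mean_value R (fun s => f (pt i, s)) (fun s => d2 (pt i, s)) (pt j) (pt j.+1)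
    (fun s => (is_derive_e2 f (pt i, s) _).1 (H2 _)).
  have -> : D2 i j = d2 (pt i, c) by rewrite /D2 /F Ec st mulrAC -mulrA nM mulr1.
  have bb : box (3 * M) (pt i, c).
    by apply/boxP; split; [exact: in_box'|apply: (@in_box j) => //; exact: leqW].
  apply: le_trans (HK2 x (pt i, c) bx bb) _ => /=.
  rewrite lerD2l ler_wpM2l//.
  have := sqr_bd j c x.2 Hc; have := sqr_ge0 (pt i - x.1); lra.
Qed.
End PolynomialApproximation.

(** * Smooth compactly supported cutoffs *)

Section Cutoff.
Variable R : realType.
Local Notation plane := (R * R)%type.
Implicit Types (f g : plane -> R).

(* [z / n <= exp(z / n)], raised to the power [n]. *)
Lemma pow_le_expR n (z : R) : 0 <= z -> z ^+ n <= n%:R ^+ n * expR z.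
Proof.
move=> z0; case: n => [|n]; first by rewrite !expr0 mul1r -expR0 ler_expR.
have n0 : 0 < n.+1%:R :> R by [].
have h : z / n.+1%:R <= expR (z / n.+1%:R).
  by apply: le_trans (expR_ge1Dx _); rewrite lerDr.
have -> : expR z = expR (z / n.+1%:R) ^+ n.+1.
  by rewrite -expRM_natr divfK// gt_eqF.
rewrite -exprMn lerXn2r ?nnegrE// ?mulr_ge0 ?expR_ge0//.
by rewrite mulrC -ler_pdivrMr.
Qed.

Lemma horner_le_expR (q : {poly R}) : exists2 C, 0 < C & forall z, 0 <= z -> `|q.[z]| <= C * expR z.
Proof.
exists (\sum_(i < size q) `|q`_i| * i%:R ^+ i + 1).
  by rewrite ltr_wpDl// sumr_ge0// => i _; rewrite mulr_ge0// exprn_ge0.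
move=> z z0; rewrite horner_coef (le_trans (ler_norm_sum _ _ _))//.
rewrite mulrDl mulr_suml -[leLHS]addr0 lerD// ?mul1r ?expR_ge0//.
apply: ler_sum => i _; rewrite normrM -mulrA ler_wpM2l// normrX ger0_norm//.
exact: pow_le_expR.
Qed.

(* [q(1/y) exp(-1/y)], extended by 0: a family closed under differentiation, hence
   consisting of smooth functions. *)
Definition flat_exp (q : {poly R}) (y : R) : R :=
  if 0 < y then q.[y^-1] * expR (- y^-1) else 0.

Lemma flat_exp_bounded q : exists2 C, 0 < C & forall y, `|flat_exp q y| <= C.
Proof.
have [C C0 HC] := horner_le_expR q; exists C => // y; rewrite /flat_exp.
case: ltP => y0; last by rewrite normr0 ltW.
by rewrite normrM expRN normfV (ger0_norm (expR_ge0 _)) ler_pdivrMr ?expR_gt0// HC// invr_ge0 ltW.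
Qed.

(** With [z = 1/y] the chain rule contributes [- z^2], whence the new polynomial. At 0, the
    exponential bound for ['X^2 * q] yields [|flat_exp q h| <= C h^2], so the derivative there is
    0. *)
Lemma is_derive_flat_exp q (y : R) : is_derive y (1 : R) (flat_exp q) (flat_exp ('X^2 * (q - q^`())) y).
Proof.
have [y0|y0|->] := ltgtP y 0.
- rewrite {2}/flat_exp ltNge (ltW y0) /=; apply: near_eq_is_derive (is_derive_cst 0 _ _).
  near=> z; rewrite /flat_exp ltNge (_ : z <= 0)//; apply/ltW; near: z; exact: lt_nbhsl.
- have yn0 : y != 0 by rewrite gt_eqF.
  have Hi : is_derive y (1 : R) (fun z : R => z^-1) (- y ^- 2).
    have := is_deriveV yn0 (is_derive_id y (1 : R)).
    by move=> /is_derive_eq; apply; rewrite /GRing.scale /= mulr1.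
  have Hq : is_derive (y^-1) (1 : R) (fun z => q.[z]) (q^`().[y^-1]).
    have : derivable (horner q) (y^-1) 1 by exact: derivable_horner.
    by move=> /derivableP; rewrite -derive1E -derivE.
  have H1 := is_derive1_comp Hq Hi.
  have H2 : is_derive y (1 : R) (fun z : R => expR (- z^-1)) (expR (- y^-1) * (y ^- 2)).
    have Hn : is_derive y (1 : R) (fun z : R => - z^-1) (y ^- 2).
      by apply: is_derive_eq; rewrite opprK.
    exact: (is_derive1_comp (is_derive_expR _) Hn).
  have H3 := is_deriveM H1 H2.
  suff H4 : is_derive y (1 : R) (fun z => q.[z^-1] * expR (- z^-1)) (flat_exp ('X^2 * (q - q^`())) y).
    apply: near_eq_is_derive H4; near=> z.
    by rewrite /flat_exp (_ : 0 < z)//; near: z; exact: lt_nbhsr.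
  rewrite /flat_exp y0 (_ : _ * _ = q.[y^-1] *: (expR (- y^-1) / y ^+ 2) +
    expR (- y^-1) *: (q^`().[y^-1] * - y ^- 2)); first exact: H3.
  by rewrite /GRing.scale /= !(hornerM, hornerD, hornerN, hornerXn, hornerX); field.
have -> : flat_exp ('X^2 * (q - q^`())) 0 = 0 by rewrite /flat_exp ltxx.
apply: is_derive_eps => e e0.
have [C C0 HC] := horner_le_expR ('X^2 * q).
exists (e / C); first by rewrite divr_gt0.
move=> h; rewrite add0r mulr0 subr0 /flat_exp ltxx subr0.
move=> hC; case: (ltP 0 h) => h0; last by rewrite normr0 mulr_ge0// ltW.
have hn0 : h != 0 by rewrite gt_eqF.
rewrite (gtr0_norm h0) in hC *.
have := HC h^-1; rewrite invr_ge0 (ltW h0) hornerM hornerXn => /(_ isT).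
rewrite normrM normrX normfV (gtr0_norm h0) => K.
rewrite normrM expRN normfV (ger0_norm (expR_ge0 _)) ler_pdivrMr ?expR_gt0//.
have -> : `|q.[h^-1]| = h ^+ 2 * (h^-1 ^+ 2 * `|q.[h^-1]|).
  by rewrite mulrA -exprMn divff// expr1n mul1r.
apply: (le_trans (ler_wpM2l (sqr_ge0 h) K)).
rewrite mulrA ler_wpM2r ?expR_ge0//.
rewrite expr2 -mulrA mulrC ler_wpM2r ?(ltW h0)//.
by rewrite -ler_pdivlMr// ltW.
Unshelve. all: by end_near. Qed.

Lemma flat_exp_continuous q : continuous (flat_exp q).
Proof.
by move=> y; apply: differentiable_continuous; apply/derivable1_diffP; case: (is_derive_flat_exp q y).
Qed.

Lemma Ck_flat_exp k q a b c : Ck k (fun x => flat_exp q (affine a b c x)).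
Proof.
elim: k q => [|k IH] q.
  move=> x; apply: (@cvg_comp _ _ _ (affine a b c) (flat_exp q)); first exact: affine_continuous.
  exact: flat_exp_continuous.
pose q' := 'X^2 * (q - q^`()).
apply: (@CkS _ k _ (fun x => flat_exp q' (affine a b c x) * a) (fun x => flat_exp q' (affine a b c x) * b)).
- move=> x; apply: (is_derive_e1 _ _ _).2.
  exact: (is_derive1_comp (is_derive_flat_exp q _) ((is_derive_e1 _ _ _).1 (is_derive_affine1 a b c x))).
- move=> x; apply: (is_derive_e2 _ _ _).2.
  exact: (is_derive1_comp (is_derive_flat_exp q _) ((is_derive_e2 _ _ _).1 (is_derive_affine2 a b c x))).
- move=> x; apply: (@cvg_comp _ _ _ (affine a b c) (flat_exp q)); first exact: affine_continuous.
  exact: flat_exp_continuous.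
- by apply: Ck_mul; [exact: IH|exact: Ck_cst].
- by apply: Ck_mul; [exact: IH|exact: Ck_cst].
Qed.

(** A standard bump supported in [[-1, 1]]; the factor [expR 2] compensates the two values
    [expR (-1)] at the origin. *)
Definition hat (y : R) : R := expR 2 * (flat_exp 1 (1 - y) * flat_exp 1 (1 + y)).

Lemma hat0 : hat 0 = 1.
Proof.
rewrite /hat subr0 addr0 /flat_exp ltr01 hornerC mul1r invr1 -!expRD.
by rewrite [X in expR X](_ : _ = 0) ?expR0//; ring.
Qed.

Lemma hat_vanishes y : 1 <= `|y| -> hat y = 0.
Proof.
rewrite ler_normr /hat /flat_exp => /orP[y1|y1].
  by rewrite [0 < 1 - y]ltNge (_ : 1 - y <= 0) ?mul0r ?mulr0//; lra.
by rewrite [0 < 1 + y]ltNge (_ : 1 + y <= 0) ?mul0r ?mulr0//; lra.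
Qed.

Lemma hat_Lipschitz : exists2 L, 1 <= L & exists dhat : R -> R,
  [/\ forall y, is_derive y (1 : R) hat (dhat y), forall y, `|dhat y| <= L &
      forall y, `|hat y| <= L /\ `|1 - hat y| <= L * `|y| ].
Proof.
have [C C0 HC] := flat_exp_bounded 1.
have [D D0 HD] := flat_exp_bounded ('X^2 * (1 - 1^`())).
set q := 'X^2 * _ in HD.
pose dhat y := expR 2 * (flat_exp 1 (1 - y) * flat_exp q (1 + y) - flat_exp q (1 - y) * flat_exp 1 (1 + y)).
have e0 : 0 < expR 2 :> R by exact: expR_gt0.
have Hd y : is_derive y (1 : R) hat (dhat y).
  have A1 : is_derive y (1 : R) (fun y : R => 1 - y) (-1).
    by apply: is_derive_eq; rewrite /GRing.scale /=; ring.
  have A2 : is_derive y (1 : R) (fun y : R => 1 + y) 1.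
    by apply: is_derive_eq; rewrite /GRing.scale /=; ring.
  have B1 := @is_derive1_comp R (flat_exp 1) (fun y => 1 - y) y _ _ (is_derive_flat_exp 1 (1 - y)) A1.
  have B2 := @is_derive1_comp R (flat_exp 1) (fun y => 1 + y) y _ _ (is_derive_flat_exp 1 (1 + y)) A2.
  have := is_deriveZ (expR 2) (is_deriveM B1 B2).
  rewrite (_ : dhat y = expR 2 *: ((flat_exp 1 \o (fun y => 1 - y)) y *: (flat_exp q (1 + y) * 1)
    + (flat_exp 1 \o (fun y => 1 + y)) y *: (flat_exp q (1 - y) * -1)))//.
  by rewrite /GRing.scale /dhat /=; ring.
pose L := expR 2 * (2 * C * D) + expR 2 * (C * C) + 1.
have p1 : 0 < expR 2 * (C * C) by rewrite !mulr_gt0.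
have p2 : 0 < expR 2 * (2 * C * D) by rewrite !mulr_gt0.
have dL y : `|dhat y| <= L.
  rewrite /dhat normrM (gtr0_norm e0).
  have : expR 2 * `|flat_exp 1 (1 - y) * flat_exp q (1 + y) - flat_exp q (1 - y) * flat_exp 1 (1 + y)| <= expR 2 * (2 * C * D).
    rewrite ler_pM2l// (le_trans (ler_normB _ _))// !normrM.
    have -> : 2 * C * D = C * D + D * C by ring.
    by apply: lerD; apply: ler_pM.
  by rewrite /L; lra.
exists L; first by rewrite /L; lra.
exists dhat; split=> // y; split.
  rewrite /hat normrM (gtr0_norm e0).
  have : expR 2 * `|flat_exp 1 (1 - y) * flat_exp 1 (1 + y)| <= expR 2 * (C * C).
    by rewrite ler_pM2l// normrM ler_pM.
  by rewrite /L; lra.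
have [c _] := @mean_value R hat dhat 0 y Hd; rewrite hat0 subr0 => E.
by rewrite distrC E normrM ler_wpM2r.
Qed.

(** [L] does not depend on [m]: both the gradient and the deficit [1 - eta] carry a factor [1 / m].
    The deficit may grow linearly in [x], so no plateau where [eta = 1] is needed; the decay of the
    modes pays for this growth. *)
Lemma cutoff_exists : exists2 L : R, 0 < L & forall m, 1 <= m -> exists eta d1 d2 : plane -> R,
  [/\ forall k, Ck k eta, vanishes_outside m eta,
    (forall x, is_derive x (@e1 R) eta (d1 x)) /\ (forall x, is_derive x (@e2 R) eta (d2 x)) &
    forall x, [/\ `|eta x| <= L, `|d1 x| <= L / m, `|d2 x| <= L / m &
      `|1 - eta x| <= L / m * (`|x.1| + `|x.2|)]].
Proof.
have [L L1 [dhat [Hd dL HL]]] := hat_Lipschitz.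
have L0 : 0 < L by lra.
have LL : L <= L ^+ 2 by rewrite expr2 ler_peMr// ltW.
exists (L ^+ 2); first by rewrite exprn_gt0.
move=> m m1; have m0 : 0 < m by lra.
pose eta (x : plane) := hat (x.1 / m) * hat (x.2 / m).
exists eta, (fun x => hat (x.2 / m) * (dhat (x.1 / m) / m)), (fun x => hat (x.1 / m) * (dhat (x.2 / m) / m)).
have Hdm s : is_derive s (1 : R) (fun s => hat (s / m)) (dhat (s / m) / m).
  have A : is_derive s (1 : R) (fun s : R => s / m) m^-1.
    rewrite (_ : (fun s => _) = (fun s => m^-1 * s)); last by apply/funext => ?; rewrite mulrC.
    by apply: is_derive_eq; rewrite /GRing.scale /= mulr1.
  exact: (is_derive1_comp (Hd _) A).
split.
- move=> k; rewrite (_ : eta = fun x => (expR 2 * (flat_exp 1 (affine (- m^-1) 0 1 x) * flat_exp 1 (affine m^-1 0 1 x))) *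
   (expR 2 * (flat_exp 1 (affine 0 (- m^-1) 1 x) * flat_exp 1 (affine 0 m^-1 1 x)))).
    by do ![exact: Ck_flat_exp | exact: Ck_cst | apply: Ck_mul].
  apply/funext => x; rewrite /eta /hat /affine; congr (_ * (flat_exp _ _ * flat_exp _ _) * (_ * (flat_exp _ _ * flat_exp _ _))); ring.
- move=> x nb; rewrite /eta.
  have [h1|h1] := leP `|x.1| m; last first.
    by rewrite (@hat_vanishes (x.1 / m)) ?mul0r// normrM normfV (gtr0_norm m0) ler_pdivlMr// mul1r ltW.
  have [h2|h2] := leP `|x.2| m; first by case: nb; apply/boxP.
  by rewrite (@hat_vanishes (x.2 / m)) ?mulr0// normrM normfV (gtr0_norm m0) ler_pdivlMr// mul1r ltW.
- split=> x.
    apply: (is_derive_e1 _ _ _).2; rewrite /eta /=.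
    have A := Hdm x.1; apply: is_derive_eq.
    by rewrite /GRing.scale /=; ring.
  apply: (is_derive_e2 _ _ _).2; rewrite /eta /=.
  have A := Hdm x.2; apply: is_derive_eq.
  by rewrite /GRing.scale /=; ring.
- move=> x; have [b1 c1] := HL (x.1 / m); have [b2 c2] := HL (x.2 / m).
  have dv (a b : R) : `|a| <= L -> `|b| <= L -> `|a * (b / m)| <= L ^+ 2 / m.
    move=> ha hb; rewrite mulrA normrM normfV (gtr0_norm m0) ler_wpM2r ?invr_ge0 ?(ltW m0)//.
    by rewrite normrM expr2 ler_pM.
  split.
  + by rewrite /eta normrM expr2 ler_pM.
  + exact: dv.
  + exact: dv.
  + have -> : 1 - eta x = (1 - hat (x.1 / m)) + hat (x.1 / m) * (1 - hat (x.2 / m)).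
      by rewrite /eta; ring.
    rewrite (le_trans (ler_normD _ _))// [leRHS]mulrDr.
    rewrite !normrM !normfV (gtr0_norm m0) in c1 c2; rewrite (normrM (hat (x.1 / m))); apply: lerD.
      apply: le_trans c1 _; rewrite -mulrA [m^-1 * _]mulrC.
      by rewrite ler_wpM2r// divr_ge0// ltW.
    rewrite [X in _ <= X](_ : _ = L * (L * (`|x.2| / m))); last by ring.
    by rewrite ler_pM.
Qed.
End Cutoff.

(** * The scalar potential of the field *)

Section TrigonometricSeries.
Variable R : realType.
Notation sum u := (limn (series u)).

Lemma dominated_series (u v : nat -> R) : (forall n, `|u n| <= v n) -> cvgn (series v) ->
  cvgn (series u) /\ `|sum u| <= sum v.
Proof.
move=> uv cv.
have cnu : cvgn [normed series u].
  apply: (series_le_cvg _ _ uv cv) => n //; exact: le_trans (normr_ge0 _) (uv n).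
split; first exact: normed_cvg.
by apply: le_trans (lim_series_norm cnu) _; exact: lim_series_le.
Qed.

Lemma sum_ge_partial (u : nat -> R) n : (forall n, 0 <= u n) -> cvgn (series u) ->
  series u n <= sum u.
Proof. by move=> u0 cu; apply: nondecreasing_cvgn_le => //; apply: nondecreasing_series. Qed.

(** Summing second-order remainder bounds gives a remainder of at most [sum M * h ^+ 2], which
    replaces any argument by uniform convergence of the derivatives. *)
Lemma is_derive_series (f df : nat -> R -> R) (M : nat -> R) (y : R) :
  (forall n h, `|f n (y + h) - f n y - h * df n y| <= M n * h ^+ 2) ->
  cvgn (series M) -> (forall z, cvgn (series (f ^~ z))) -> cvgn (series (df ^~ y)) ->
  is_derive y (1 : R) (fun z => sum (f ^~ z)) (sum (df ^~ y)).
Proof.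
move=> H cM cf cdf; apply: is_derive_eps => e e0.
have M0 n : 0 <= M n by have := H n 1; rewrite expr1n mulr1; apply: le_trans.
have S0 : 0 <= sum M by have := sum_ge_partial 0 M0 cM; rewrite /series /= big_geq.
(* Adding 1 keeps the denominator positive when all the [M n] vanish. *)
exists (e / (sum M + 1)); first by rewrite divr_gt0// ltr_wpDl.
move=> h he.
pose r n := f n (y + h) - f n y - h * df n y.
have -> : sum (f ^~ (y + h)) - sum (f ^~ y) - h * sum (df ^~ y) = sum r.
  have -> : h * sum (df ^~ y) = sum (h *: (df ^~ y)) by rewrite (lim_seriesZ h cdf).
  rewrite -lim_seriesB// -lim_seriesB//; first exact: is_cvg_seriesB.
  exact: is_cvg_seriesZ.
have cMh : cvgn (series (h ^+ 2 *: M)) by exact: is_cvg_seriesZ.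
have rM n : `|r n| <= (h ^+ 2 *: M) n.
  by rewrite /r (le_trans (H n h))// mulrC.
have [_] := dominated_series rM cMh.
rewrite lim_seriesZ// => K; apply: le_trans K _; rewrite /GRing.scale /=.
rewrite -(real_normK (num_real h)) expr2 mulrAC ler_wpM2r//.
have : `|h| * (sum M + 1) <= e by rewrite -ler_pdivlMr ?ltW// ltr_wpDl.
by apply: le_trans; rewrite ler_wpM2l// lerDl.
Qed.

Lemma taylor_bound (F dF ddF : R -> R) (K y h : R) : 0 <= K ->
  (forall s, is_derive s (1 : R) F (dF s)) -> (forall s, is_derive s (1 : R) dF (ddF s)) ->
  (forall s, `|ddF s| <= K) -> `|F (y + h) - F y - h * dF y| <= K * h ^+ 2.
Proof.
move=> K0 H1 H2 HK.
have [c Hc ->] := mean_value y (y + h) H1.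
have [d _ Ed] := mean_value y c H2.
have yh : y + h - y = h by ring.
rewrite yh in Hc *; rewrite [h * _]mulrC -mulrBl Ed !normrM.
rewrite -(real_normK (num_real h)) expr2 mulrA ler_wpM2r// ler_pM//.
Qed.

Lemma cos_taylor (c l y h : R) : 0 <= c ->
  `|c * cos (l * (y + h)) - c * cos (l * y) - h * (- (c * l * sin (l * y)))| <= c * l ^+ 2 * h ^+ 2.
Proof.
move=> c0.
have Hl s : is_derive s (1 : R) (fun s => l * s) l.
  by apply: is_derive_eq; rewrite /GRing.scale /= mulr1.
have Hs s := is_derive1_comp (is_derive_sin (l * s)) (Hl s).
have Hc s := is_derive1_comp (is_derive_cos (l * s)) (Hl s).
have D1 s : is_derive s (1 : R) (fun s => c * cos (l * s)) (- (c * l * sin (l * s))).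
  rewrite (_ : - _ = c *: (- sin (l * s) * l)); first exact: (is_deriveZ c (Hc s)).
  by rewrite /GRing.scale /=; ring.
have D2 s : is_derive s (1 : R) (fun s => - (c * l * sin (l * s))) (- (c * l * (cos (l * s) * l))).
  exact: (is_deriveN (is_deriveZ (c * l) (Hs s))).
apply: (taylor_bound _ _ _ D1 D2) => [|s]; first by rewrite mulr_ge0// sqr_ge0.
rewrite normrN !normrM (ger0_norm c0) -(real_normK (num_real l)) expr2 -!mulrA.
by do 2 rewrite ler_wpM2l//; rewrite ler_piMl// cos_max.
Qed.

Lemma sin_taylor (c l y h : R) : 0 <= c ->
  `|c * sin (l * (y + h)) - c * sin (l * y) - h * (c * l * cos (l * y))| <= c * l ^+ 2 * h ^+ 2.
Proof.
move=> c0.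
have Hl s : is_derive s (1 : R) (fun s => l * s) l.
  by apply: is_derive_eq; rewrite /GRing.scale /= mulr1.
have Hs s := is_derive1_comp (is_derive_sin (l * s)) (Hl s).
have Hc s := is_derive1_comp (is_derive_cos (l * s)) (Hl s).
have D1 s : is_derive s (1 : R) (fun s => c * sin (l * s)) (c * l * cos (l * s)).
  rewrite (_ : c * l * _ = c *: (cos (l * s) * l)); first exact: (is_deriveZ c (Hs s)).
  by rewrite /GRing.scale /=; ring.
have D2 s : is_derive s (1 : R) (fun s => c * l * cos (l * s)) (- (c * l * (sin (l * s) * l))).
  rewrite (_ : - _ = (c * l) *: (- sin (l * s) * l)); first exact: (is_deriveZ (c * l) (Hc s)).
  by rewrite /GRing.scale /=; ring.
apply: (taylor_bound _ _ _ D1 D2) => [|s]; first by rewrite mulr_ge0// sqr_ge0.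
rewrite normrN !normrM (ger0_norm c0) -(real_normK (num_real l)) expr2 -!mulrA.
by do 2 rewrite ler_wpM2l//; rewrite ler_piMl// sin_max.
Qed.

Lemma norm_sin_le (x : R) : `|sin x| <= `|x|.
Proof.
have [c _] := mean_value 0 x (@is_derive_sin R); rewrite sin0 !subr0 => ->.
by rewrite normrM ler_piMl// cos_max.
Qed.

Lemma norm_one_sub_cos_le (x : R) : 0 <= 1 - cos x <= x ^+ 2.
Proof.
rewrite subr_ge0 cos_le1 /=.
have := @cos_taylor 1 1 0 x ler01; rewrite !mul1r add0r cos0 sin0 oppr0 mulr0 subr0 expr1n mul1r.
by apply: le_trans; rewrite distrC ler_norm.
Qed.

(** By the half angle, [1 - cos x = 2 sin^2 u] with [u = x / 2]. Since [|u| <= 1/2], the estimate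
    [|u| <= |sin u| + u^2] gives [|sin u| >= |u| / 2], hence the constant 8. *)
Lemma one_sub_cos_ge (x : R) : `|x| <= 1 -> x ^+ 2 / 8 <= 1 - cos x.
Proof.
move=> x1; pose u := x / 2.
have -> : x = u + u by rewrite /u -splitr.
have un : `|u| <= 1 / 2 by move: x1; rewrite /u !ler_norml => /andP[? ?]; apply/andP; split; lra.
rewrite cosD; have := cos2Dsin2 u.
have := @sin_taylor 1 1 0 u ler01; rewrite !mul1r add0r cos0 sin0 subr0 expr1n mul1r mulr1 => h.
have : `|u| / 2 <= `|sin u|.
  have : `|u| <= `|sin u| + `|u| ^+ 2.
    rewrite real_normK ?num_real//; apply: (le_trans _ (lerD (lexx _) h)).
    by rewrite -{1}[u](subKr (sin u)); apply: ler_normB.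
  have := normr_ge0 u; nra.
have n0 := normr_ge0 u.
move=> k; have : (`|u| / 2) ^+ 2 <= `|sin u| ^+ 2 by rewrite lerXn2r// nnegrE divr_ge0.
by rewrite exprMn !real_normK ?num_real//; nra.
Qed.
End TrigonometricSeries.

(** * The potential [Phi]: derivatives, growth and decay of its exponential *)

Section CosinePotential.
Variables (R : realType) (t s : R).
Hypotheses (ht : 0 < t) (hs : 1 < s) (hst : s - 2 * t < 1).
Notation sum u := (limn (series u)).

Let a (n : nat) : R := n.+1%:R `^ (- s).
Let l (n : nat) : R := n.+1%:R `^ (- t).

Let a_gt0 n : 0 < a n. Proof. exact: powR_gt0. Qed.
Let l_gt0 n : 0 < l n. Proof. exact: powR_gt0. Qed.
Let l_le1 n : l n <= 1.
Proof. by rewrite -(powRr0 n.+1%:R); apply: ler_powR; rewrite ?ler1n// oppr_le0 ltW. Qed.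

(* From [ln x <= x - 1]; summing over [n] bounds the partial sums of [a]. *)
Lemma powR_telescope n : (s - 1) * a n.+1 <= n.+1%:R `^ (1 - s) - n.+2%:R `^ (1 - s).
Proof.
have p0 : 0 < n.+1%:R :> R by []. have q0 : 0 < n.+2%:R :> R by [].
have E : n.+1%:R `^ (1 - s) = n.+2%:R `^ (1 - s) * expR ((1 - s) * ln (n.+1%:R / n.+2%:R)) :> R.
  rewrite /powR !gt_eqF// -expRD ln_div ?posrE//; congr expR; ring.
have L : ln (n.+1%:R / n.+2%:R) <= - n.+2%:R^-1 :> R.
  have -> : n.+1%:R / n.+2%:R = 1 + - n.+2%:R^-1 :> R.
    have q1 : n.+2%:R = n.+1%:R + 1 :> R by rewrite -[n.+2]addn1 natrD.
    apply: (mulIf (lt0r_neq0 q0)); rewrite divfK ?lt0r_neq0// mulrDl mul1r mulNr mulVf ?lt0r_neq0//.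
    by rewrite q1 addrK.
  by apply: le_ln1Dx; rewrite ltrN2 invf_lt1// ltr1n.
have X : 1 + (s - 1) * n.+2%:R^-1 <= expR ((1 - s) * ln (n.+1%:R / n.+2%:R)).
  apply: le_trans (expR_ge1Dx _); rewrite lerD2l.
  rewrite -subr_ge0 [X in 0 <= X](_ : _ = (s - 1) * (- n.+2%:R^-1 - ln (n.+1%:R / n.+2%:R))); last by ring.
  by rewrite mulr_ge0// subr_ge0// ltW.
have -> : a n.+1 = n.+2%:R `^ (1 - s) * n.+2%:R^-1.
  rewrite /a -[in RHS](powR_inv1 (ltW q0)) -powRD; last by rewrite (gt_eqF q0) implybT.
  by congr (_ `^ _); ring.
rewrite E [leRHS](_ : _ = n.+2%:R `^ (1 - s) * (expR ((1 - s) * ln (n.+1%:R / n.+2%:R)) - 1)); last by ring.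
by rewrite mulrCA ler_wpM2l ?powR_ge0// lerBrDl.
Qed.

Lemma powR_summable : cvgn (series a).
Proof.
apply: nondecreasing_is_cvgn; first by apply: nondecreasing_series => n _ _; exact: ltW.
exists (1 + (s - 1)^-1) => _ [n _ <-].
have s1 : 0 < s - 1 by rewrite subr_gt0.
case: n => [|n]; first by rewrite /series /= big_geq// addr_ge0// invr_ge0 ltW.
suff : series a n.+1 <= 1 + (s - 1)^-1 * (1 - n.+1%:R `^ (1 - s)).
  move/le_trans; apply; rewrite lerD2l; apply: ler_piMr; first by rewrite invr_ge0 ltW.
  by have := powR_ge0 (n.+1%:R : R) (1 - s); lra.
elim: n => [|n IH].
  by rewrite /series /= big_nat1 /a !powR1 /= subrr mulr0 addr0.
rewrite /series /= big_nat_recr//=; apply: le_trans (lerD IH (lexx _)) _.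
have : a n.+1 <= (s - 1)^-1 * (n.+1%:R `^ (1 - s) - n.+2%:R `^ (1 - s)).
  by rewrite mulrC ler_pdivlMr// mulrC powR_telescope.
lra.
Qed.

Let S := sum a.

Definition Phi (y : R) : R := sum (fun n => a n / l n ^+ 2 * (1 - cos (l n * y))).
Definition dPhi (y : R) : R := sum (fun n => a n / l n * sin (l n * y)).

Let al2 n : a n / l n ^+ 2 * l n ^+ 2 = a n. Proof. by rewrite divfK// expf_neq0// gt_eqF. Qed.
Let al1 n : a n / l n * l n = a n. Proof. by rewrite divfK// gt_eqF. Qed.
Let al2_gt0 n : 0 < a n / l n ^+ 2. Proof. by rewrite divr_gt0// exprn_gt0. Qed.
Let al1_gt0 n : 0 < a n / l n. Proof. by rewrite divr_gt0. Qed.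

Lemma summable_scaled (c : R) : cvgn (series (c *: a)) /\ sum (c *: a) = c * S.
Proof.
split; first by apply: is_cvg_seriesZ; exact: powR_summable.
by rewrite lim_seriesZ//; exact: powR_summable.
Qed.

(** The upper bound regains the factor [l n ^+ 2] from [1 - cos z <= z^2] and yields convergence;
    the lower bound lets any block of terms bound [Phi] from below. *)
Lemma Phi_term_bounds n y : 0 <= a n / l n ^+ 2 * (1 - cos (l n * y)) <= y ^+ 2 * a n.
Proof.
have /andP[c0 c1] := norm_one_sub_cos_le (l n * y).
rewrite mulr_ge0 ?(ltW (al2_gt0 n))//=.
apply: le_trans (ler_wpM2l (ltW (al2_gt0 n)) c1) _.
by rewrite exprMn mulrA al2 mulrC.
Qed.

Lemma Phi_summable y : cvgn (series (fun n => a n / l n ^+ 2 * (1 - cos (l n * y)))).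
Proof.
apply: (dominated_series _ (summable_scaled (y ^+ 2)).1).1 => n.
by have /andP[h1 h2] := Phi_term_bounds n y; rewrite ger0_norm.
Qed.

(** The linear growth matters as much as the convergence: [dPhi] enters the gradient of the modes,
    where it costs one power of [|x|]. *)
Lemma dPhi_bound y : cvgn (series (fun n => a n / l n * sin (l n * y))) /\
  `|dPhi y| <= S * `|y|.
Proof.
have [c E] := summable_scaled `|y|; rewrite [S * _]mulrC -E.
apply: dominated_series => // n /=.
rewrite normrM (gtr0_norm (al1_gt0 n)).
apply: le_trans (ler_wpM2l (ltW (al1_gt0 n)) (norm_sin_le _)) _.
by rewrite normrM (gtr0_norm (l_gt0 n)) mulrA al1 mulrC.
Qed.

Lemma cos_series_bound y : cvgn (series (fun n => a n * cos (l n * y))) /\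
  `|cos_series t s y| <= S.
Proof.
rewrite /cos_series; apply: (@dominated_series R (fun n => a n * cos (l n * y)) a) => [n|]; last exact: powR_summable.
by rewrite normrM (gtr0_norm (a_gt0 n)) ler_piMr ?(ltW (a_gt0 n))// cos_max.
Qed.

Lemma is_derive_Phi y : is_derive y (1 : R) Phi (dPhi y).
Proof.
apply: (@is_derive_series R (fun n z => a n / l n ^+ 2 * (1 - cos (l n * z)))
  (fun n z => a n / l n * sin (l n * z)) a y _ powR_summable Phi_summable (dPhi_bound y).1).
move=> n h; have := cos_taylor (l n) y h (ltW (al2_gt0 n)).
rewrite al2 -normrN; apply: le_trans; rewrite le_eqVlt; apply/orP; left; apply/eqP; congr `|_|.
by field; rewrite gt_eqF.
Qed.

Lemma is_derive_dPhi y : is_derive y (1 : R) dPhi (cos_series t s y).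
Proof.
apply: (@is_derive_series R (fun n z => a n / l n * sin (l n * z))
  (fun n z => a n * cos (l n * z)) a y _ powR_summable (fun z => (dPhi_bound z).1) (cos_series_bound y).1).
move=> n h; have := sin_taylor (l n) y h (ltW (al1_gt0 n)).
rewrite al1 -/(a n) -/(l n) => /le_trans; apply.
(* The Taylor constant is [a n * l n], at most [a n] because [l n <= 1]. *)
by rewrite ler_wpM2r ?sqr_ge0// expr2 mulrA al1 ler_piMr// ltW.
Qed.

Let delta := 2 * t + 1 - s.
Let delta_gt0 : 0 < delta. Proof. by rewrite /delta; move: hst; lra. Qed.

Lemma Phi_ge0 y : 0 <= Phi y.
Proof.
have := @sum_ge_partial R _ 0 (fun n => (andP (Phi_term_bounds n y)).1) (@Phi_summable y).
by rewrite {1}/series /= big_geq.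
Qed.

(* On these indices [n^-t |y| <= 1], so each term is at least [n^-s y^2 / 8]. *)
Lemma Phi_block N y : (0 < N)%N -> `|y| <= N%:R `^ t ->
  N%:R * (2 * N%:R) `^ (- s) * (y ^+ 2 / 8) <= Phi y.
Proof.
move=> N0 yN; have h0 n := (andP (Phi_term_bounds n y)).1.
apply: le_trans (@sum_ge_partial R _ (N + N)%N h0 (@Phi_summable y)).
rewrite /series /= (big_cat_nat (leq0n N) (leq_addr N N)) /=.
apply: le_trans (_ : _ <= \sum_(N <= i < N + N) (2 * N%:R) `^ (- s) * (y ^+ 2 / 8)) _.
  by rewrite sumr_const_nat addnK -[leRHS]mulr_natl -[leLHS]mulrA lexx.
rewrite -[leLHS]add0r; apply: lerD; first exact: sumr_ge0.
apply: ler_sum_nat => n /andP[Nn nN].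
have n0 : 0 < n.+1%:R :> R by [].
have Nn1 : N%:R <= n.+1%:R :> R by rewrite ler_nat leqW.
have ly : `|l n * y| <= 1.
  rewrite normrM (gtr0_norm (l_gt0 n)) /l powRN mulrC ler_pdivrMr ?powR_gt0// mul1r.
  by apply: le_trans yN _; apply: ge0_ler_powR => //; rewrite ?nnegrE// ltW.
apply: le_trans (_ : a n * (y ^+ 2 / 8) <= _).
  rewrite ler_wpM2r ?divr_ge0 ?sqr_ge0// /a !powRN lef_pV2 ?posrE ?powR_gt0// ?mulr_gt0 ?ltr0n//.
  apply: ge0_ler_powR; rewrite ?nnegrE ?mulr_ge0//; first exact: ltW (lt_trans ltr01 hs).
  by rewrite -natrM ler_nat mul2n -addnn.
apply: le_trans (ler_wpM2l (ltW (al2_gt0 n)) (one_sub_cos_ge ly)).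
rewrite [leRHS](_ : _ = a n / l n ^+ 2 * l n ^+ 2 * (y ^+ 2 / 8)); last by ring.
by rewrite al2.
Qed.

(* On the range [(N-1)^t <= |y| <= N^t] the block of indices between [N] and [2N]
   already contributes a multiple of [N^delta]. *)
Lemma Phi_growth : exists2 c, 0 < c & forall y, exists2 x : R, 1 <= x &
  1 + `|y| <= 2 * x `^ t /\ c * x `^ delta - c <= Phi y.
Proof.
(* The factors come from [(2 N)^(-s)], from [(N / 2)^(2t)], and from the 8 of [one_sub_cos_ge]. *)
pose c := 2 `^ (- s) * (2 `^ (- (2 * t)) / 8) : R.
have c0 : 0 < c by rewrite !mulr_gt0 ?powR_gt0.
exists c => // y; pose N := (Num.truncn (`|y| `^ (t^-1))).+1.
have N1 : 1 <= N%:R :> R by rewrite ler1n.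
have yN : `|y| <= N%:R `^ t.
  have -> : `|y| = (`|y| `^ (t^-1)) `^ t by rewrite -powRrM mulVf ?gt_eqF// powRr1.
  by apply: ge0_ler_powR; rewrite ?nnegrE ?powR_ge0 ?(ltW ht)// ltW// truncnS_gt.
exists N%:R => //; split.
  have := @ler_powR R N%:R N1 0 t (ltW ht); rewrite powRr0.
  lra.
(* For [N = 1] the subtracted [c] reduces the claim to [Phi y >= 0]. For [N >= 2] one has
   [N - 1 >= N / 2], which gives the lower bound on [|y|]. *)
have [N_ge2|N_ge2] := ltnP N 2.
  have -> : N = 1%N by apply/eqP; rewrite eqn_leq -(ltnS N) N_ge2.
  by rewrite powR1 mulr1 subrr Phi_ge0.
apply: (@le_trans _ _ (c * N%:R `^ delta)); first by rewrite gerBl ltW.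
apply: le_trans (@Phi_block N y _ yN) => //.
have half : (N%:R / 2) `^ t <= `|y|.
  have -> : `|y| = (`|y| `^ (t^-1)) `^ t by rewrite -powRrM mulVf ?gt_eqF// powRr1.
  apply: ge0_ler_powR; rewrite ?nnegrE ?powR_ge0 ?(ltW ht)// ?divr_ge0//.
  have : (Num.truncn (`|y| `^ t^-1))%:R <= `|y| `^ t^-1 by rewrite truncn_le// powR_ge0.
  apply: le_trans; rewrite /N -addn1 natrD ler_pdivrMr// mulr_natr mulr2n lerD2l.
  by rewrite ler1n.
have sq : (N%:R / 2) `^ (2 * t) <= y ^+ 2.
  rewrite [2 * t]mulrC powRrM powR_mulrn ?powR_ge0// -(real_normK (num_real y)).
  by rewrite lerXn2r ?nnegrE ?powR_ge0.
apply: (@le_trans _ _ (N%:R * (2 * N%:R) `^ (- s) * ((N%:R / 2) `^ (2 * t) / 8))); last first.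
  by rewrite ler_wpM2l ?mulr_ge0 ?powR_ge0// ler_wpM2r.
rewrite !powRM ?invr_ge0// -(powR_inv1 (ler0n _ 2)) -powRrM mulN1r.
have -> : N%:R `^ delta = N%:R * N%:R `^ (- s) * N%:R `^ (2 * t).
  rewrite -{2}[N%:R]powRr1// -!powRD ?(gt_eqF (lt_le_trans ltr01 N1)) ?implybT//.
  by congr (_ `^ _); rewrite /delta; ring.
by rewrite /c le_eqVlt; apply/orP; left; apply/eqP; ring.
Qed.

Lemma Phi_decay k : exists2 C, 0 < C & forall y, (1 + `|y|) ^+ k <= C * expR (Phi y).
Proof.
have [c c0 Hc] := Phi_growth.
(* This [j] satisfies [t * k <= delta * j], so [x^(t k)] is at most the [j]-th power of [x^delta],
   which [pow_le_expR] absorbs. The factor [expR c] in the constant undoes the [- c] of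
   [Phi_growth]. *)
pose j := (Num.truncn (t * k%:R / delta)).+1.
have cj : 0 < c ^+ j by rewrite exprn_gt0.
exists (2 ^+ k * (c ^- j * (j%:R ^+ j * expR c))).
  by rewrite !mulr_gt0 ?invr_gt0 ?exprn_gt0 ?expR_gt0.
move=> y; have [x x1 [xy gr]] := Hc y.
have y0 : 0 <= 1 + `|y| by rewrite addr_ge0.
apply: le_trans (lerXn2r k _ _ xy) _; rewrite ?nnegrE ?mulr_ge0 ?powR_ge0//.
rewrite exprMn -!mulrA ler_wpM2l ?exprn_ge0//.
have h1 : (x `^ t) ^+ k <= (x `^ delta) ^+ j.
  rewrite -(powR_mulrn k (powR_ge0 x t)) -(powR_mulrn j (powR_ge0 x delta)) -!powRrM.
  apply: ler_powR => //.
  by rewrite [leRHS]mulrC -ler_pdivrMr//; apply/ltW; exact: truncnS_gt.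
apply: le_trans h1 _.
have : (c * x `^ delta) ^+ j <= j%:R ^+ j * expR (c * x `^ delta).
  by apply: pow_le_expR; rewrite mulr_ge0 ?powR_ge0// ltW.
rewrite exprMn mulrC -ler_pdivlMr// => /le_trans; apply.
rewrite mulrC ler_wpM2l ?invr_ge0 ?(ltW cj)// ler_wpM2l ?exprn_ge0//.
by rewrite -expRD ler_expR; lra.
Qed.
End CosinePotential.

(** * Complex-valued square integrable functions *)

Section ComplexFunctions.
Variable R : realType.
Local Notation plane := (R * R)%type.
Local Notation area := ((@lebesgue_measure R \x @lebesgue_measure R)%E).
Local Notation integrable f := (area.-integrable setT (EFin \o f)).
Local Notation I f := (Rintegral area setT f).
Local Notation Re := (@complex.Re R).
Local Notation Im := (@complex.Im R).
Implicit Types (u v w : plane -> R[i]) (z : R[i]).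

Lemma complex_ext (z z' : R[i]) : Re z = Re z' -> Im z = Im z' -> z = z'.
Proof. by case: z z' => [a b] [c d] /= -> ->. Qed.

Lemma ReIm_D z z' : (Re (z + z') = Re z + Re z') * (Im (z + z') = Im z + Im z').
Proof. by case: z z' => [a b] [c d]. Qed.
Lemma ReIm_N z : (Re (- z) = - Re z) * (Im (- z) = - Im z).
Proof. by case: z. Qed.
Lemma ReIm_M z z' : (Re (z * z') = Re z * Re z' - Im z * Im z') *
  (Im (z * z') = Re z * Im z' + Im z * Re z').
Proof. by case: z z' => [a b] [c d]; split => //=; rewrite [b * c]mulrC addrC. Qed.
Lemma ReIm_conj z : (Re (conjc z) = Re z) * (Im (conjc z) = - Im z).
Proof. by case: z. Qed.
Lemma ReIm_real (a : R) : (Re a%:C = a) * (Im a%:C = 0). Proof. by []. Qed.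
Lemma ReIm_i : (Re 'i%C = (0 : R)) * (Im 'i%C = (1 : R)). Proof. by []. Qed.
Lemma ReIm_0 : (Re 0 = 0) * (Im 0 = 0). Proof. by []. Qed.
Lemma ReIm_1 : (Re 1 = 1) * (Im 1 = 0). Proof. by []. Qed.
(** Rewriting with these rules turns a complex identity into two real polynomial identities. *)
Definition ReImE := (ReIm_i, ReIm_D, ReIm_N, ReIm_M, ReIm_conj, ReIm_real, ReIm_0, ReIm_1).

Lemma sqmod_ge0 z : 0 <= sqmod z.
Proof. by rewrite addr_ge0 ?sqr_ge0. Qed.

Lemma sqmodM z z' : sqmod (z * z') = sqmod z * sqmod z'.
Proof. by rewrite /sqmod !ReImE; ring. Qed.

Lemma sqmodD_le z z' : sqmod (z + z') <= 2 * sqmod z + 2 * sqmod z'.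
Proof.
rewrite /sqmod !ReImE; have := sqr_ge0 (Re z - Re z'); have := sqr_ge0 (Im z - Im z'); nra.
Qed.

Lemma sqmodN z : sqmod (- z) = sqmod z.
Proof. by rewrite /sqmod !ReImE !sqrrN. Qed.

Lemma sqmodB_le z z' : sqmod (z - z') <= 2 * sqmod z + 2 * sqmod z'.
Proof. by rewrite -[in leRHS](sqmodN z') sqmodD_le. Qed.

Lemma sqmod_real (a : R) : sqmod a%:C = a ^+ 2.
Proof. by rewrite /sqmod !ReImE; ring. Qed.

Lemma sqmod_i : sqmod 'i%C = 1 :> R.
Proof. by rewrite /sqmod !ReImE; ring. Qed.

Lemma Re_sqr_le z : Re z ^+ 2 <= sqmod z. Proof. by rewrite /sqmod lerDl sqr_ge0. Qed.
Lemma Im_sqr_le z : Im z ^+ 2 <= sqmod z. Proof. by rewrite /sqmod lerDr sqr_ge0. Qed.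

Definition ccont u := continuous (rePart u) /\ continuous (imPart u).

Lemma ccontD u v : ccont u -> ccont v -> ccont (fun x => u x + v x).
Proof.
move=> [u1 u2] [v1 v2]; split=> x; rewrite /rePart /imPart.
  under eq_fun do rewrite ReImE. by apply: cvgD; [exact: u1|exact: v1].
under eq_fun do rewrite ReImE. by apply: cvgD; [exact: u2|exact: v2].
Qed.

Lemma ccontN u : ccont u -> ccont (fun x => - u x).
Proof.
move=> [u1 u2]; split=> x; rewrite /rePart /imPart.
  under eq_fun do rewrite ReImE. by apply: cvgN; exact: u1.
under eq_fun do rewrite ReImE. by apply: cvgN; exact: u2.
Qed.

Lemma ccontM u v : ccont u -> ccont v -> ccont (fun x => u x * v x).
Proof.
move=> [u1 u2] [v1 v2]; split=> x; rewrite /rePart /imPart.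
  under eq_fun do rewrite ReImE.
  by apply: cvgB; apply: cvgM; [exact: u1|exact: v1|exact: u2|exact: v2].
under eq_fun do rewrite ReImE.
by apply: cvgD; apply: cvgM; [exact: u1|exact: v2|exact: u2|exact: v1].
Qed.

Lemma ccont_conj u : ccont u -> ccont (fun x => conjc (u x)).
Proof.
move=> [u1 u2]; split=> x; rewrite /rePart /imPart.
  under eq_fun do rewrite ReImE. exact: u1.
under eq_fun do rewrite ReImE. by apply: cvgN; exact: u2.
Qed.

Lemma ccont_cst z : ccont (fun=> z).
Proof. by split=> x; exact: cvg_cst. Qed.

Lemma ccont_real (f : plane -> R) : continuous f -> ccont (fun x => (f x)%:C).
Proof. by move=> cf; split=> x; [exact: cf|exact: cvg_cst]. Qed.

Lemma sqmod_continuous u : ccont u -> continuous (fun x => sqmod (u x)).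
Proof.
move=> [u1 u2] x; rewrite /sqmod; under eq_fun do rewrite !expr2.
by apply: cvgD; apply: cvgM; [exact: u1|exact: u1|exact: u2|exact: u2].
Qed.

Definition cderiv (d : plane) u (x : plane) z :=
  is_derive x d (rePart u) (Re z) /\ is_derive x d (imPart u) (Im z).

Lemma cderiv_cpartial d u x z : cderiv d u x z -> cpartial d u x = z.
Proof. by move=> [[_ h1] [_ h2]]; apply: complex_ext => /=. Qed.

Lemma cderivD d u v x z z' : cderiv d u x z -> cderiv d v x z' ->
  cderiv d (fun x => u x + v x) x (z + z').
Proof.
move=> [u1 u2] [v1 v2]; split; rewrite ReImE.
  rewrite (_ : rePart _ = rePart u \+ rePart v); first exact: is_deriveD.
  by apply/funext => y; rewrite /rePart /= ReImE.
rewrite (_ : imPart _ = imPart u \+ imPart v); first exact: is_deriveD.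
by apply/funext => y; rewrite /imPart /= ReImE.
Qed.

Lemma cderivM d u v x z z' : cderiv d u x z -> cderiv d v x z' ->
  cderiv d (fun x => u x * v x) x (u x * z' + z * v x).
Proof.
move=> [u1 u2] [v1 v2]; split.
  rewrite (_ : rePart _ = (rePart u \* rePart v) \- (imPart u \* imPart v)); last first.
    by apply/funext => y; rewrite /rePart /imPart /= ReImE.
  rewrite (_ : Re _ = (rePart u x *: Re z' + rePart v x *: Re z) -
    (imPart u x *: Im z' + imPart v x *: Im z)).
    exact: (is_deriveB (is_deriveM u1 v1) (is_deriveM u2 v2)).
  by rewrite /GRing.scale /= !ReImE /rePart /imPart; ring.
rewrite (_ : imPart _ = (rePart u \* imPart v) \+ (imPart u \* rePart v)); last first.
  by apply/funext => y; rewrite /rePart /imPart /= ReImE.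
rewrite (_ : Im _ = (rePart u x *: Im z' + imPart v x *: Re z) +
  (imPart u x *: Re z' + rePart v x *: Im z)).
  exact: (is_deriveD (is_deriveM u1 v2) (is_deriveM u2 v1)).
by rewrite /GRing.scale /= !ReImE /rePart /imPart; ring.
Qed.

Lemma cderiv_conj d u x z : cderiv d u x z -> cderiv d (fun x => conjc (u x)) x (conjc z).
Proof.
move=> [u1 u2]; split; rewrite ReImE.
  by rewrite (_ : rePart _ = rePart u)//; apply/funext => y; rewrite /rePart /= ReImE.
rewrite (_ : imPart _ = \- imPart u); first exact: is_deriveN.
by apply/funext => y; rewrite /imPart /= ReImE.
Qed.

Lemma cderiv_cst d z x : cderiv d (fun=> z) x 0.
Proof. by split; exact: is_derive_cst. Qed.

Lemma cderiv_real d (f : plane -> R) x (df : R) : is_derive x d f df ->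
  cderiv d (fun x => (f x)%:C) x df%:C.
Proof. by move=> H; split => //; exact: is_derive_cst. Qed.

Lemma L2P u : L2 u <-> [/\ measurable_fun setT (rePart u), measurable_fun setT (imPart u) &
  integrable (fun x => sqmod (u x))].
Proof.
rewrite /L2 !Lfun2P; split=> [[[m1 i1] [m2 i2]]|[m1 m2 i]].
  by split=> //; exact: (integrable_add i1 i2).
have sq (f : plane -> R) : measurable_fun setT f -> (forall x, f x ^+ 2 <= sqmod (u x)) ->
    integrable (fun x => f x ^+ 2).
  move=> mf fu; apply: bounded_integrable i => [|x]; first exact: measurable_funX.
  by rewrite ger0_norm ?sqr_ge0.
by split; split=> //; apply: sq => // x; [exact: Re_sqr_le|exact: Im_sqr_le].
Qed.

Lemma L2_weight u C : ccont u -> (forall x, sqmod (u x) <= C * weight x) -> L2 u.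
Proof.
move=> cu uC; apply/L2P; split; [exact: continuous_measurable_plane cu.1|
  exact: continuous_measurable_plane cu.2|].
apply: (weight_bounded_integrable (C := C)) => [|x].
  by apply: continuous_measurable_plane; exact: sqmod_continuous.
by rewrite ger0_norm ?sqmod_ge0.
Qed.

Lemma cmeasurable_mul u v : L2 u -> L2 v ->
  measurable_fun setT (rePart (fun x => u x * conjc (v x))) /\
  measurable_fun setT (imPart (fun x => u x * conjc (v x))).
Proof.
move=> /L2P[u1 u2 _] /L2P[v1 v2 _]; split.
  rewrite (_ : rePart _ = (rePart u \* rePart v) \+ (imPart u \* imPart v)).
    by apply: measurable_funD; apply: measurable_funM.
  by apply/funext => y; rewrite /rePart /imPart /= !ReImE; ring.
rewrite (_ : imPart _ = (imPart u \* rePart v) \- (rePart u \* imPart v)).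
  by apply: measurable_funB; apply: measurable_funM.
by apply/funext => y; rewrite /rePart /imPart /= !ReImE; ring.
Qed.

Lemma L2D u v : L2 u -> L2 v -> L2 (fun x => u x + v x).
Proof.
move=> /L2P[u1 u2 u3] /L2P[v1 v2 v3].
have m1 : measurable_fun setT (rePart (fun x => u x + v x)).
  rewrite (_ : rePart _ = rePart u \+ rePart v); first exact: measurable_funD.
  by apply/funext => y; rewrite /rePart /= ReImE.
have m2 : measurable_fun setT (imPart (fun x => u x + v x)).
  rewrite (_ : imPart _ = imPart u \+ imPart v); first exact: measurable_funD.
  by apply/funext => y; rewrite /imPart /= ReImE.
apply/L2P; split=> //.
apply: (bounded_integrable (g := fun x => 2 * sqmod (u x) + 2 * sqmod (v x))).
- by apply: measurable_funD; apply: measurable_funX.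
- by move=> x; rewrite ger0_norm ?sqmod_ge0// sqmodD_le.
- by apply: integrable_add; apply: integrable_scale.
Qed.

Lemma L2M z u : L2 u -> L2 (fun x => z * u x).
Proof.
move=> /L2P[u1 u2 u3]; apply/L2P; split.
- rewrite (_ : rePart _ = (cst (Re z) \* rePart u) \- (cst (Im z) \* imPart u)).
    by apply: measurable_funB; apply: measurable_funM => //; exact: measurable_cst.
  by apply/funext => y; rewrite /rePart /imPart /= ReImE.
- rewrite (_ : imPart _ = (cst (Re z) \* imPart u) \+ (cst (Im z) \* rePart u)).
    by apply: measurable_funD; apply: measurable_funM => //; exact: measurable_cst.
  by apply/funext => y; rewrite /rePart /imPart /= ReImE.
- by under eq_fun do rewrite sqmodM; exact: integrable_scale.
Qed.

Lemma L2B u v : L2 u -> L2 v -> L2 (fun x => u x - v x).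
Proof.
move=> Lu Lv; have := L2D Lu (L2M (-1) Lv).
by under eq_fun do rewrite mulN1r.
Qed.

Definition sqnorm u : R := I (fun x => sqmod (u x)).

Lemma sqnorm_ge0 u : 0 <= sqnorm u.
Proof. by apply: Rintegral_ge0 => x _; exact: sqmod_ge0. Qed.

Lemma sqnormM z u : L2 u -> sqnorm (fun x => z * u x) = sqmod z * sqnorm u.
Proof.
move=> /L2P[_ _ i]; rewrite /sqnorm; under [LHS]eq_Rintegral do rewrite sqmodM.
by rewrite RintegralZl.
Qed.

Lemma sqnormD_le u v : L2 u -> L2 v -> sqnorm (fun x => u x + v x) <= 2 * sqnorm u + 2 * sqnorm v.
Proof.
move=> Lu Lv; have /L2P[_ _ i] := L2D Lu Lv.
move: Lu Lv => /L2P[_ _ iu] /L2P[_ _ iv].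
rewrite /sqnorm -!RintegralZl// -RintegralD//; [|exact: integrable_scale..].
apply: le_Rintegral => //; first by apply: integrable_add; exact: integrable_scale.
by move=> x _; exact: sqmodD_le.
Qed.

Lemma sqnormB_le u v : L2 u -> L2 v -> sqnorm (fun x => u x - v x) <= 2 * sqnorm u + 2 * sqnorm v.
Proof.
move=> Lu Lv; have -> : sqnorm v = sqnorm (fun x => - v x).
  by apply: eq_Rintegral => x _; rewrite sqmodN.
apply: sqnormD_le => //; have := L2M (-1) Lv; by under eq_fun do rewrite mulN1r.
Qed.

Lemma inner_integrable u v : L2 u -> L2 v ->
  integrable (rePart (fun x => u x * conjc (v x))) /\ integrable (imPart (fun x => u x * conjc (v x))).
Proof.
move=> Lu Lv; have [m1 m2] := cmeasurable_mul Lu Lv.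
move: Lu Lv => /L2P[_ _ iu] /L2P[_ _ iv].
have i := integrable_add iu iv.
split; apply: bounded_integrable i => // x; rewrite /rePart /imPart !ReImE /sqmod ler_norml.
  have := sqr_ge0 (Re (u x) - Re (v x)); have := sqr_ge0 (Im (u x) - Im (v x)).
  have := sqr_ge0 (Re (u x) + Re (v x)); have := sqr_ge0 (Im (u x) + Im (v x)).
  by move=> *; apply/andP; split; nra.
have := sqr_ge0 (Re (u x) - Im (v x)); have := sqr_ge0 (Im (u x) - Re (v x)).
have := sqr_ge0 (Re (u x) + Im (v x)); have := sqr_ge0 (Im (u x) + Re (v x)).
by move=> *; apply/andP; split; nra.
Qed.

Definition cintegrable u := integrable (rePart u) /\ integrable (imPart u).

Lemma cintegralD u v : cintegrable u -> cintegrable v ->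
  cintegral (fun x => u x + v x) = cintegral u + cintegral v.
Proof.
move=> [u1 u2] [v1 v2]; apply: complex_ext; rewrite !ReImE /= -RintegralD//;
  by apply: eq_Rintegral => x _; rewrite /rePart /imPart ReImE.
Qed.

Lemma cintegralM z u : cintegrable u -> cintegral (fun x => z * u x) = z * cintegral u.
Proof.
move=> [u1 u2]; apply: complex_ext; rewrite !ReImE /= -!RintegralZl//.
  rewrite -RintegralB//; [|exact: integrable_scale..].
  by apply: eq_Rintegral => x _; rewrite /rePart /imPart ReImE.
rewrite -RintegralD//; [|exact: integrable_scale..].
by apply: eq_Rintegral => x _; rewrite /rePart /imPart ReImE.
Qed.

Lemma innerD_l u v w : L2 u -> L2 v -> L2 w ->
  inner (fun x => u x + v x) w = inner u w + inner v w.
Proof.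
move=> Lu Lv Lw; rewrite /inner -cintegralD; [|exact: inner_integrable..].
by congr cintegral; apply/funext => x; rewrite mulrDl.
Qed.

Lemma innerD_r u v w : L2 u -> L2 v -> L2 w ->
  inner u (fun x => v x + w x) = inner u v + inner u w.
Proof.
move=> Lu Lv Lw; rewrite /inner -cintegralD; [|exact: inner_integrable..].
by congr cintegral; apply/funext => x; rewrite -mulrDr; congr (_ * _); apply: complex_ext;
  rewrite !ReImE// opprD.
Qed.

Lemma innerM_l z u v : L2 u -> L2 v -> inner (fun x => z * u x) v = z * inner u v.
Proof.
move=> Lu Lv; rewrite /inner -cintegralM; last exact: inner_integrable.
by congr cintegral; apply/funext => x; rewrite mulrA.
Qed.

Lemma quadratic_discriminant (a b c : R) : 0 <= a -> (forall r : R, 0 <= r ^+ 2 * a - 2 * r * b + c) ->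
  b ^+ 2 <= a * c.
Proof.
rewrite le_eqVlt => /orP[/eqP <-|a0] H.
  rewrite mul0r; have [->|b0] := eqVneq b 0; first by rewrite expr0n.
  (* For [a = 0] the expression is affine in [r], and at this [r] it equals -1. *)
  have := H ((c + 1) / (2 * b)); rewrite mulr0 add0r.
  have -> : 2 * ((c + 1) / (2 * b)) * b = c + 1 by field.
  lra.
have := H (b / a).
have -> : (b / a) ^+ 2 * a - 2 * (b / a) * b + c = c - b ^+ 2 / a by field; rewrite gt_eqF.
by rewrite subr_ge0 ler_pdivrMr// mulrC.
Qed.

Lemma Re_inner_sqr u v : L2 u -> L2 v -> Re (inner u v) ^+ 2 <= sqnorm u * sqnorm v.
Proof.
move=> Lu Lv; apply: quadratic_discriminant => [|r]; first exact: sqnorm_ge0.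
have [i1 _] := inner_integrable Lu Lv.
have Lru := L2M r%:C Lu.
suff -> : r ^+ 2 * sqnorm u - 2 * r * Re (inner u v) + sqnorm v = sqnorm (fun x => r%:C * u x - v x) by exact: sqnorm_ge0.
move: Lu Lv => /L2P[_ _ iu] /L2P[_ _ iv].
rewrite /sqnorm /inner /= -!RintegralZl// -RintegralB//; [|exact: integrable_scale..].
rewrite -RintegralD//; last by apply: integrable_sub; exact: integrable_scale.
by apply: eq_Rintegral => x _; rewrite /rePart /sqmod !ReImE; ring.
Qed.

(** The real-part inequality is applied to [u] and to [i u]. Adding the two costs a factor 2 but
    avoids rotating by the phase of the inner product. *)
Lemma inner_cauchy_schwarz u v : L2 u -> L2 v -> sqmod (inner u v) <= 2 * (sqnorm u * sqnorm v).
Proof.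
move=> Lu Lv; have Liu := L2M 'i%C Lu.
have := Re_inner_sqr Liu Lv; rewrite sqnormM// sqmod_i mul1r innerM_l// !ReImE => h.
have := Re_inner_sqr Lu Lv; rewrite /sqmod; move: h; nra.
Qed.
End ComplexFunctions.

(** * The magnetic form *)

Section ZeroModes.
Variable R : realType.
Local Notation plane := (R * R)%type.
Implicit Types (f : plane -> R) (u v w psi : plane -> R[i]).

Lemma vanishing_slice (g : R -> R) (s d : R) : is_derive s (1 : R) g d ->
  (\forall r \near s, g r = 0) -> d = 0.
Proof.
move=> [_ <-] H; have : is_derive s (1 : R) g 0; last by case.
by apply: (near_eq_is_derive _ (is_derive_cst (0 : R) s (1 : R))); near=> r; near: r; apply: filterS H.
Unshelve. all: by end_near. Qed.

Lemma near_norm_gt (M s : R) : M < `|s| -> \forall r \near s, M < `|r|.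
Proof.
move=> Ms; apply/nbhs_ballP; exists (`|s| - M) => /=; first by rewrite subr_gt0.
move=> r; rewrite /ball /= => h; have := ler_normD (s - r) r; rewrite subrK; lra.
Qed.

(** The complement of the box is open, so the slice through [x] in either direction vanishes near
    [x]. *)
Lemma vanishing_derive f M x d : vanishes_outside M f -> ~ box M x ->
  is_derive x (@e1 R) f d \/ is_derive x (@e2 R) f d -> d = 0.
Proof.
move=> vf nb H.
have out : M < `|x.1| \/ M < `|x.2|.
  have [x1|] := leP `|x.1| M; last by left.
  by have [x2|] := leP `|x.2| M; [case: nb; apply/boxP|right].
have vz (y : plane) : M < `|y.1| \/ M < `|y.2| -> f y = 0.
  move=> h; apply: vf => /boxP[h1 h2]; move: h; rewrite !ltNge h1 h2.
  by case.
case: H => [/is_derive_e1 H|/is_derive_e2 H]; apply: (vanishing_slice H).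
  case: out => [/near_norm_gt o1|o2]; last by near=> r; apply: vz; right.
  by apply: filterS o1 => r hr; apply: vz; left.
case: out => [h1|/near_norm_gt o2]; first by near=> r; apply: vz; left.
by apply: filterS o2 => r hr; apply: vz; right.
Unshelve. all: by end_near. Qed.

Definition cvanishes (M : R) u := forall x, ~ box M x -> u x = 0.

Lemma cvanishesP M u : cvanishes M u -> vanishes_outside M (rePart u) /\ vanishes_outside M (imPart u).
Proof. by move=> h; split=> x /h; rewrite /rePart /imPart => ->. Qed.

(** The partials are explicit data, so that magnetic gradients become algebraic expressions, see
    [mgradE]. *)
Definition C1 u (d1 d2 : plane -> R[i]) := [/\ ccont u, ccont d1, ccont d2,
  forall x, cderiv (@e1 R) u x (d1 x) & forall x, cderiv (@e2 R) u x (d2 x)].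

Lemma C1_cvanishes M u d1 d2 : C1 u d1 d2 -> cvanishes M u -> cvanishes M d1 /\ cvanishes M d2.
Proof.
move=> [_ _ _ H1 H2] /cvanishesP[v1 v2]; split=> x nb; apply: complex_ext => /=.
- by apply: (vanishing_derive v1 nb); left; case: (H1 x).
- by apply: (vanishing_derive v2 nb); left; case: (H1 x).
- by apply: (vanishing_derive v1 nb); right; case: (H2 x).
- by apply: (vanishing_derive v2 nb); right; case: (H2 x).
Qed.

Lemma test_function_C1 psi : test_function psi -> exists M p1 p2,
  [/\ 0 <= M, C1 psi p1 p2 & cvanishes M psi].
Proof.
move=> [sm cpt].
have [r1 [r2 [cr R1 R2 cr1 cr2]]] := CkS_inv (sm 1%N).1.
have [i1 [i2 [ci I1 I2 ci1 ci2]]] := CkS_inv (sm 1%N).2.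
have [M0 [_ HM]] := compact_bounded cpt.
exists (`|M0| + 1), (fun x => r1 x +i* i1 x), (fun x => r2 x +i* i2 x).
split; [by rewrite addr_ge0|by []|].
move=> x nb; apply/eqP; apply: contra_notT nb => nz.
have := HM (`|M0| + 1) ltac:(by rewrite (le_lt_trans (ler_norm _))// ltrDl) x (@subset_closure _ [set x | psi x != 0] x nz).
by rewrite /= prod_normE ge_max => /andP[h1 h2]; apply/boxP.
Qed.

Lemma cvanishes_L2 M u : ccont u -> cvanishes M u -> L2 u.
Proof.
move=> cu vu; apply/L2P; split; [exact: continuous_measurable_plane cu.1|
  exact: continuous_measurable_plane cu.2|].
apply: (vanishing_integrable (M := M)); first exact: sqmod_continuous.
by move=> x /vu ->; rewrite /sqmod !ReImE; ring.
Qed.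

Lemma cintegrable_cvanishes M u : ccont u -> cvanishes M u -> cintegrable u.
Proof.
move=> [c1 c2] /cvanishesP[v1 v2].
by split; [exact: vanishing_integrable c1 v1|exact: vanishing_integrable c2 v2].
Qed.

Lemma cintegral_partial M u d1 d2 : 0 <= M -> C1 u d1 d2 -> cvanishes M u ->
  cintegral d1 = 0 /\ cintegral d2 = 0.
Proof.
move=> M0 Cu vu; have [/cvanishesP[a1 a2] /cvanishesP[b1 b2]] := C1_cvanishes Cu vu.
have [v1 v2] := cvanishesP vu.
case: Cu => _ [c11 c12] [c21 c22] H1 H2; split; apply: complex_ext => /=.
- exact: (integral_partial1 M0 c11 (fun x => (H1 x).1) v1 a1).
- exact: (integral_partial1 M0 c12 (fun x => (H1 x).2) v2 a2).
- exact: (integral_partial2 M0 c21 (fun x => (H2 x).1) v1 b1).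
- exact: (integral_partial2 M0 c22 (fun x => (H2 x).2) v2 b2).
Qed.

Variables (A : plane -> R * R).
Hypothesis cA1 : continuous (fun x => (A x).1).
Hypothesis cA2 : continuous (fun x => (A x).2).

Lemma mgradE psi p1 p2 : C1 psi p1 p2 ->
  (mgrad1 A psi = fun x => 'i%C * p1 x + (A x).1%:C * psi x) /\
  (mgrad2 A psi = fun x => 'i%C * p2 x + (A x).2%:C * psi x).
Proof.
move=> [_ _ _ H1 H2]; split; apply/funext => x.
  by rewrite /mgrad1 (cderiv_cpartial (H1 x)).
by rewrite /mgrad2 (cderiv_cpartial (H2 x)).
Qed.

Lemma mgrad_ccont psi p1 p2 : C1 psi p1 p2 -> ccont (mgrad1 A psi) /\ ccont (mgrad2 A psi).
Proof.
move=> Cp; have [-> ->] := mgradE Cp; case: Cp => c c1 c2 _ _.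
split; apply: ccontD; apply: ccontM => //; by [exact: ccont_cst|exact: ccont_real].
Qed.

Lemma mgrad_cvanishes M psi p1 p2 : C1 psi p1 p2 -> cvanishes M psi ->
  cvanishes M (mgrad1 A psi) /\ cvanishes M (mgrad2 A psi).
Proof.
move=> Cp vp; have [-> ->] := mgradE Cp; have [v1 v2] := C1_cvanishes Cp vp.
by split=> x nb; rewrite vp// ?v1// ?v2// !mulr0 addr0.
Qed.

Lemma test_L2 psi : test_function psi -> [/\ L2 psi, L2 (mgrad1 A psi) & L2 (mgrad2 A psi)].
Proof.
move=> /test_function_C1[M [p1 [p2 [M0 Cp vp]]]].
have [g1 g2] := mgrad_ccont Cp; have [v1 v2] := mgrad_cvanishes Cp vp.
split; [|exact: cvanishes_L2 g1 v1|exact: cvanishes_L2 g2 v2].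
by case: (Cp) => c *; exact: cvanishes_L2 c vp.
Qed.

Lemma C1B u u1 u2 v v1 v2 : C1 u u1 u2 -> C1 v v1 v2 ->
  C1 (fun x => u x - v x) (fun x => u1 x - v1 x) (fun x => u2 x - v2 x).
Proof.
have E (f g : plane -> R[i]) : (fun x => f x - g x) = (fun x => f x + (-1) * g x).
  by apply/funext => x; rewrite mulN1r.
have cB (f g : plane -> R[i]) : ccont f -> ccont g -> ccont (fun x => f x - g x).
  by move=> cf cg; rewrite E; apply: ccontD => //; apply: ccontM => //; exact: ccont_cst.
have dB d (f g : plane -> R[i]) x a b : cderiv d f x a -> cderiv d g x b ->
    cderiv d (fun x => f x - g x) x (a - b).
  move=> cf cg; rewrite E.
  have := cderivD cf (cderivM (cderiv_cst d (-1) x) cg).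
  by rewrite mul0r addr0 mulN1r.
move=> [a1 a2 a3 a4 a5] [b1 b2 b3 b4 b5].
by split; [exact: cB|exact: cB|exact: cB|move=> x; exact: dB|move=> x; exact: dB].
Qed.

Lemma mgradB u u1 u2 v v1 v2 : C1 u u1 u2 -> C1 v v1 v2 ->
  mgrad1 A (fun x => u x - v x) = (fun x => mgrad1 A u x - mgrad1 A v x) /\
  mgrad2 A (fun x => u x - v x) = (fun x => mgrad2 A u x - mgrad2 A v x).
Proof.
move=> Cu Cv; have [-> ->] := mgradE (C1B Cu Cv).
by have [-> ->] := mgradE Cu; have [-> ->] := mgradE Cv; split; apply/funext => x; ring.
Qed.

Lemma qformE psi : L2 (mgrad1 A psi) -> L2 (mgrad2 A psi) ->
  qform A psi = sqnorm (mgrad1 A psi) + sqnorm (mgrad2 A psi).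
Proof. move=> /L2P[_ _ i1] /L2P[_ _ i2]; exact: (RintegralD measurableT i1 i2). Qed.

Section Mode.
Variables (b : plane -> R) (u u1 u2 w w1 w2 : plane -> R[i]).
Hypothesis cb : continuous b.
Hypothesis Cu : C1 u u1 u2.
Hypothesis Cw : C1 w w1 w2.
Hypothesis Eu1 : forall x, 'i%C * u1 x + (A x).1%:C * u x = w x.
Hypothesis Eu2 : forall x, 'i%C * u2 x + (A x).2%:C * u x = 'i%C * w x.
Hypothesis Ew : forall x,
  'i%C * w1 x - w2 x + ((A x).1%:C + 'i%C * (A x).2%:C) * w x = (b x)%:C * u x.
Hypothesis Lw : L2 w.
Hypothesis Lbu : L2 (fun x => (b x)%:C * u x).

(* [w = P1 u] and [P2 u = i P1 u], so the form collapses to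
   [<w, (P1 - i P2) psi>] and one integration by parts suffices. *)
Lemma form_against_test psi : test_function psi ->
  inner w (mgrad1 A psi) + inner (fun x => 'i%C * w x) (mgrad2 A psi) =
  inner (fun x => (b x)%:C * u x) psi.
Proof.
move=> tp; have [Lp Lg1 Lg2] := test_L2 tp.
have [M [p1 [p2 [M0 Cp vp]]]] := test_function_C1 tp.
have Liw := L2M 'i%C Lw.
rewrite /inner -cintegralD; [|exact: inner_integrable..].
pose g x := w x * conjc (psi x).
pose g1 x := w x * conjc (p1 x) + w1 x * conjc (psi x).
pose g2 x := w x * conjc (p2 x) + w2 x * conjc (psi x).
have vg : cvanishes M g.
  by move=> x /vp; rewrite /g => ->; rewrite conjc0 mulr0.
have Cg : C1 g g1 g2.
  case: Cw Cp => [cw cw1 cw2 dw1 dw2] [cp cp1 cp2 dp1 dp2].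
  split; first by apply: ccontM => //; exact: ccont_conj.
  - by apply: ccontD; apply: ccontM => //; exact: ccont_conj.
  - by apply: ccontD; apply: ccontM => //; exact: ccont_conj.
  - by move=> x; apply: cderivM => //; exact: cderiv_conj.
  - by move=> x; apply: cderivM => //; exact: cderiv_conj.
have [vg1 vg2] := C1_cvanishes Cg vg.
have [z1 z2] := cintegral_partial M0 Cg vg.
have ig1 : cintegrable g1 by case: (Cg) => _ c1 _ _ _; exact: cintegrable_cvanishes c1 vg1.
have ig2 : cintegrable g2 by case: (Cg) => _ _ c2 _ _; exact: cintegrable_cvanishes c2 vg2.
have iig1 : cintegrable (fun x => - 'i%C * g1 x).
  case: (Cg) => _ c1 _ _ _; apply: (@cintegrable_cvanishes M).
    by apply: ccontM => //; exact: ccont_cst.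
  by move=> x /vg1 ->; rewrite mulr0.
(* This divergence term integrates to zero. Added to the right-hand side, it turns the claim into an
   identity between integrands, which follows from [Ew]. *)
have Z : cintegral (fun x => - 'i%C * g1 x + g2 x) = 0.
  by rewrite cintegralD// cintegralM// z1 z2 mulr0 addr0.
rewrite -[RHS]addr0 -[X in _ + X]Z -cintegralD.
- congr cintegral; apply/funext => x; have [-> ->] := mgradE Cp.
  rewrite /g1 /g2 -Ew; apply: complex_ext; rewrite !ReImE; by ring.
- exact: inner_integrable.
- by apply: (@cintegrable_cvanishes M); case: (Cg) => _ c1 c2 _ _;
    [apply: ccontD => //; apply: ccontM => //; exact: ccont_cst|
     move=> x nb; rewrite vg1// vg2// mulr0 addr0].
Qed.

End Mode.
End ZeroModes.

(** * Smooth approximants in the magnetic form norm *)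

Section Approximation.
Variable R : realType.
Local Notation plane := (R * R)%type.
Local Notation Re := (@complex.Re R).
Local Notation Im := (@complex.Im R).
Implicit Types (u v w psi : plane -> R[i]).

Lemma box_closed (M : R) : closed (box M).
Proof. by apply: compact_closed; [exact: norm_hausdorff|exact: box_compact]. Qed.

Lemma cvanishes_test M psi : (forall k, Ck k (rePart psi) /\ Ck k (imPart psi)) ->
  cvanishes M psi -> test_function psi.
Proof.
move=> sm vp; split=> //; apply: (subclosed_compact (@closed_closure _ _) (@box_compact R M)).
rewrite [X in _ `<=` X]((closure_id _).1 (@box_closed M)); apply: closure_subset.
by move=> x /= nz; apply: contrapT => /vp; apply/eqP.
Qed.

Lemma coordinates_le_weight (x : plane) : (`|x.1| + `|x.2|) ^+ 2 <= 2 / weight x.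
Proof.
have o0 (a : R) : oneDsqr a != 0 by rewrite gt_eqF// (lt_le_trans ltr01)// oneDsqr_ge1.
have -> : 2 / weight x = 2 * (oneDsqr x.1 * oneDsqr x.2).
  by rewrite /weight; field; rewrite !o0.
have := real_normK (num_real x.1); have := real_normK (num_real x.2).
rewrite /oneDsqr => <- <-; set a := `|x.1|; set c := `|x.2|.
have := sqr_ge0 (a - c); have := sqr_ge0 (a * c); nra.
Qed.

(** The squared deficit costs [2 / weight x], paid by one of the two factors [weight] in the
    hypothesis. Of the resulting [1 / m^2] only [1 / m] is kept. *)
Lemma cutoff_tail (u : plane -> R[i]) (C L m : R) x (e : R) : 1 <= m -> 0 <= L ->
  sqmod (u x) <= C * weight x ^+ 2 -> `|e| <= L / m * (`|x.1| + `|x.2|) ->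
  sqmod (e%:C * u x) <= 2 * L ^+ 2 * C / m * weight x.
Proof.
move=> m1 L0 uC he; have m0 : 0 < m by exact: lt_le_trans ltr01 m1.
have W0 := weight_gt0 x.
have CW0 : 0 <= C * weight x ^+ 2 by exact: le_trans (sqmod_ge0 _) uC.
rewrite sqmodM sqmod_real.
have e2 : e ^+ 2 <= (L / m) ^+ 2 * (2 / weight x).
  rewrite -(real_normK (num_real e)); apply: le_trans (_ : _ <= (L / m * (`|x.1| + `|x.2|)) ^+ 2) _.
    by rewrite lerXn2r ?nnegrE// mulr_ge0 ?divr_ge0 ?addr_ge0// ltW.
  by rewrite exprMn ler_wpM2l ?sqr_ge0// coordinates_le_weight.
apply: le_trans (ler_pM (sqr_ge0 _) (sqmod_ge0 _) e2 uC) _.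
have -> : (L / m) ^+ 2 * (2 / weight x) * (C * weight x ^+ 2) = 2 * L ^+ 2 * C / m * weight x / m.
  by field; rewrite !gt_eqF.
rewrite ler_pdivrMr// ler_peMr// mulr_ge0 ?(ltW W0)// divr_ge0 ?(ltW m0)//.
by rewrite mulr_ge0 ?mulr_ge0 ?sqr_ge0//; move: CW0; rewrite pmulr_lge0// exprn_gt0.
Qed.

(** The first line of the right side contains only approximation errors multiplied by [eta] or its
    derivative, hence confined to the square. The second contains only the target, with
    [i * w + a * v] kept whole because only this sum is assumed to decay. *)
Lemma gradient_splitting (K : comPzRingType) (i eta d a p q v w : K) :
  i * (eta * q + d * p) + a * (eta * p) - (i * w + a * v) =
  i * (d * (p - v)) + eta * (i * (q - w) + a * (p - v)) +
  (i * (d * v) - (1 - eta) * (i * w + a * v)).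
Proof. by ring. Qed.

Variables (A : plane -> R * R).
Hypothesis cA1 : continuous (fun x => (A x).1).
Hypothesis cA2 : continuous (fun x => (A x).2).
Variables (u u1 u2 : plane -> R[i]) (C : R).
Hypothesis Cu : C1 u u1 u2.
Let w1 x := 'i%C * u1 x + (A x).1%:C * u x.
Let w2 x := 'i%C * u2 x + (A x).2%:C * u x.
Hypothesis decay : forall x, [/\ sqmod (u x) <= C * weight x ^+ 2,
  sqmod (w1 x) <= C * weight x ^+ 2 & sqmod (w2 x) <= C * weight x ^+ 2].

Lemma complex_C1_approx (M e : R) : 0 < M -> 0 < e -> exists p p1 p2,
  [/\ forall k, Ck k (rePart p) /\ Ck k (imPart p), C1 p p1 p2 &
    forall x, box M x -> [/\ sqmod (p x - u x) <= 2 * e ^+ 2,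
      sqmod (p1 x - u1 x) <= 2 * e ^+ 2 & sqmod (p2 x - u2 x) <= 2 * e ^+ 2]].
Proof.
move=> M0 e0; case: Cu => [[cr ci] [cr1 ci1] [cr2 ci2] H1 H2].
have [p [p1 [p2 [Sp P1 P2 Hp]]]] := C1_approx M0 e0 cr cr1 cr2 (fun x => (H1 x).1) (fun x => (H2 x).1).
have [q [q1 [q2 [Sq Q1 Q2 Hq]]]] := C1_approx M0 e0 ci ci1 ci2 (fun x => (H1 x).2) (fun x => (H2 x).2).
exists (fun x => p x +i* q x), (fun x => p1 x +i* q1 x), (fun x => p2 x +i* q2 x).
split; first by move=> k; split; [exact: Sp|exact: Sq].
  have [a1 [a2 [ca A1 A2 ca1 ca2]]] := CkS_inv (Sp 1%N).
  have [b1 [b2 [cb B1 B2 cb1 cb2]]] := CkS_inv (Sq 1%N).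
  have Ep1 : p1 = a1 by apply/funext => x; case: (P1 x) (A1 x) => _ <- [_ <-].
  have Ep2 : p2 = a2 by apply/funext => x; case: (P2 x) (A2 x) => _ <- [_ <-].
  have Eq1 : q1 = b1 by apply/funext => x; case: (Q1 x) (B1 x) => _ <- [_ <-].
  have Eq2 : q2 = b2 by apply/funext => x; case: (Q2 x) (B2 x) => _ <- [_ <-].
  by split; [split|rewrite Ep1 Eq1|rewrite Ep2 Eq2|move=> x; split|move=> x; split].
have sq (z : R[i]) : `|Re z| <= e -> `|Im z| <= e -> sqmod z <= 2 * e ^+ 2.
  move=> z1 z2; rewrite /sqmod -(real_normK (num_real (Re z))) -(real_normK (num_real (Im z))).
  by rewrite mulr2n mulrDl mul1r; apply: lerD; rewrite lerXn2r ?nnegrE// ltW.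
move=> x bx; have [h0 h1 h2] := Hp x bx; have [k0 k1 k2] := Hq x bx.
by split; apply: sq; rewrite !ReImE.
Qed.

Lemma smooth_approx : exists2 D : R, 0 <= D & forall m : nat, exists2 phi, test_function phi &
  forall x, [/\ sqmod (phi x - u x) <= D / m.+1%:R * weight x,
    sqmod (mgrad1 A phi x - w1 x) <= D / m.+1%:R * weight x &
    sqmod (mgrad2 A phi x - w2 x) <= D / m.+1%:R * weight x].
Proof.
have ar1 (l k r g : R) : 0 <= r * l -> 0 <= r * (l * k) -> g <= l * (2 * r) ->
  2 * g <= r * (4 * (2 * l + l * (4 + 4 * k))) by lra.
have ar2 (a c p : R) : a <= p -> c <= 2 * p -> 2 * a + 2 * c <= 6 * p by lra.
have [L L0 HL] := cutoff_exists R.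
have C0 : 0 <= C.
  have [h _ _] := decay 0; have := le_trans (sqmod_ge0 _) h.
  by rewrite pmulr_lge0// exprn_gt0// weight_gt0.
pose LC := L ^+ 2 * C; have LC0 : 0 <= LC by rewrite mulr_ge0 ?sqr_ge0.
(* 1 covers the Bernstein error; 12 is twice the 6 of the tail bound, doubled by [sqmodD_le]. *)
exists (1 + 12 * LC); first by lra.
move=> m; pose M : R := m.+1%:R; have M1 : 1 <= M by rewrite ler1n.
have M0 : 0 < M by exact: lt_le_trans ltr01 M1.
have [eta [d1 [d2 [Seta veta [E1 E2] Heta]]]] := HL M M1.
have [c c0 Hc] := weight_box_lb M.
have [K1 K10 HK1] := box_bounded M cA1; have [K2 K20 HK2] := box_bounded M cA2.
pose K := K1 + K2; have K0 : 0 < K by rewrite addr_gt0.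
(* [X] collects the coefficients of [e ^+ 2] in the Bernstein part of the gradient error. Then [e]
   is chosen with [e ^+ 2 * X <= c / M], where [c] bounds [weight] from below on the square;
   [e <= 1] serves to get [e ^+ 2 <= e]. *)
pose X := 4 * (2 * L ^+ 2 + L ^+ 2 * (4 + 4 * K ^+ 2)).
have L20 : 0 < L ^+ 2 by rewrite exprn_gt0.
have K20' := sqr_ge0 K.
have LK0 : 0 <= L ^+ 2 * K ^+ 2 by rewrite mulr_ge0// ltW.
have X0 : 0 < X by rewrite /X; nra.
pose y := c / M / X; have y0 : 0 < y by rewrite !divr_gt0.
pose e := Num.min 1 y; have e0 : 0 < e by rewrite lt_min ltr01.
have e2X : e ^+ 2 * X <= c / M.
  have e1 : e <= 1 by rewrite ge_min lexx.
  have ey : e <= y by rewrite ge_min lexx orbT.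
  have : e ^+ 2 <= y by apply: le_trans ey; rewrite expr2 ler_piMr// ltW.
  by rewrite /y ler_pdivlMr.
have [p [p1 [p2 [Sp Cp Hp]]]] := complex_C1_approx M0 e0.
pose phi x := (eta x)%:C * p x.
pose f1 x := (eta x)%:C * p1 x + (d1 x)%:C * p x.
pose f2 x := (eta x)%:C * p2 x + (d2 x)%:C * p x.
have [a1 [a2 [ceta A1 A2 ca1 ca2]]] := CkS_inv (Seta 1%N).
have cd1 : continuous d1.
  by rewrite (_ : d1 = a1)//; apply/funext => x; case: (E1 x) (A1 x) => _ <- [_ <-].
have cd2 : continuous d2.
  by rewrite (_ : d2 = a2)//; apply/funext => x; case: (E2 x) (A2 x) => _ <- [_ <-].
have Cphi : C1 phi f1 f2.
  case: Cp => cp cp1 cp2 P1 P2; split.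
  - by apply: ccontM => //; exact: ccont_real.
  - by apply: ccontD; apply: ccontM => //; exact: ccont_real.
  - by apply: ccontD; apply: ccontM => //; exact: ccont_real.
  - by move=> x; apply: cderivM => //; exact: cderiv_real.
  - by move=> x; apply: cderivM => //; exact: cderiv_real.
have tphi : test_function phi.
  apply: (@cvanishes_test M) => [k|x nb]; last by rewrite /phi veta// mul0r.
  have [Sr Si] := Sp k; split.
    rewrite (_ : rePart phi = fun x => eta x * rePart p x); first exact: Ck_mul.
    by apply/funext => x; rewrite /rePart /phi !ReImE; ring.
  rewrite (_ : imPart phi = fun x => eta x * imPart p x); first exact: Ck_mul.
  by apply/funext => x; rewrite /imPart /phi !ReImE; ring.
exists phi => // x.
have W0 := weight_gt0 x; have [dec0 dec1 dec2] := decay x.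
have [eL d1L d2L tail] := Heta x.
have t0 := cutoff_tail M1 (ltW L0) dec0 tail.
have t1 := cutoff_tail M1 (ltW L0) dec1 tail.
have t2 := cutoff_tail M1 (ltW L0) dec2 tail.
have LMe : 2 * L ^+ 2 * C / M = 2 * (LC / M) by rewrite /LC; ring.
rewrite LMe in t0 t1 t2.
have LM0 : 0 <= LC / M by rewrite divr_ge0// ltW.
have LMW0 : 0 <= LC / M * weight x by rewrite mulr_ge0// ltW.
have sqL (a B : R) : `|a| <= B -> a ^+ 2 <= B ^+ 2.
  by move=> h; rewrite -(real_normK (num_real a)) lerXn2r ?nnegrE// (le_trans _ h).
have LM : L / M <= L by rewrite ler_pdivrMr// ler_peMr// ltW.
have LM2 : (L / M) ^+ 2 <= L ^+ 2 by rewrite lerXn2r ?nnegrE ?divr_ge0// ltW.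
have LM2' : (L / M) ^+ 2 * (C * weight x ^+ 2) <= LC / M * weight x.
  have -> : (L / M) ^+ 2 * (C * weight x ^+ 2) = LC / M * weight x * (weight x / M) by rewrite /LC; field; rewrite gt_eqF.
  rewrite ler_piMr// ler_pdivrMr// mul1r; apply: le_trans M1; exact: weight_le1.
(* [z] is the error confined to the square, as the conditional expresses, and [z'] is the tail. *)
have fin (z z' : R[i]) : 2 * sqmod z <= (if `[< box M x >] then e ^+ 2 * X else 0) ->
   sqmod z' <= 6 * (LC / M * weight x) -> sqmod (z + z') <= (1 + 12 * LC) / M * weight x.
  move=> hz hz'; apply: le_trans (sqmodD_le _ _) _.
  have -> : (1 + 12 * LC) / M * weight x = weight x / M + 2 * (6 * (LC / M * weight x)) by ring.
  apply: lerD; last by rewrite ler_wpM2l.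
  apply: le_trans hz _; case: asboolP => bx; last by rewrite divr_ge0 ?ltW.
  by apply: le_trans e2X _; rewrite ler_wpM2r ?invr_ge0 ?(ltW M0)//; exact: Hc.
have eta2 := sqL _ _ eL.
have e20 := sqr_ge0 e.
(* One estimate for both directions: [dj] is a partial of [eta], [aj] a component of [A], bounded by
   [K] on the square only. *)
have grad (dj aj : R) (pj uj : R[i]) : `|dj| <= L / M -> (~ box M x -> dj = 0) ->
    (box M x -> `|aj| <= K) -> (box M x -> sqmod (pj - uj) <= 2 * e ^+ 2) ->
    sqmod ((1 - eta x)%:C * ('i%C * uj + aj%:C * u x)) <= 2 * (LC / M) * weight x ->
    sqmod ('i%C * ((eta x)%:C * pj + dj%:C * p x) + aj%:C * phi x - ('i%C * uj + aj%:C * u x))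
      <= (1 + 12 * LC) / M * weight x.
  move=> hdj dj0 haj hpj ht.
  pose z := 'i%C * (dj%:C * (p x - u x)) + (eta x)%:C * ('i%C * (pj - uj) + aj%:C * (p x - u x)).
  pose z' := 'i%C * (dj%:C * u x) - (1 - eta x)%:C * ('i%C * uj + aj%:C * u x).
  rewrite (_ : _ - _ = z + z'); last first.
    by rewrite /z /z' /phi (rmorphB (real_complex R)) /=; exact: gradient_splitting.
  have dj2 : dj ^+ 2 <= (L / M) ^+ 2 by exact: sqL.
  apply: fin.
    have zE : sqmod z <= 2 * (dj ^+ 2 * sqmod (p x - u x)) +
        2 * (eta x ^+ 2 * (2 * sqmod (pj - uj) + 2 * (aj ^+ 2 * sqmod (p x - u x)))).
      apply: le_trans (sqmodD_le _ _) _; rewrite !sqmodM !sqmod_real sqmod_i mul1r lerD2l.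
      rewrite ler_wpM2l// ler_wpM2l ?sqr_ge0//; apply: le_trans (sqmodD_le _ _) _.
      by rewrite !sqmodM sqmod_real sqmod_i mul1r.
    apply: le_trans (ler_wpM2l (ler0n _ 2) zE) _; case: asboolP => bx; last first.
      by rewrite dj0// veta// expr0n !mul0r !mulr0 add0r mulr0.
    have [q0 _ _] := Hp x bx; have qj := hpj bx; have aK := sqL _ _ (haj bx).
    have s0 := sqmod_ge0 (p x - u x); have sj := sqmod_ge0 (pj - uj).
    have g1 : dj ^+ 2 * sqmod (p x - u x) <= L ^+ 2 * (2 * e ^+ 2).
      by apply: ler_pM; rewrite ?sqr_ge0// (le_trans dj2).
    have g2 : aj ^+ 2 * sqmod (p x - u x) <= K ^+ 2 * (2 * e ^+ 2) by apply: ler_pM; rewrite ?sqr_ge0.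
    have g3 : eta x ^+ 2 * (2 * sqmod (pj - uj) + 2 * (aj ^+ 2 * sqmod (p x - u x))) <=
        L ^+ 2 * (2 * (2 * e ^+ 2) + 2 * (K ^+ 2 * (2 * e ^+ 2))).
      apply: ler_pM; rewrite ?sqr_ge0//; first by rewrite addr_ge0 ?(mulr_ge0 (ler0n _ 2))// mulr_ge0 ?sqr_ge0.
      by apply: lerD; rewrite ler_wpM2l.
    apply: le_trans (ler_wpM2l (ler0n _ 2) (lerD (ler_wpM2l (ler0n _ 2) g1) (ler_wpM2l (ler0n _ 2) g3))) _.
    by rewrite /X le_eqVlt; apply/orP; left; apply/eqP; ring.
  apply: le_trans (sqmodB_le _ _) _; rewrite [sqmod ('i%C * _)]sqmodM sqmod_i mul1r sqmodM sqmod_real.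
  apply: ar2; last by rewrite mulrA.
  by apply: le_trans LM2'; apply: ler_pM => //; rewrite ?sqr_ge0 ?sqmod_ge0.
have [H1 H2] := mgradE A Cphi.
have d10 : ~ box M x -> d1 x = 0 by move=> nb; apply: (vanishing_derive veta nb); left.
have d20 : ~ box M x -> d2 x = 0 by move=> nb; apply: (vanishing_derive veta nb); right.
split.
- rewrite (_ : phi x - u x = (eta x)%:C * (p x - u x) + - ((1 - eta x)%:C * u x)); last first.
    by rewrite /phi; apply: complex_ext; rewrite !ReImE; ring.
  apply: fin; last by rewrite sqmodN; apply: le_trans t0 _; rewrite -[2 * (LC / M) * _]mulrA ler_wpM2r// ler_nat.
  rewrite sqmodM sqmod_real; case: asboolP => bx; last by rewrite veta// expr0n !mul0r mulr0.
  have [q0 _ _] := Hp x bx; have s0 := sqmod_ge0 (p x - u x).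
  have g1 : eta x ^+ 2 * sqmod (p x - u x) <= L ^+ 2 * (2 * e ^+ 2).
    by apply: ler_pM => //; rewrite sqr_ge0.
  exact: ar1 (mulr_ge0 e20 (ltW L20)) (mulr_ge0 e20 LK0) g1.
- rewrite H1; apply: grad => // bx; last by case: (Hp x bx).
  by rewrite (le_trans (HK1 x bx))// lerDl ltW.
- rewrite H2; apply: grad => // bx; last by case: (Hp x bx).
  by rewrite (le_trans (HK2 x bx))// lerDr ltW.
Qed.
End Approximation.

(** * From first-order equations to the graph of the magnetic operator *)

Section MagneticEigenfunction.
Variable R : realType.
Local Notation plane := (R * R)%type.
Local Notation area := ((@lebesgue_measure R \x @lebesgue_measure R)%E).
Local Notation I f := (Rintegral area setT f).
Implicit Types (u v w psi : plane -> R[i]).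

Lemma cvg0_harmonic_bound (f : nat -> R) (D : R) : (forall n, 0 <= f n <= D / n.+1%:R) ->
  f @ \oo --> (0 : R).
Proof.
move=> H; apply: (@squeeze_cvgr _ _ _ _ (cst 0) (fun n => D * n.+1%:R^-1)).
- by apply: nearW => n; exact: H.
- exact: cvg_cst.
- by rewrite -(mulr0 D); apply: cvgM; [exact: cvg_cst|exact: cvg_harmonic].
Qed.

Lemma sqnorm_weight_le u (D : R) : L2 u -> (forall x, sqmod (u x) <= D * weight x) ->
  sqnorm u <= D * I (@weight R).
Proof.
move=> /L2P[_ _ iu] H; rewrite /sqnorm -RintegralZl//; last exact: weight_integrable.
apply: le_Rintegral => //; exact: integrable_scale (@weight_integrable R).
Qed.

Lemma cauchy_arith (a c am1 am2 an1 an2 dm dn e : R) : a <= 2 * am1 + 2 * an1 ->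
  c <= 2 * am2 + 2 * an2 -> am1 <= dm -> am2 <= dm -> an1 <= dn -> an2 <= dn ->
  dm < e / 8 -> dn < e / 8 -> a + c < e.
Proof. lra. Qed.

Lemma bounded_arith (x d1 d2 y1 y2 : R) : x <= 2 * d1 + 2 * y1 -> 0 <= d2 -> 0 <= y2 ->
  d1 + d2 < 1 -> x <= 2 * (y1 + y2) + 2.
Proof. lra. Qed.

Lemma limit_arith (s s1 s2 s3 p1 p2 d q f bt : R) : s <= 2 * s1 + 2 * s2 -> s1 <= 2 * p1 ->
  s2 <= 2 * p2 -> s3 <= 2 * (f * bt) -> p1 <= d * q -> p2 <= d * q ->
  2 * s + 2 * s3 <= 16 * q * d + 4 * f * bt.
Proof. lra. Qed.

Lemma add_rearrange (V : zmodType) (a1 p1 a2 p2 fp fd fv : V) : p1 + p2 = fp -> fp = fd + fv ->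
  a1 + p1 + (a2 + p2) - fv = a1 + a2 + fd.
Proof. by move=> h1 h2; rewrite addrACA h1 h2 addrA addrK. Qed.

Variables (A : plane -> R * R).
Hypothesis cA1 : continuous (fun x => (A x).1).
Hypothesis cA2 : continuous (fun x => (A x).2).
Variables (b : plane -> R) (B C : R) (u u1 u2 w w1 w2 : plane -> R[i]).
Hypothesis cb : continuous b.
Hypothesis bB : forall x, `|b x| <= B.
Hypothesis Cu : C1 u u1 u2.
Hypothesis Cw : C1 w w1 w2.
Hypothesis Eu1 : forall x, 'i%C * u1 x + (A x).1%:C * u x = w x.
Hypothesis Eu2 : forall x, 'i%C * u2 x + (A x).2%:C * u x = 'i%C * w x.
Hypothesis Ew : forall x,
  'i%C * w1 x - w2 x + ((A x).1%:C + 'i%C * (A x).2%:C) * w x = (b x)%:C * u x.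
Hypothesis decay_u : forall x, sqmod (u x) <= C * weight x ^+ 2.
Hypothesis decay_w : forall x, sqmod (w x) <= C * weight x ^+ 2.

Lemma decay_L2 v D : ccont v -> (forall x, sqmod (v x) <= D * weight x ^+ 2) -> L2 v.
Proof.
move=> cv dv; have W0 := @weight_gt0 R; apply: (@L2_weight _ _ D cv) => x.
apply: le_trans (dv x) _; have D0 : 0 <= D.
  by have := le_trans (sqmod_ge0 _) (dv x); rewrite pmulr_lge0// exprn_gt0.
by rewrite ler_wpM2l// expr2 ler_piMl// ?weight_le1// ltW.
Qed.

Let Lu : L2 u. Proof. by case: Cu => cu *; exact: decay_L2 cu decay_u. Qed.
Let Lw : L2 w. Proof. by case: Cw => cw *; exact: decay_L2 cw decay_w. Qed.
Let Liw : L2 (fun x => 'i%C * w x). Proof. exact: L2M Lw. Qed.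

Lemma L2_field_mode : L2 (fun x => (b x)%:C * u x).
Proof.
case: Cu => cu *; apply: (@decay_L2 _ (B ^+ 2 * C)) => [|x].
  by apply: ccontM => //; exact: ccont_real.
rewrite sqmodM sqmod_real -mulrA; apply: ler_pM; rewrite ?sqr_ge0 ?sqmod_ge0//.
rewrite -(real_normK (num_real (b x))) lerXn2r ?nnegrE//.
exact: le_trans (normr_ge0 _) (bB x).
Qed.

(** The pointwise bounds integrate against [weight]. Since [P_2 u = i w] has the modulus of [w],
    decay of [u] and [w] is enough. *)
Lemma mode_approx : exists (D : R) (phi : nat -> plane -> R[i]), 0 <= D /\ forall n,
  [/\ test_function (phi n), sqnorm (fun x => phi n x - u x) <= D / n.+1%:R,
      sqnorm (fun x => mgrad1 A (phi n) x - w x) <= D / n.+1%:R &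
      sqnorm (fun x => mgrad2 A (phi n) x - 'i%C * w x) <= D / n.+1%:R].
Proof.
have [|D D0 HD] := @smooth_approx R A cA1 cA2 u u1 u2 C Cu.
  by move=> x; rewrite Eu1 Eu2 sqmodM sqmod_i mul1r.
have /choice[phi Hphi] : forall n : nat, exists phi, test_function phi /\ forall x,
    [/\ sqmod (phi x - u x) <= D / n.+1%:R * weight x,
    sqmod (mgrad1 A phi x - w x) <= D / n.+1%:R * weight x &
    sqmod (mgrad2 A phi x - 'i%C * w x) <= D / n.+1%:R * weight x].
  move=> n; have [phi t h] := HD n; exists phi; split=> // x.
  by have := h x; rewrite Eu1 Eu2.
have IW0 : 0 <= I (@weight R) by apply: Rintegral_ge0 => x _; exact: ltW (weight_gt0 x).
exists (D * I (@weight R)), phi; split=> [|n]; first exact: mulr_ge0.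
have [t h] := Hphi n; have [Lp L1 L2] := test_L2 cA1 cA2 t.
split=> //; rewrite mulrAC; apply: sqnorm_weight_le => [|x]; try (by case: (h x)); exact: L2B.
Qed.

(** For [v] in the form domain with approximants [psi n], the magnetic gradients of [psi n] stay
    bounded because they are Cauchy. Replacing the gradients of [phi n] by their limits [w] and
    [i w] therefore costs little, the identity with the limits is exact against each test function,
    and what remains is [inner f (psi n - v)]. *)
Lemma mode_magnetic_op : magnetic_op A u (fun x => (b x)%:C * u x).
Proof.
have Lf := L2_field_mode.
have [D [phi [D0 Hphi]]] := mode_approx.
have Lphi n : [/\ L2 (phi n), L2 (mgrad1 A (phi n)) & L2 (mgrad2 A (phi n))].
  by have [t _ _ _] := Hphi n; exact: test_L2.
have approx : form_approx A phi u.
  split=> //.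
  - by move=> n; have [] := Hphi n.
  - apply: (@cvg0_harmonic_bound _ D) => n; have [_ h _ _] := Hphi n.
    by rewrite h andbT; exact: sqnorm_ge0.
  (* Beyond this index each approximation error is below [eps / 8]; four of them occur, each with a
     factor 2. *)
  move=> eps eps0; exists (Num.truncn (8 * D / eps)).+1 => m n Nm Nn.
  have [Lm Lm1 Lm2] := Lphi m; have [Ln Ln1 Ln2] := Lphi n.
  have [tm _ am1 am2] := Hphi m; have [tn _ an1 an2] := Hphi n.
  have [M1 [p1 [p2 [_ Cm _]]]] := test_function_C1 tm.
  have [M2 [q1 [q2 [_ Cn _]]]] := test_function_C1 tn.
  have [G1 G2] := mgradB A Cm Cn.
  have L1 := L2B Lm1 Ln1; have L2' := L2B Lm2 Ln2.
  rewrite qformE ?G1 ?G2//.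
  have tri v v' v0 : L2 v -> L2 v' -> L2 v0 ->
      sqnorm (fun x => v x - v' x) <= 2 * sqnorm (fun x => v x - v0 x) + 2 * sqnorm (fun x => v' x - v0 x).
    move=> Lv Lv' Lv0; have := sqnormB_le (L2B Lv Lv0) (L2B Lv' Lv0).
    suff -> : (fun x => v x - v0 x - (v' x - v0 x)) = (fun x => v x - v' x) by [].
    by apply/funext => x; ring.
  have t1 := tri _ _ _ Lm1 Ln1 Lw; have t2 := tri _ _ _ Lm2 Ln2 Liw.
  have small k : ((Num.truncn (8 * D / eps)).+1 <= k)%N -> D / k.+1%:R < eps / 8.
    move=> hk; have h : 8 * D / eps < k.+1%:R.
      by apply: lt_le_trans (truncnS_gt _) _; rewrite ler_nat leqW.
    by rewrite ltr_pdivrMr// mulrAC ltr_pdivlMr// mulrC [ltRHS]mulrC -ltr_pdivrMr.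
  exact: (cauchy_arith t1 t2 am1 am2 an1 an2 (small m Nm) (small n Nn)).
split=> //; first by exists phi.
move=> v [psi Hpsi]; exists phi, psi; split=> //.
case: Hpsi => Lv tpsi cpsi Cpsi.
have Lpsi n := test_L2 cA1 cA2 (tpsi n).
pose f := fun x => (b x)%:C * u x.
have [N HN] := Cpsi 1 ltr01.
(* From index [N] on, [psi n] differs from [psi N] by less than 1 in the form, and [sqnormD_le]
   doubles both contributions. *)
pose Q := 2 * qform A (psi N) + 2.
have bound n : (N <= n)%N -> sqnorm (mgrad1 A (psi n)) <= Q /\ sqnorm (mgrad2 A (psi n)) <= Q.
  move=> Nn; have [Ln Ln1 Ln2] := Lpsi n; have [LN LN1 LN2] := Lpsi N.
  have [M1 [p1 [p2 [_ Cn _]]]] := test_function_C1 (tpsi n).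
  have [M2 [q1 [q2 [_ CN _]]]] := test_function_C1 (tpsi N).
  have := HN n N Nn (leqnn N); have [G1 G2] := mgradB A Cn CN.
  have L1 := L2B Ln1 LN1; have L2' := L2B Ln2 LN2.
  rewrite qformE ?G1 ?G2// => h.
  have tri v' v0 : L2 v' -> L2 v0 -> sqnorm v' <= 2 * sqnorm (fun x => v' x - v0 x) + 2 * sqnorm v0.
    move=> Lv' Lv0; have E : v' = (fun x => v' x - v0 x + v0 x).
      by apply/funext => x; rewrite subrK.
    rewrite {1}E; exact: sqnormD_le (L2B Lv' Lv0) Lv0.
  have t1 := tri _ _ Ln1 LN1; have t2 := tri _ _ Ln2 LN2.
  have n1 := sqnorm_ge0 (fun x => mgrad1 A (psi n) x - mgrad1 A (psi N) x).
  have n2 := sqnorm_ge0 (fun x => mgrad2 A (psi n) x - mgrad2 A (psi N) x).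
  have n3 := sqnorm_ge0 (mgrad1 A (psi N)); have n4 := sqnorm_ge0 (mgrad2 A (psi N)).
  rewrite /Q qformE//; split; first exact: (bounded_arith t1 n2 n4 h).
  by rewrite [X in _ <= 2 * X + _]addrC; apply: (bounded_arith t2 n1 n3 _); rewrite addrC.
have Q0 : 0 <= Q by apply: le_trans (bound N (leqnn N)).1; exact: sqnorm_ge0.
pose beta n := sqnorm (fun x => psi n x - v x).
have main n : (N <= n)%N -> sqmod (sform A (phi n) (psi n) - inner f v) <=
    16 * Q * (D / n.+1%:R) + 4 * sqnorm f * beta n.
  move=> Nn; have [Lp L1 L2'] := Lphi n; have [Lq M1 M2] := Lpsi n.
  have [b1 b2] := bound n Nn; have [_ _ a1 a2] := Hphi n.
  have Ld1 := L2B L1 Lw; have Ld2 := L2B L2' Liw; have Ldv := L2B Lq Lv.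
  have e1 : mgrad1 A (phi n) = (fun x => mgrad1 A (phi n) x - w x + w x).
    by apply/funext => x; rewrite subrK.
  have e2 : mgrad2 A (phi n) = (fun x => mgrad2 A (phi n) x - 'i%C * w x + 'i%C * w x).
    by apply/funext => x; rewrite subrK.
  have i1 : inner (mgrad1 A (phi n)) (mgrad1 A (psi n)) =
      inner (fun x => mgrad1 A (phi n) x - w x) (mgrad1 A (psi n)) + inner w (mgrad1 A (psi n)).
    rewrite {1}e1; exact: innerD_l.
  have i2 : inner (mgrad2 A (phi n)) (mgrad2 A (psi n)) =
      inner (fun x => mgrad2 A (phi n) x - 'i%C * w x) (mgrad2 A (psi n)) +
      inner (fun x => 'i%C * w x) (mgrad2 A (psi n)).
    rewrite {1}e2; exact: innerD_l.
  have i3 : inner f (psi n) = inner f (fun x => psi n x - v x) + inner f v.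
    have e3 : psi n = (fun x => psi n x - v x + v x) by apply/funext => x; rewrite subrK.
    rewrite {1}e3; exact: innerD_r.
  have key := form_against_test cA1 cA2 Cw Ew Lw Lf (tpsi n).
  rewrite /sform; rewrite i1 i2 (add_rearrange _ _ key i3).
  have q1 := inner_cauchy_schwarz Ld1 M1; have q2 := inner_cauchy_schwarz Ld2 M2.
  have q3 := inner_cauchy_schwarz Lf Ldv.
  apply: le_trans (sqmodD_le _ _) _.
  have r1 : sqnorm (fun x => mgrad1 A (phi n) x - w x) * sqnorm (mgrad1 A (psi n)) <= D / n.+1%:R * Q.
    exact: (ler_pM (sqnorm_ge0 _) (sqnorm_ge0 _) a1 b1).
  have r2 : sqnorm (fun x => mgrad2 A (phi n) x - 'i%C * w x) * sqnorm (mgrad2 A (psi n)) <= D / n.+1%:R * Q.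
    exact: (ler_pM (sqnorm_ge0 _) (sqnorm_ge0 _) a2 b2).
  have := sqmodD_le (inner (fun x => mgrad1 A (phi n) x - w x) (mgrad1 A (psi n)))
     (inner (fun x => mgrad2 A (phi n) x - 'i%C * w x) (mgrad2 A (psi n))).
  move=> q12; exact: (limit_arith q12 q1 q2 q3 r1 r2).
apply: (@squeeze_cvgr _ _ _ _ (cst 0) (fun n => 16 * Q * (D / n.+1%:R) + 4 * sqnorm f * beta n)).
- near=> n; rewrite sqmod_ge0 /=; apply: main; near: n; exact: nbhs_infty_ge.
- exact: cvg_cst.
rewrite -[X in _ --> X]addr0 -[X in _ --> X + _](mulr0 (16 * Q)) -[X in _ --> _ + X](mulr0 (4 * sqnorm f)).
apply: cvgD; apply: cvgM; try exact: cvg_cst; last exact: cpsi.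
apply: (@cvg0_harmonic_bound _ D) => n; by rewrite lexx andbT divr_ge0.
Unshelve. all: by end_near. Qed.
End MagneticEigenfunction.

(** * Aharonov-Casher zero modes *)

Section AharonovCasher.
Variable R : realType.
Local Notation plane := (R * R)%type.
Implicit Types (f : plane -> R) (u : plane -> R[i]).

Lemma is_derive_comp1 f (g : R -> R) x d g' : is_derive x (@e1 R) f d ->
  is_derive (f x) (1 : R) g g' -> is_derive x (@e1 R) (fun x => g (f x)) (g' * d).
Proof.
move=> /is_derive_e1 H K; apply: (is_derive_e1 _ _ _).2; case: x => [r s] in H K *.
exact: (@is_derive1_comp R g (fun a => f (a, s)) r _ _ K H).
Qed.

Lemma is_derive_comp2 f (g : R -> R) x d g' : is_derive x (@e2 R) f d ->
  is_derive (f x) (1 : R) g g' -> is_derive x (@e2 R) (fun x => g (f x)) (g' * d).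
Proof.
move=> /is_derive_e2 H K; apply: (is_derive_e2 _ _ _).2; case: x => [r s] in H K *.
exact: (@is_derive1_comp R g (fun a => f (r, a)) s _ _ K H).
Qed.

Lemma is_derive_coords x : [/\ is_derive x (@e1 R) (fun x => x.1) 1, is_derive x (@e1 R) (fun x => x.2) 0,
  is_derive x (@e2 R) (fun x => x.1) 0 & is_derive x (@e2 R) (fun x => x.2) 1].
Proof.
split.
- apply: (is_derive_e1 _ _ _).2; exact: is_derive_id.
- apply: (is_derive_e1 _ _ _).2; exact: is_derive_cst.
- apply: (is_derive_e2 _ _ _).2; exact: is_derive_cst.
- apply: (is_derive_e2 _ _ _).2; exact: is_derive_id.
Qed.

Definition zcoord (x : plane) : R[i] := x.1 +i* x.2.

Lemma ccont_zcoord : ccont zcoord.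
Proof. by split=> x; [exact: cvg_fst|exact: cvg_snd]. Qed.

Lemma cderiv_zcoord x : cderiv (@e1 R) zcoord x 1 /\ cderiv (@e2 R) zcoord x 'i%C.
Proof. by have [h1 h2 h3 h4] := is_derive_coords x; split; split. Qed.

Lemma ccont_zcoordX k : ccont (fun x => zcoord x ^+ k).
Proof.
elim: k => [|k IH]; first exact: ccont_cst.
by under eq_fun do rewrite exprS; apply: ccontM; [exact: ccont_zcoord|exact: IH].
Qed.

(** The factor [i] between the two partials is the Cauchy-Riemann equation. At [k = 0] the truncated
    predecessor is harmless, its coefficient being 0. *)
Lemma cderiv_zcoordX k x : cderiv (@e1 R) (fun x => zcoord x ^+ k) x (k%:R * zcoord x ^+ k.-1) /\
  cderiv (@e2 R) (fun x => zcoord x ^+ k) x ('i%C * (k%:R * zcoord x ^+ k.-1)).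
Proof.
elim: k => [|k [IH1 IH2]].
  by rewrite mul0r mulr0; split; exact: cderiv_cst.
have [z1 z2] := cderiv_zcoord x.
have E : (fun x => zcoord x ^+ k.+1) = (fun x => zcoord x * zcoord x ^+ k) by apply/funext => y; rewrite exprS.
have D : zcoord x * (k%:R * zcoord x ^+ k.-1) + 1 * zcoord x ^+ k = k.+1%:R * zcoord x ^+ k.
  rewrite mulrCA -[k.+1]addn1 natrD mulrDl; congr (_ + _).
  by case: (k) => [|j]; [rewrite !mul0r|rewrite -exprS].
rewrite E; split.
  by rewrite -[X in cderiv _ _ _ X]D; exact: cderivM.
have -> : 'i%C * (k.+1%:R * zcoord x ^+ k.+1.-1) = zcoord x * ('i%C * (k%:R * zcoord x ^+ k.-1)) + 'i%C * zcoord x ^+ k.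
  by rewrite /= -D mulrDr mul1r mulrCA.
exact: cderivM.
Qed.

(* [E] stands for [exp(- phi + i chi)] with logarithmic derivatives [D1], [D2], and
   [Z], [Z1], [Z2] for [z^k] and its first two derivatives. *)
Lemma gauge_identity (K : comPzRingType) (i E Z Z1 Z2 p1 p2 c1 c2 b1 b2 : K) : i * i = - 1 ->
  let g := - (p2 + i * p1) * Z + i * Z1 in
  let D1 := - p1 + i * c1 in
  let D2 := - p2 + i * c2 in
  let g1 := - (p2 + i * p1) * Z1 + - (i * b1) * Z + i * Z2 in
  let g2 := - (p2 + i * p1) * (i * Z1) + - b2 * Z + i * (i * Z2) in
  [/\ i * (E * Z1 + E * D1 * Z) + (c1 - p2) * (E * Z) = E * g,
      i * (E * (i * Z1) + E * D2 * Z) + (c2 + p1) * (E * Z) = i * (E * g) &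
      i * (E * g1 + E * D1 * g) - (E * g2 + E * D2 * g) +
        ((c1 - p2) + i * (c2 + p1)) * (E * g) = (b1 + b2) * (E * Z)].
Proof. by move=> ii g D1 D2 g1 g2; split; rewrite /g /D1 /D2 /g1 /g2; ring: ii. Qed.

End AharonovCasher.

Section AharonovCasherModes.
Variables (R : realType) (t s : R).
Hypotheses (ht : 0 < t) (hs : 1 < s) (hst : s - 2 * t < 1).
Local Notation plane := (R * R)%type.
Local Notation beta := (cos_series t s).
Local Notation P := (Phi t s).
Local Notation dP := (dPhi t s).

Variable A : plane -> R * R.
Hypothesis hA : vector_potential (field_b t s) A.

Lemma potential_continuous : continuous (fun x => (A x).1) /\ continuous (fun x => (A x).2).
Proof. by case: hA => [[c1 _ _ _] [c2 _ _ _] _]. Qed.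

(** Read off from the curl equation, since [A] is C^1, rather than from the series. *)
Lemma field_continuous : continuous (field_b t s).
Proof.
case: hA => [[_ _ _ c1] [_ _ c2 _] E].
rewrite (_ : field_b t s = fun x => 'D_(@e1 R) (fun y => (A y).2) x - 'D_(@e2 R) (fun y => (A y).1) x).
  by move=> x; apply: cvgB; [exact: c2|exact: c1].
by apply/funext => x; rewrite E.
Qed.

(** On the diagonal the field equals [2 * beta y]. *)
Lemma beta_continuous : continuous beta.
Proof.
move=> y; apply/cvgrPdist_lt => e e0.
have [d d0 Hd] := (plane_continuousP _).1 field_continuous (y, y) e e0.
apply/nbhs_ballP; exists d => //= r hr; have := Hd (r, r) hr hr; rewrite /field_b /=.
have -> : beta y + beta y - (beta r + beta r) = 2 * (beta y - beta r) by ring.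
rewrite normrM ger0_norm//; apply: le_lt_trans; rewrite ler_peMl// ler1n//.
Qed.

Lemma comp_fst_continuous (g : R -> R) : continuous g -> continuous (fun x : plane => g x.1).
Proof. by move=> cg x; apply: (@cvg_comp _ _ _ fst g); [exact: cvg_fst|exact: cg]. Qed.

Lemma comp_snd_continuous (g : R -> R) : continuous g -> continuous (fun x : plane => g x.2).
Proof. by move=> cg x; apply: (@cvg_comp _ _ _ snd g); [exact: cvg_snd|exact: cg]. Qed.

Lemma derivable_continuous (g dg : R -> R) : (forall y, is_derive y (1 : R) g (dg y)) -> continuous g.
Proof. by move=> H y; apply: differentiable_continuous; apply/derivable1_diffP; case: (H y). Qed.

Let cP : continuous P. Proof. exact: derivable_continuous (is_derive_Phi t hs). Qed.
Let cdP : continuous dP. Proof. exact: derivable_continuous (is_derive_dPhi ht hs). Qed.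

Lemma gauge_exists : exists chi c1 c2 : plane -> R,
  [/\ continuous chi, continuous c1 /\ continuous c2,
    forall x, is_derive x (@e1 R) chi (c1 x), forall x, is_derive x (@e2 R) chi (c2 x) &
    forall x, A x = (c1 x - dP x.2, c2 x + dP x.1)].
Proof.
have [cA1 cA2] := potential_continuous; have cb := beta_continuous.
case: hA => [[_ D1 _ c12] [_ D2 c21 _] E].
pose c1 x := (A x).1 + dP x.2; pose c2 x := (A x).2 - dP x.1.
have cc1 : continuous c1 by move=> x; apply: cvgD; [exact: cA1|exact: comp_snd_continuous].
have cc2 : continuous c2 by move=> x; apply: cvgB; [exact: cA2|exact: comp_fst_continuous].
(* The common mixed derivative: the curl equation makes it equal to the second partial of [c1] as
   well, so [(c1, c2)] is curl-free. *)
pose d x := 'D_(@e1 R) (fun y => (A y).2) x - beta x.1.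
have cd : continuous d by move=> x; apply: cvgB; [exact: c21|exact: comp_fst_continuous].
have K2 x : is_derive x (@e1 R) c2 (d x).
  have [h _ _ _] := is_derive_coords x.
  have := is_deriveB (derivableP (D2 x).1) (is_derive_comp1 h (is_derive_dPhi ht hs x.1)).
  by rewrite mulr1.
have K1 x : is_derive x (@e2 R) c1 (d x).
  have [_ _ _ h] := is_derive_coords x.
  have := is_deriveD (derivableP (D1 x).2) (is_derive_comp2 h (is_derive_dPhi ht hs x.2)).
  rewrite mulr1 (_ : _ + beta x.2 = d x)// /d.
  by have := E x; rewrite /field_b => e; apply/eqP; rewrite eq_sym subr_eq -addrA [beta x.2 + _]addrC -e addrC subrK.
have [chi Hchi] := potential_exists cc1 cc2 cd K2 K1.
exists chi, c1, c2; split=> //; [|by move=> x; case: (Hchi x)|by move=> x; case: (Hchi x)|].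
  by apply: (C1_continuous cc1 cc2) => x; case: (Hchi x).
by move=> x; rewrite /c1 /c2 addrK subrK; case: (A x).
Qed.

Lemma field_bounded x : `|field_b t s x| <= 2 * limn (series (fun n : nat => n.+1%:R `^ (- s) : R)).
Proof.
rewrite mulr2n mulrDl mul1r /field_b; apply: le_trans (ler_normD _ _) _.
by apply: lerD; have [_] := cos_series_bound t hs (x.1); have [_] := cos_series_bound t hs (x.2).
Qed.

(** Since [1 / weight] is at most the square of [(1 + |x.1|) * (1 + |x.2|)], two extra powers before
    squaring yield [weight ^+ 2]. Each coordinate contributes a factor [C], and squaring gives
    [C ^+ 4]. *)
Lemma exp_potential_decay k : exists2 C, 0 <= C & forall x : plane,
  expR (- (P x.1 + P x.2)) ^+ 2 * ((1 + `|x.1|) * (1 + `|x.2|)) ^+ (k * 2) <= C * weight x ^+ 2.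
Proof.
have [C C0 HC] := Phi_decay ht hs hst (k + 2).
exists (C ^+ 4); first by rewrite exprn_ge0// ltW.
move=> x; set q := 1 + `|x.1|; set r := 1 + `|x.2|.
have q1 : 1 <= q by rewrite lerDl. have r1 : 1 <= r by rewrite lerDl.
have q0 : 0 < q by exact: lt_le_trans q1. have r0 : 0 < r by exact: lt_le_trans r1.
have W : (q * r) ^- 2 <= weight x.
  have o0 (a : R) : 0 < oneDsqr a by rewrite (lt_le_trans ltr01)// oneDsqr_ge1.
  have oq (a : R) : oneDsqr a <= (1 + `|a|) ^+ 2.
    rewrite /oneDsqr -(real_normK (num_real a)); have := normr_ge0 a; nra.
  rewrite /weight -invfM lef_pV2 ?posrE ?mulr_gt0 ?exprn_gt0 ?mulr_gt0//.
  by rewrite exprMn; apply: ler_pM; [exact: ltW (o0 _)|exact: ltW (o0 _)|exact: oq|exact: oq].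
have e (y : R) : (1 + `|y|) ^+ (k + 2) * expR (- P y) <= C.
  by rewrite expRN ler_pdivrMr ?expR_gt0// HC.
have h : (q * r) ^+ (k + 2) * expR (- (P x.1 + P x.2)) <= C ^+ 2.
  rewrite opprD expRD exprMn mulrACA expr2.
  by apply: ler_pM; rewrite ?mulr_ge0 ?exprn_ge0 ?expR_ge0 ?(ltW q0) ?(ltW r0)//; exact: e.
have qr0 : 0 < q * r by rewrite mulr_gt0.
have h2 : ((q * r) ^+ (k + 2) * expR (- (P x.1 + P x.2))) ^+ 2 <= C ^+ 4.
  rewrite -[4%N]/(2 * 2)%N exprM lerXn2r ?nnegrE ?exprn_ge0 ?(ltW C0)//.
  by rewrite mulr_ge0 ?exprn_ge0 ?expR_ge0 ?(ltW qr0).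
apply: le_trans (_ : _ <= C ^+ 4 * ((q * r) ^- 2) ^+ 2) _; last first.
  rewrite ler_wpM2l ?exprn_ge0 ?(ltW C0)// lerXn2r ?nnegrE ?invr_ge0 ?exprn_ge0 ?(ltW qr0)//.
  exact: ltW (weight_gt0 x).
have -> : ((q * r) ^- 2) ^+ 2 = ((q * r) ^+ 4)^-1 by rewrite exprVn -exprM.
rewrite ler_pdivlMr ?exprn_gt0//.
apply: le_trans h2; rewrite [leRHS]exprMn -[((q * r) ^+ (k + 2)) ^+ 2]exprM le_eqVlt; apply/orP; left; apply/eqP.
by rewrite -mulrA -exprD mulrC mulnDl.
Qed.

End AharonovCasherModes.

(** * The concrete modes, their gradients and decay *)

Section Modes.
Variables (R : realType) (t s : R).
Hypotheses (ht : 0 < t) (hs : 1 < s) (hst : s - 2 * t < 1).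
Local Notation plane := (R * R)%type.
Local Notation beta := (cos_series t s).
Local Notation P := (Phi t s).
Local Notation dP := (dPhi t s).

Variable A : plane -> R * R.
Hypothesis hA : vector_potential (field_b t s) A.

(* [exp (- phi + i chi)] with [phi x = P x.1 + P x.2]. *)
Definition gaussian_gauge (chi : plane -> R) (x : plane) : R[i] :=
  (expR (- (P x.1 + P x.2)) * cos (chi x)) +i* (expR (- (P x.1 + P x.2)) * sin (chi x)).

Section Gauge.
Variables chi c1 c2 : plane -> R.
Hypothesis cchi : continuous chi.
Hypothesis cc1 : continuous c1.
Hypothesis cc2 : continuous c2.
Hypothesis Hchi1 : forall x, is_derive x (@e1 R) chi (c1 x).
Hypothesis Hchi2 : forall x, is_derive x (@e2 R) chi (c2 x).
Hypothesis HAE : forall x, A x = (c1 x - dP x.2, c2 x + dP x.1).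

Let E := gaussian_gauge chi.
Let cP : continuous P. Proof. exact: derivable_continuous (is_derive_Phi t hs). Qed.
Let cdP : continuous dP. Proof. exact: derivable_continuous (is_derive_dPhi ht hs). Qed.
Let cb : continuous beta. Proof. exact: beta_continuous hA. Qed.

Lemma gauge_sqmod x : sqmod (E x) = expR (- (P x.1 + P x.2)) ^+ 2.
Proof. by rewrite /sqmod /= !exprMn -mulrDr cos2Dsin2 mulr1. Qed.

Lemma ccont_gauge : ccont E.
Proof.
have ce : continuous (fun x : plane => expR (- (P x.1 + P x.2))).
  move=> x; apply: (@cvg_comp _ _ _ (fun x : plane => - (P x.1 + P x.2)) expR); last exact: continuous_expR.
  by apply: cvgN; apply: cvgD; [exact: comp_fst_continuous|exact: comp_snd_continuous].
split=> x; apply: cvgM; try exact: ce.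
  by apply: (@cvg_comp _ _ _ chi cos); [exact: cchi|exact: continuous_cos].
by apply: (@cvg_comp _ _ _ chi sin); [exact: cchi|exact: continuous_sin].
Qed.

Lemma cderiv_gauge x : cderiv (@e1 R) E x (E x * (- (dP x.1)%:C + 'i%C * (c1 x)%:C)) /\
  cderiv (@e2 R) E x (E x * (- (dP x.2)%:C + 'i%C * (c2 x)%:C)).
Proof.
have [h1 h2 h3 h4] := is_derive_coords x.
have d1 : is_derive x (@e1 R) (fun x => - (P x.1 + P x.2)) (- dP x.1).
  have := is_deriveN (is_deriveD (is_derive_comp1 h1 (is_derive_Phi t hs x.1)) (is_derive_comp1 h2 (is_derive_Phi t hs x.2))).
  by rewrite mulr1 mulr0 addr0.
have d2 : is_derive x (@e2 R) (fun x => - (P x.1 + P x.2)) (- dP x.2).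
  have := is_deriveN (is_deriveD (is_derive_comp2 h3 (is_derive_Phi t hs x.1)) (is_derive_comp2 h4 (is_derive_Phi t hs x.2))).
  by rewrite mulr1 mulr0 add0r.
have x1 := is_derive_comp1 d1 (is_derive_expR _).
have x2 := is_derive_comp2 d2 (is_derive_expR _).
have a1 := is_derive_comp1 (Hchi1 x) (is_derive_cos _).
have a2 := is_derive_comp2 (Hchi2 x) (is_derive_cos _).
have b1 := is_derive_comp1 (Hchi1 x) (is_derive_sin _).
have b2 := is_derive_comp2 (Hchi2 x) (is_derive_sin _).
have fix_eq d (f : plane -> R) (p q : R) : is_derive x d f p -> p = q -> is_derive x d f q by move=> ? <-.
have r1 : complex.Re (E x) = expR (- (P x.1 + P x.2)) * cos (chi x) by [].
have r2 : complex.Im (E x) = expR (- (P x.1 + P x.2)) * sin (chi x) by [].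
split; split.
- apply: fix_eq (is_deriveM x1 a1) _; move: r1 r2; move: (E x) => z r1 r2.
  by rewrite !ReImE r1 r2 /GRing.scale /=; ring.
- apply: fix_eq (is_deriveM x1 b1) _; move: r1 r2; move: (E x) => z r1 r2.
  by rewrite !ReImE r1 r2 /GRing.scale /=; ring.
- apply: fix_eq (is_deriveM x2 a2) _; move: r1 r2; move: (E x) => z r1 r2.
  by rewrite !ReImE r1 r2 /GRing.scale /=; ring.
- apply: fix_eq (is_deriveM x2 b2) _; move: r1 r2; move: (E x) => z r1 r2.
  by rewrite !ReImE r1 r2 /GRing.scale /=; ring.
Qed.

Variable k : nat.
Let Z (x : plane) := zcoord x ^+ k.
Let Z1 (x : plane) := k%:R * zcoord x ^+ k.-1.
Let Z2 (x : plane) := k%:R * (k.-1%:R * zcoord x ^+ k.-1.-1).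
Let D1 x : R[i] := - (dP x.1)%:C + 'i%C * (c1 x)%:C.
Let D2 x : R[i] := - (dP x.2)%:C + 'i%C * (c2 x)%:C.
(** [E x * g x] is [P_1 u]. The gauge terms have cancelled, so [g] involves only [dPhi] and powers
    of [z]; its partials [g1] and [g2] are explicit and its growth is polynomial. *)
Let g x := - ((dP x.2)%:C + 'i%C * (dP x.1)%:C) * Z x + 'i%C * Z1 x.
Let g1 x := - ((dP x.2)%:C + 'i%C * (dP x.1)%:C) * Z1 x + - ('i%C * (beta x.1)%:C) * Z x + 'i%C * Z2 x.
Let g2 x := - ((dP x.2)%:C + 'i%C * (dP x.1)%:C) * ('i%C * Z1 x) + - (beta x.2)%:C * Z x + 'i%C * ('i%C * Z2 x).

Lemma mode_C1 : C1 (fun x => E x * Z x) (fun x => E x * Z1 x + E x * D1 x * Z x)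
  (fun x => E x * ('i%C * Z1 x) + E x * D2 x * Z x).
Proof.
have cE0 := ccont_gauge; have cZ : ccont Z by exact: ccont_zcoordX.
have cZ1 : ccont Z1 by apply: ccontM; [exact: ccont_cst|exact: ccont_zcoordX].
have cD1 : ccont D1.
  apply: ccontD; first by apply: ccontN; apply: ccont_real; exact: comp_fst_continuous.
  by apply: ccontM; [exact: ccont_cst|exact: ccont_real].
have cD2 : ccont D2.
  apply: ccontD; first by apply: ccontN; apply: ccont_real; exact: comp_snd_continuous.
  by apply: ccontM; [exact: ccont_cst|exact: ccont_real].
split.
- exact: ccontM.
- by apply: ccontD; [exact: ccontM|apply: ccontM => //; exact: ccontM].
- apply: ccontD; [|apply: ccontM => //; exact: ccontM].
  by apply: ccontM => //; apply: ccontM => //; exact: ccont_cst.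
- move=> x; exact: (cderivM (cderiv_gauge x).1 (cderiv_zcoordX k x).1).
- move=> x; exact: (cderivM (cderiv_gauge x).2 (cderiv_zcoordX k x).2).
Qed.

Lemma mode_gradient_C1 : C1 (fun x => E x * g x) (fun x => E x * g1 x + E x * D1 x * g x)
  (fun x => E x * g2 x + E x * D2 x * g x).
Proof.
have cE0 := ccont_gauge; have cZ : ccont Z by exact: ccont_zcoordX.
have cZ1 : ccont Z1 by apply: ccontM; [exact: ccont_cst|exact: ccont_zcoordX].
have cZ2 : ccont Z2.
  by apply: ccontM; [exact: ccont_cst|apply: ccontM; [exact: ccont_cst|exact: ccont_zcoordX]].
have ci (u : plane -> R[i]) : ccont u -> ccont (fun x => 'i%C * u x).
  by move=> cu; apply: ccontM => //; exact: ccont_cst.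
have q1 : ccont (fun x => (dP x.1)%:C) by apply: ccont_real; exact: comp_fst_continuous.
have q2 : ccont (fun x => (dP x.2)%:C) by apply: ccont_real; exact: comp_snd_continuous.
have r1 : ccont (fun x => (beta x.1)%:C) by apply: ccont_real; exact: comp_fst_continuous.
have r2 : ccont (fun x => (beta x.2)%:C) by apply: ccont_real; exact: comp_snd_continuous.
have cD1 : ccont D1 by apply: ccontD; [exact: ccontN|apply: ci; exact: ccont_real].
have cD2 : ccont D2 by apply: ccontD; [exact: ccontN|apply: ci; exact: ccont_real].
have cq : ccont (fun x => - ((dP x.2)%:C + 'i%C * (dP x.1)%:C)).
  by apply: ccontN; apply: ccontD => //; exact: ci.
have cg : ccont g by apply: ccontD; [exact: ccontM|exact: ci].
have cg1 : ccont g1.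
  apply: ccontD; last exact: ci.
  by apply: ccontD; apply: ccontM => //; apply: ccontN; exact: ci.
have cg2 : ccont g2.
  apply: ccontD; last by apply: (ci _ (ci _ _)).
  by apply: ccontD; apply: ccontM => //; [exact: ci|exact: ccontN].
have dN d (u : plane -> R[i]) x z : cderiv d u x z -> cderiv d (fun x => - u x) x (- z).
  move=> h; have := cderivM (cderiv_cst d (-1) x) h; rewrite mul0r addr0 mulN1r.
  by under eq_fun do rewrite mulN1r.
have di d (u : plane -> R[i]) x z : cderiv d u x z -> cderiv d (fun x => 'i%C * u x) x ('i%C * z).
  by move=> h; have := cderivM (cderiv_cst d 'i%C x) h; rewrite mul0r addr0.
have dg1 x : cderiv (@e1 R) g x (g1 x).
  have [h1 h2 h3 h4] := is_derive_coords x.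
  have e1 := cderiv_real (is_derive_comp1 h1 (is_derive_dPhi ht hs x.1)).
  have e2 := cderiv_real (is_derive_comp1 h2 (is_derive_dPhi ht hs x.2)).
  have := cderivD (cderivM (dN _ _ _ _ (cderivD e2 (di _ _ _ _ e1))) (cderiv_zcoordX k x).1)
    (di _ _ _ _ (cderivM (cderiv_cst (@Defs.e1 R) (k%:R : R[i]) x) (cderiv_zcoordX k.-1 x).1)).
  by rewrite mulr1 mulr0 mul0r !add0r !addr0.
have dg2 x : cderiv (@e2 R) g x (g2 x).
  have [h1 h2 h3 h4] := is_derive_coords x.
  have e1 := cderiv_real (is_derive_comp2 h3 (is_derive_dPhi ht hs x.1)).
  have e2 := cderiv_real (is_derive_comp2 h4 (is_derive_dPhi ht hs x.2)).
  have := cderivD (cderivM (dN _ _ _ _ (cderivD e2 (di _ _ _ _ e1))) (cderiv_zcoordX k x).2)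
    (di _ _ _ _ (cderivM (cderiv_cst (@Defs.e2 R) (k%:R : R[i]) x) (cderiv_zcoordX k.-1 x).2)).
  by rewrite mulr1 !mulr0 mul0r !addr0 [k%:R * ('i%C * _)]mulrCA.
split.
- exact: ccontM.
- by apply: ccontD; [exact: ccontM|apply: ccontM => //; exact: ccontM].
- by apply: ccontD; [exact: ccontM|apply: ccontM => //; exact: ccontM].
- move=> x; exact: (cderivM (cderiv_gauge x).1 (dg1 x)).
- move=> x; exact: (cderivM (cderiv_gauge x).2 (dg2 x)).
Qed.

(** A majorant that factors over the coordinates, to match the decay of the exponential. *)
Lemma sqmod_zcoordX j (x : plane) : sqmod (zcoord x ^+ j) <= ((1 + `|x.1|) * (1 + `|x.2|)) ^+ (j * 2).
Proof.
have h : sqmod (zcoord x) <= ((1 + `|x.1|) * (1 + `|x.2|)) ^+ 2.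
  rewrite /sqmod /= -(real_normK (num_real x.1)) -(real_normK (num_real x.2)).
  have := normr_ge0 x.1; have := normr_ge0 x.2; set a := `|x.1|; set c := `|x.2| => c0 a0.
  have ac : 0 <= a * c by exact: mulr_ge0.
  have q : 0 <= 1 + a + c + a * c by lra.
  have -> : (1 + a) * (1 + c) = 1 + a + c + a * c by ring.
  have l : (a + c) ^+ 2 <= (1 + a + c + a * c) ^+ 2 by rewrite lerXn2r ?nnegrE; lra.
  have : (a + c) ^+ 2 = a ^+ 2 + c ^+ 2 + 2 * (a * c) by ring.
  by move: l; lra.
elim: j => [|j IH]; first by rewrite mul0n !expr0 /sqmod !ReImE expr1n expr0n addr0.
rewrite exprS sqmodM mulSn exprD; apply: ler_pM => //; exact: sqmod_ge0.
Qed.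

Lemma mode_decay : exists C, forall x, sqmod (E x * Z x) <= C * weight x ^+ 2 /\
  sqmod (E x * g x) <= C * weight x ^+ 2.
Proof.
(* One power more than [z^k], because [g] contains [dPhi], of linear growth, times [z^k]. *)
have [C C0 HC] := exp_potential_decay ht hs hst (k.+1).
pose S := limn (series (fun n : nat => n.+1%:R `^ (- s) : R)).
have HS y : `|dP y| <= S * `|y| by have [_] := dPhi_bound t hs y.
have S0 : 0 <= S by have := HS 1; rewrite normr1 mulr1; apply: le_trans.
(* 1 serves for the mode itself; [2 * S ^+ 2] and [2 * k%:R ^+ 2] serve for the two summands of
   [g]. *)
pose K := 1 + 2 * S ^+ 2 + 2 * k%:R ^+ 2.
have Sq := sqr_ge0 S; have kq := sqr_ge0 (k%:R : R).
have K1 : 1 <= K by rewrite /K; lra.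
exists (C * K) => x; set q := (1 + `|x.1|) * (1 + `|x.2|).
have q1 : 1 <= q by rewrite /q mulr_ege1// lerDl.
have q0 : 0 <= q by apply: le_trans q1.
have fin z : sqmod z <= K * q ^+ (k.+1 * 2) -> sqmod (E x * z) <= C * K * weight x ^+ 2.
  move=> hz; rewrite sqmodM gauge_sqmod; apply: le_trans (ler_wpM2l (sqr_ge0 _) hz) _.
  rewrite mulrCA (_ : C * K * weight x ^+ 2 = K * (C * weight x ^+ 2)); last by ring.
  by apply: ler_wpM2l; [exact: le_trans K1|exact: HC].
have zk := sqmod_zcoordX k x; rewrite -/q in zk.
have qk : 0 <= q ^+ (k.+1 * 2) by rewrite exprn_ge0.
have up j : (j <= k.+1)%N -> q ^+ (j * 2) <= q ^+ (k.+1 * 2).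
  by move=> jk; apply: ler_weXn2l => //; rewrite leq_mul2r jk orbT.
split; apply: fin.
  apply: le_trans zk _; apply: le_trans (up k _) _ => //.
  by rewrite ler_peMl.
apply: le_trans (sqmodD_le _ _) _; rewrite !sqmodM sqmodN sqmod_i mul1r.
have z1 : sqmod (zcoord x ^+ k.-1) <= q ^+ (k.+1 * 2).
  apply: le_trans (sqmod_zcoordX _ x) (up _ _); exact: leq_trans (leq_pred k) (leqnSn k).
have kk : sqmod (k%:R : R[i]) = k%:R ^+ 2.
  by rewrite -(sqmod_real (k%:R : R)) (rmorph_nat (real_complex R)).
have dd : sqmod ((dP x.2)%:C + 'i%C * (dP x.1)%:C) <= S ^+ 2 * q ^+ 2.
  have -> : sqmod ((dP x.2)%:C + 'i%C * (dP x.1)%:C) = dP x.2 ^+ 2 + dP x.1 ^+ 2.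
    by rewrite /sqmod !ReImE; ring.
  have h y : dP y ^+ 2 <= S ^+ 2 * y ^+ 2.
    rewrite -exprMn -(real_normK (num_real (dP y))) -[leRHS](real_normK (num_real _)).
    by rewrite lerXn2r ?nnegrE// normrM (ger0_norm S0).
  apply: le_trans (lerD (h x.2) (h x.1)) _; rewrite -mulrDr ler_wpM2l//.
  by have := sqmod_zcoordX 1 x; rewrite expr1 /sqmod /= addrC -/q.
have T1 : sqmod ((dP x.2)%:C + 'i%C * (dP x.1)%:C) * sqmod (Z x) <= S ^+ 2 * q ^+ (k.+1 * 2).
  rewrite mulSn exprD mulrA; apply: ler_pM => //; exact: sqmod_ge0.
have T2 : sqmod (k%:R : R[i]) * sqmod (zcoord x ^+ k.-1) <= k%:R ^+ 2 * q ^+ (k.+1 * 2).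
  by rewrite kk ler_wpM2l.
apply: le_trans (lerD (ler_wpM2l (ler0n _ 2) T1) (ler_wpM2l (ler0n _ 2) T2)) _.
rewrite /K; move: qk; set Q := q ^+ _ => Q0; lra.
Qed.

Lemma gauge_mode_magnetic_op :
  magnetic_op A (fun x => E x * Z x) (fun x => (field_b t s x)%:C * (E x * Z x)).
Proof.
have [C HC] := mode_decay; have [cA1 cA2] := potential_continuous hA.
have id x := gauge_identity (E x) (Z x) (Z1 x) (Z2 x) (dP x.1)%:C (dP x.2)%:C
  (c1 x)%:C (c2 x)%:C (beta x.1)%:C (beta x.2)%:C (sqr_i R).
have eA x : (A x).1%:C = (c1 x)%:C - (dP x.2)%:C /\ (A x).2%:C = (c2 x)%:C + (dP x.1)%:C.
  by rewrite HAE /=; split; apply: complex_ext; rewrite !ReImE ?subr0 ?addr0.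
apply: (mode_magnetic_op cA1 cA2 (field_continuous hA) (field_bounded t hs) mode_C1 mode_gradient_C1
   (C := C)) => x; try (by case: (HC x)); have [a1 a2] := eA x; have [i1 i2 i3] := id x; rewrite ?a1 ?a2 ?i1 ?i2 ?i3 //.
congr (_ * _); by apply: complex_ext; rewrite !ReImE ?addr0.
Qed.
End Gauge.
End Modes.

(** * Linear independence of the modes *)

Section LinearIndependence.
Variable R : realType.
Local Notation plane := (R * R)%type.
Local Notation area := ((@lebesgue_measure R \x @lebesgue_measure R)%E).

(* A nonzero polynomial has finitely many roots, and the points where the identity
   holds have unbounded abscissa. *)
Lemma ae_root_eq0 (p : {poly R[i]}) : {ae area, forall x, root p (zcoord x)} -> p = 0.
Proof.
move=> H; apply/eqP; apply: contraT => p0.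
have [r [sr ur rr]] : exists r : seq R[i], [/\ size r = size p, uniq r & all (root p) r].
  elim: (size p) => [|m [r [sr ur rr]]]; first by exists [::].
  (* An abscissa beyond the sum of all [|Re z|] exceeds that of every root found so far, so the new
     root is distinct from them. *)
  have [x px xK] := ae_exists_right (\sum_(z <- r) `|complex.Re z|) H.
  exists (zcoord x :: r); split; rewrite /= ?sr ?px// ur andbT; apply/negP => xr.
  have : `|complex.Re (zcoord x)| <= \sum_(z <- r) `|complex.Re z|.
    rewrite (big_rem (zcoord x))//= lerDl sumr_ge0//.
  by rewrite leNgt (lt_le_trans xK)// ler_norm.
by have := max_poly_roots p0 rr ur; rewrite sr ltnn.
Qed.

Lemma gauge_neq0 t s (chi : plane -> R) x : gaussian_gauge t s chi x != 0.
Proof.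
apply: contraTneq (expR_gt0 (- (Phi t s x.1 + Phi t s x.2))) => E0.
have := gauge_sqmod t s chi x; rewrite E0 /sqmod /= expr0n addr0 => /esym/eqP.
by rewrite sqrf_eq0 => /eqP ->; rewrite ltxx.
Qed.
End LinearIndependence.

Theorem theorem4p6 (R : realType) (t s : R) (ht : 0 < t) (hs : 1 < s)
    (hst : s - 2 * t < 1) (A : R * R -> R * R)
    (hA : vector_potential (field_b t s) A) :
  infinite_dim (pauli_ker A (field_b t s)).
Proof.
move=> n; have [chi [c1 [c2 [cchi [cc1 cc2] H1 H2 HA]]]] := gauge_exists ht hs hA.
pose E := gaussian_gauge t s chi.
have [cA1 cA2] := potential_continuous hA.
pose u k (x : R * R) : R[i] := E x * zcoord x ^+ k.
exists (fun k : 'I_n => (u k, fun=> 0)); split=> [k|c Hc _ j].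
  (* The zero lower component must itself lie in the graph; this is the previous criterion applied
     to the zero mode. *)
  have zero_op : magnetic_op A (fun=> 0) (fun x => (field_b t s x)%:C * 0).
    apply: (@mode_magnetic_op R A cA1 cA2 (field_b t s) _ 0 (fun=> 0) (fun=> 0) (fun=> 0) (fun=> 0)
      (fun=> 0) (fun=> 0) (field_continuous hA) (field_bounded t hs)).
    - by split; try exact: ccont_cst; move=> x; exact: cderiv_cst.
    - by split; try exact: ccont_cst; move=> x; exact: cderiv_cst.
    - by move=> x; rewrite !mulr0 addr0.
    - by move=> x; rewrite !mulr0 addr0.
    - by move=> x; rewrite !mulr0 subrr addr0.
    - by move=> x; rewrite /sqmod !ReImE expr0n addr0 mul0r.
    - by move=> x; rewrite /sqmod !ReImE expr0n addr0 mul0r.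
  exists (fun x => (field_b t s x)%:C * u k x), (fun x => (field_b t s x)%:C * 0); split=> //=.
  - exact: (gauge_mode_magnetic_op ht hs hst hA cchi cc1 cc2 H1 H2 HA k).
  - by apply: aeW => x; rewrite subrr.
  - by apply: aeW => x; rewrite mulr0 addr0.
(* After division by the nowhere vanishing [E], the combination of modes is this polynomial
   evaluated at [z]; [insub] extends the coefficients from ordinals to all indices. *)
pose p : {poly R[i]} := \poly_(i < n) (if insub i is Some i' then c i' else 0).
have p0 : p = 0.
  apply: ae_root_eq0; case: Hc => N [mN N0 sub]; exists N; split=> //.
  apply: subset_trans sub; apply: subsetC => x /= Hx; rewrite /root horner_poly.
  have : E x * \sum_(i < n) c i * zcoord x ^+ i = 0.
    by rewrite mulr_sumr -[RHS]Hx; apply: eq_bigr => i _; rewrite /u mulrCA.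
  move/eqP; rewrite mulf_eq0 (negbTE (gauge_neq0 t s chi x)) /= => /eqP Sx.
  by rewrite -[X in _ == X]Sx; apply/eqP; apply: eq_bigr => i _; rewrite valK.
have := coef_poly n (fun i => if insub i is Some i' then c i' else 0) j.
by rewrite -/p p0 coef0 ltn_ord valK => <-.
Qed.
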